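(* Let $a,b$ be positive integers with $b>a$. There is an algebraic isomorphism $\Phi^{\mathcal R\to\mathcal E}_{a,b}:\mathcal R^F_{a,b}\xrightarrow{\sim}\mathcal E_{a,b}$ between the frieze-compatible reduced wild representation variety $\mathcal R^F_{a,b}$, parametrising frieze-compatible reduced Stokes representations with irregular class $\Theta_{a,b}$, and the moduli space $\mathcal E_{a,b}$ of superperiodic linear difference equations of type $(a,b)$, given as follows: if $\rho\in\mathcal R^F_{a,b}$ has nontrivial Stokes matrix entries $s_i^j$ for $i\in\mathbb Z/b\mathbb Z$ and $j\in\{1,\dots,a-1\}$, the coefficients $\alpha_i^j$ of the corresponding superperiodic linear difference equation are given by $$\alpha_i^j=\varepsilon_i^j\,s_i^j,\qquad \varepsilon_i^j\in\{\pm1\},$$ for $i\in\{a+1,\dots,a+b\}$, $j\in\{1,\dots,a-1\}$ (extended to $i\in\mathbb Z$ by $b$-periodicity), with the signs explicitly determined by $$\varepsilon_i^j=\varepsilon_i\,\varepsilon_{i-j}\,(-1)^{j-1}\,\eta_i^j,$$ where $\varepsilon_m$ ($1\le m\le a+b$) and $\eta_i^j$ are the signs defined in the context. This isomorphism lifts the isomorphism $\mathcal B_{a,b}\simeq\mathcal P_{a,b}$ between the wild character variety $\mathcal B_{a,b}$, parametrising isomorphism classes of Stokes local systems with irregular class $\Theta_{a,b}$, and the moduli space $\mathcal P_{a,b}$ of nondegenerate $b$-gons in $\mathbb P^{a-1}$, induced by the equivalence between Stokes local systems and (recessive solutions of) Stokes filtered local systems with irregular class $\Theta_{a,b}$. Namely,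 the diagram $$\begin{array}{ccc}\mathcal R^F_{a,b}&\xrightarrow{\ \sim\ }&\mathcal E_{a,b}\\ \downarrow&&\downarrow\\ \mathcal B_{a,b}&\xrightarrow{\ \sim\ }&\mathcal P_{a,b}\end{array}$$ commutes, where the left vertical map is the quasi-Hamiltonian reduction from Stokes representations to Stokes local systems (amounting to forgetting the framing). Moreover, if $a$ and $b$ are coprime, we have $\mathcal R^F_{a,b}=\mathcal B_{a,b}$, hence $\mathcal F_{a,b}\simeq\mathcal E_{a,b}\simeq\mathcal B_{a,b}$, where $\mathcal F_{a,b}$ is the moduli space of tame frieze patterns of type $(a,b)$. In this case, the vertical maps in the diagram are isomorphisms.
   Context: **Notation.** $p=\gcd(a,b)$, $r=a/p$, $s=b/p$. For $i\in\mathbb Z$: $q_i=e^{2\pi\sqrt{-1}\,i/a}z^{b/a}$, with $q_i(Re^{\sqrt{-1}\theta})=R^{b/a}e^{\sqrt{-1}(2\pi i+b\theta)/a}$ (depends only on $i$ mod $a$). The irregular class $\Theta_{a,b}$ at $\infty$ on $\mathbb P^1$ has exponential factors $q_i$, $i\in\mathbb Z/a$, each of multiplicity one. $\theta_{i,l}=\frac{2\pi}b(-i+l\frac a2)$; for $l$ odd, $q_i$ has the most rapid decay at angle $\theta_{i,l}$. **Stokes arrows.** $\theta\in\mathbb R$ is a singular angle if $(q_k-q_{k'})(e^{\sqrt{-1}\theta})\in\mathbb R_{<0}$ for some $k\not\equiv k'$ mod $a$; then write $k'\to_\theta k$. All arrows are of the form $i\to i-j$ at $\theta^j_{i,l}:=\frac{2\pi}b(-i+\frac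 a4+\frac j2+l\frac a2)$ with $i\in\mathbb Z$, $l$ odd, $1\le j\le a-1$. **Reduced Stokes representations.** Fix a reference pair $(i_0,l_0)\in\mathbb Z^2$, $l_0$ odd, and $\vartheta>\theta_{i_0,l_0}$ sufficiently close to $\theta_{i_0,l_0}$. Let $\theta_1<\dots<\theta_N$ be the singular angles in $(\vartheta,\vartheta+2\pi)$. Matrices have rows and columns indexed by $\mathbb Z/a$. A Stokes representation of type $\Theta_{a,b}$ is a tuple $\rho=(h,S_1,\dots,S_N)$ of invertible matrices with $hS_N\cdots S_1=1$, where $S_m$ has $1$'s on the diagonal and vanishing $(k,k')$ off-diagonal entry unless $k'\to_{\theta_m}k$, and $h_{k,k'}\ne0$ iff $k\equiv k'+b$ mod $a$. It is reduced if $h_{k+b,k}=1$ unless $k+b$ is congruent mod $a$ to one of $i_0,\dots,i_0+p-1$. Its reduced formal monodromy is $\breve h=(\breve h_1,\dots,\breve h_p)$, $\breve h_m=h_{i_0+m-1,\,i_0+m-1-b}$. $\breve{\mathcal R}_{a,b}$ is the variety of reduced Stokes representations; $\mathcal R^F_{a,b}\subset\breve{\mathcal R}_{a,b}$ is the closed subvariety of frieze-compatible ones, given by $\breve h_m=\varepsilon^F_{a,b}:=(-1)^{(s-r)(a-1)}$ for all $m$. The torus $\breve H=(\mathbb C^* )^p$ acts on $\breve{\mathcal R}_{a,b}$ by simultaneous conjugation by diagonal matrices whose $k$-th entry depends only on $k$ mod $p$ (change of minimal framing); $\breve{\mathcal R}_{a,b}$ is a quasi-Hamiltonian $\breve H$-space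 with momentum map $\rho\mapsto\breve h^{-1}$. The wild character variety is $\mathcal B_{a,b}=\breve{\mathcal R}_{a,b}/\!/\breve H$. **Stokes matrix entries.** For $i\in\mathbb Z$, $l$ odd, $1\le j\le a-1$, choose $n\in\mathbb Z$ with $\theta^j_{i,l}+2\pi n=\theta_m\in(\vartheta,\vartheta+2\pi)$; $s^j_{i,l}$ is the entry of $S_m$ in row $i-j-nb$ and column $i-nb$ (mod $a$). Put $s_i^j:=s^j_{i_0+i-1,l_0}$, which is $b$-periodic in $i$. **Signs.** For $1\le m\le p$ put $k_m=l_m=0$. For $p+1\le m\le a+b$ write uniquely $m=\iota_m+k_m a-l_m b$ with $\iota_m\in\{1,\dots,p\}$, $k_m\in\{1,\dots,s\}$ and $l_m\ge0$ an integer. Put $\varepsilon_m=(-1)^{(a-1)(k_m+l_m)}$. Let $(h_1,\dots,h_a)$ be given by $h_m=\varepsilon^F_{a,b}$ for $1\le m\le p$ and $h_m=1$ for $p<m\le a$. For $a+1\le i\le a+b$ and $1\le j\le a-1$ put $\eta_i^j=1$ if $i-j\le b$ and $\eta_i^j=h_{i-b}^{-1}h_{i-b-j}$ if $i-j>b$. **Recessive lines.** A Stokes filtered local system of type $\Theta_{a,b}$ is determined by its recessive lines, i.e. the lines of solutions of slowest growth at the $b$ directions $[\theta_{i,l}]$, $l$ odd. For the Stokes representation $\rho$ these are computed as follows: for $\theta\in[\vartheta,\vartheta+2\pi)$ let $u_k(\theta)\in\mathbb C^a$ be the $k$-th column of $(S_m\cdots S_1)^{-1}$ for $\theta_m<\theta<\theta_{m+1}$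 (with the obvious conventions before $\theta_1$ and after $\theta_N$). For $1\le m\le b$ let $v'_m=u_{i_0+m-1-b}(\theta_{i_0+m-1,l_0}+2\pi)$ (this column does not jump at that angle); $\mathbb Cv'_m$ is the recessive line at direction $[\theta_{i_0+m-1,l_0}]$. The bottom map $\mathcal B_{a,b}\to\mathcal P_{a,b}$ sends the class of $\rho$ to the class of $(\mathbb Cv'_1,\dots,\mathbb Cv'_b)$. **Superperiodic difference equations.** $\mathcal E_{a,b}$ is the affine variety of systems $v_i=\alpha_i^1v_{i-1}-\alpha_i^2v_{i-2}+\dots+(-1)^{a-2}\alpha_i^{a-1}v_{i-a+1}+(-1)^{a-1}v_{i-a}$ ($i\in\mathbb Z$), with $\alpha_i^j\in\mathbb C$, $\alpha^j_{i+b}=\alpha_i^j$, all of whose solutions satisfy $v_{i+b}=(-1)^{a-1}v_i$. The map $\mathcal E_{a,b}\to\mathcal P_{a,b}$ sends an equation to the class of the $b$-gon $(v_1,\dots,v_b)$, where $v_i\in\mathbb C^a$ collects the $i$-th values of a basis of solutions. **$\mathcal P_{a,b}$** is the moduli space of $b$-tuples of points in $\mathbb P^{a-1}$ such that any $a$ cyclically consecutive ones are linearly independent, modulo projective transformations. **$\mathcal F_{a,b}$** is the moduli space of tame $\mathrm{SL}_a$-friezes of width $b-a-1$: infinite arrays with $b-a-1$ nontrivial rows bounded above and below by a row of $1$'s and then $a-1$ rows of $0$'s, all of whose adjacent $a\times a$ minors equal $1$ and all of whose adjacent $(a+1)\times(a+1)$ minors vanish. It is known (Morier-Genoud–Ovsienko–Schwartz–Tabachnikov)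 that $\mathcal F_{a,b}\simeq\mathcal E_{a,b}$.
   Formalization: The sign η_i^j is corrected: it equals h_{i-b}^{-1}h_{i-b-j} only if i-j>b and also θ^j_{i_0+i-1,l_0}+2π ≤ θ_{i_0,l_0}, and 1 otherwise; the printed rule (i-j>b alone) fails, e.g. for (a,b)=(4,5), i=7, j=1. *)

(* Defs.v *)
From mathcomp Require Import all_boot all_order all_algebra.
From mathcomp Require Import complex.
From mathcomp Require Import all_classical all_reals all_analysis.

Set Implicit Arguments.
Unset Strict Implicit.
Unset Printing Implicit Defensive.

Import Order.TTheory GRing.Theory Num.Theory.
Import numFieldNormedType.Exports.

Local Open Scope classical_set_scope.
Local Open Scope ring_scope.

(******************************************************************************)
(* Rank: the integer a >= 1 is written n.+1 throughout, so that n = a - 1.    *)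
(* The index set Z/a is 'I_n.+1, an integer being sent to its residue by      *)
(* residue. A superscript j in {1, ..., a - 1} is a natural number where the  *)
(* formulas use its value; families of scalars indexed by it are indexed by   *)
(* 'I_n, the element j : 'I_n standing for the superscript j.+1.              *)
(******************************************************************************)

Section AffineVarieties.
Variable K : fieldType.

(* The coordinate ring of X generated by the functions in G. Functions are    *)
(* defined on the ambient type and only their values on X matter. Inverting   *)
(* nowhere vanishing functions adds nothing when X is Zariski closed and K is *)
(* algebraically closed; for a principal open subset it adds the inverse of   *)
(* the defining function.                                                     *)
Inductive generated (T : Type) (X : set T) (G : set (T -> K)) :
    (T -> K) -> Prop :=
| gen_base f : G f -> generated X G f
| gen_const c : generated X G (fun=> c)
| gen_add f g : generated X G f -> generated X G g ->
    generated X G (fun x => f x + g x)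
| gen_mul f g : generated X G f -> generated X G g ->
    generated X G (fun x => f x * g x)
| gen_inv f : generated X G f -> (forall x, X x -> f x != 0) ->
    generated X G (fun x => (f x)^-1)
| gen_ext f g : generated X G f -> (forall x, X x -> f x = g x) ->
    generated X G g.

(* An affine variety, given by its set of closed points and its ring of       *)
(* regular functions.                                                         *)
Record variety := Variety {
  ambient : Type;
  points : set ambient;
  regfun : set (ambient -> K) }.

Definition affine_variety (T : Type) (X : set T) (G : set (T -> K)) :=
  {| ambient := T; points := X; regfun := generated X G |}.

Definition isomorphism (X Y : variety) (F : ambient X -> ambient Y) : Prop :=
  set_bij (@points X) (@points Y) F /\
  forall f : ambient Y -> K, regfun f <-> @regfun X (fun x => f (F x)).

Definition isomorphic (X Y : variety) : Prop :=
  exists F : ambient X -> ambient Y, isomorphism F.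

(* The affine quotient X // G by a reductive group whose orbits are the       *)
(* classes of E: its ring of regular functions is the ring of invariants and  *)
(* its points are the classes of points of X that the invariants do not       *)
(* separate (each of them contains exactly one closed orbit).                 *)
Section GITQuotient.
Variables (X : variety) (E : ambient X -> ambient X -> Prop).

Definition invariant (f : ambient X -> K) : Prop :=
  regfun f /\ forall x y, points x -> points y -> E x y -> f x = f y.

Definition git_equiv (x y : ambient X) : Prop :=
  forall f, invariant f -> f x = f y.

Definition git_class (x : ambient X) : set (ambient X) :=
  [set y | points y /\ git_equiv x y].

Definition git_quotient : variety := {|
  ambient := set (ambient X);
  points := [set git_class x | x in @points X];
  regfun := fun f => regfun (fun x => f (git_class x)) |}.

End GITQuotient.

(* f induces a bijection between the orbits in X and the orbits in Y.         *)
Definition orbit_bijection (X Y : variety) (EX : ambient X -> ambient X -> Prop)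
    (EY : ambient Y -> ambient Y -> Prop) (f : ambient X -> ambient Y) : Prop :=
  [/\ forall x, points x -> points (f x),
      forall x x', points x -> points x' -> (EX x x' <-> EY (f x) (f x')) &
      forall y, points y -> exists2 x, points x & EY (f x) y].

End AffineVarieties.

Section StokesData.
Variables (R : realType) (n b : nat).
Local Notation C := R[i].
Local Notation a := n.+1.

Definition residue (z : int) : 'I_n.+1 := inord `|(z %% a%:Z)%Z|%N.

Definition gab : nat := gcdn a b.
Definition rab : nat := (a %/ gab)%N.
Definition sab : nat := (b %/ gab)%N.

(* The value of q_i at the point exp(sqrt(-1) t) of angle t.                  *)
Definition exp_factor (i : int) (t : R) : C :=
  (cos ((2 * pi * i%:~R + b%:R * t) / a%:R) +i*
   sin ((2 * pi * i%:~R + b%:R * t) / a%:R))%C.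

(* stokes_arrow t k' k is k' ->_t k. In R[i], z < 0 means that z is real and  *)
(* negative.                                                                  *)
Definition stokes_arrow (t : R) (k' k : 'I_n.+1) : Prop :=
  exp_factor k%:Z t - exp_factor k'%:Z t < 0.

Definition singular_angle (t : R) : Prop :=
  exists k' k : 'I_n.+1, k' != k /\ stokes_arrow t k' k.

Definition decay_angle (i l : int) : R :=
  2 * pi / b%:R * (- i%:~R + l%:~R * (a%:R / 2)).

Definition arrow_angle (i l : int) (j : nat) : R :=
  2 * pi / b%:R * (- i%:~R + a%:R / 4 + j%:R / 2 + l%:~R * (a%:R / 2)).

(* th lists theta_1 < ... < theta_N, the singular angles in (vt, vt + 2 pi).  *)
Definition singular_angles (vt : R) (N : nat) (th : N.-tuple R) : Prop :=
  sorted <%R th /\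
  forall t, t \in th <-> singular_angle t /\ vt < t < vt + 2 * pi.

Section Representations.
Variables (i0 l0 : int) (vt : R) (N : nat) (th : N.-tuple R).

(* (h, S) with S m standing for S_{m+1}, since indices start at 0.            *)
Definition stokes_data : Type :=
  ('M[C]_n.+1 * {ffun 'I_N -> 'M[C]_n.+1})%type.

(* The product S_N ... S_1.                                                   *)
Definition stokes_product (rho : stokes_data) : 'M[C]_n.+1 :=
  \prod_(m < N) rho.2 (rev_ord m).

(* The product S_m ... S_1 over the singular angles smaller than t.           *)
Definition stokes_product_upto (rho : stokes_data) (t : R) : 'M[C]_n.+1 :=
  \prod_(m < N | tnth th (rev_ord m) < t) rho.2 (rev_ord m).

Definition stokes_rep : set stokes_data := [set rho : stokes_data |
  [/\ rho.1 \in unitmx /\ (forall m, rho.2 m \in unitmx),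
      rho.1 * stokes_product rho = 1,
      forall m k, rho.2 m k k = 1,
      forall m k k', k != k' -> ~ stokes_arrow (tnth th m) k' k ->
        rho.2 m k k' = 0 &
      forall k k', rho.1 k k' != 0 <-> k = residue (k'%:Z + b%:Z)]].

Definition reduced (rho : stokes_data) : Prop :=
  forall k : int,
    (forall t : nat, (t < gab)%N ->
       residue (k + b%:Z) != residue (i0 + t%:Z)) ->
    rho.1 (residue (k + b%:Z)) (residue k) = 1.

(* reduced_monodromy rho m is the m-th entry of the reduced formal monodromy, *)
(* for 1 <= m <= gcd(a, b).                                                   *)
Definition reduced_monodromy (rho : stokes_data) (m : nat) : C :=
  rho.1 (residue (i0 + m%:Z - 1)) (residue (i0 + m%:Z - 1 - b%:Z)).

Definition epsF : C := (-1) ^+ ((sab - rab) * n).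

Definition frieze_compatible (rho : stokes_data) : Prop :=
  forall m : nat, (1 <= m <= gab)%N -> reduced_monodromy rho m = epsF.

Definition stokes_coord : set (stokes_data -> C) := [set f |
  (exists k k', f = fun rho : stokes_data => rho.1 k k') \/
  (exists m k k', f = fun rho : stokes_data => rho.2 m k k')].

Definition Rred : variety C :=
  affine_variety [set rho : stokes_data | stokes_rep rho /\ reduced rho] stokes_coord.

Definition RF : variety C :=
  affine_variety
    [set rho : stokes_data | [/\ stokes_rep rho, reduced rho & frieze_compatible rho]]
    stokes_coord.

(* rho' is obtained from rho by a change of minimal framing.                  *)
Definition framing_equiv (rho rho' : stokes_data) : Prop :=
  exists d : 'rV[C]_n.+1,
    [/\ forall k, d 0 k != 0,
        forall k k' : 'I_n.+1, k = k' %[mod gab] -> d 0 k = d 0 k',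
        rho'.1 = diag_mx d *m rho.1 *m invmx (diag_mx d) &
        forall m, rho'.2 m = diag_mx d *m rho.2 m *m invmx (diag_mx d)].

Definition wild_character_variety : variety C :=
  git_quotient (X := Rred) framing_equiv.

(* The class in the wild character variety of a reduced representation.       *)
Definition wild_class (rho : stokes_data) : set stokes_data :=
  git_class (X := Rred) framing_equiv rho.

(* The entry s^j_{i,l}; there is one pair (m, z) as below, unless the arrow   *)
(* angle is congruent to vt modulo 2 pi.                                      *)
Definition stokes_entry (rho : stokes_data) (i l : int) (j : nat) : C :=
  xget 0 [set c | exists (m : 'I_N) (z : int),
    tnth th m = arrow_angle i l j + 2 * pi * z%:~R /\
    c = rho.2 m (residue (i - j%:Z - z * b%:Z)) (residue (i - z * b%:Z))].

(* eps_sign m is (-1)^((a - 1)(k_m + l_m)), where (iota_m, k_m, l_m) is the   *)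
(* only triple with m = iota_m + k_m a - l_m b if gcd(a, b) < m <= a + b.     *)
Definition eps_sign (m : nat) : C :=
  if (m <= gab)%N then 1 else
  xget 1 [set c | exists iota k l : nat,
    [/\ (1 <= iota <= gab)%N, (1 <= k <= sab)%N,
        (m + l * b = iota + k * a)%N & c = (-1) ^+ (n * (k + l))]].

Definition h_sign (m : nat) : C := if (m <= gab)%N then epsF else 1.

(* eta_i^j for a + 1 <= i <= a + b. The arrow from i0 + i - 1 to              *)
(* i0 + i - 1 - j at its angle in (vt, vt + 2 pi) is the translate of the one *)
(* at arrow_angle (i0 + i - 1) l0 j by one turn, in which case no             *)
(* factor of h enters the recursion satisfied by the recessive solutions, or  *)
(* by two turns. The condition b < i - j alone does not tell these cases      *)
(* apart: for a = 4, b = 5, i = 7, j = 1 there is one turn although           *)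
(* b < i - j, and h_2^-1 h_1 = -1 is not the right sign.                      *)
Definition eta (i j : nat) : C :=
  if (b < i - j)%N &&
     (arrow_angle (i0 + i%:Z - 1) l0 j + 2 * pi <= decay_angle i0 l0)
  then (h_sign (i - b))^-1 * h_sign (i - b - j) else 1.

(* eps_i^j for a + 1 <= i <= a + b.                                           *)
Definition coef_sign (i j : nat) : C :=
  eps_sign i * eps_sign (i - j) * (-1) ^+ (j - 1) * eta i j.

(* The representative of i modulo b in {a + 1, ..., a + b}.                   *)
Definition period_rep (i : int) : nat :=
  (a + 1 + `|((i - (a + 1)%:Z) %% b%:Z)%Z|)%N.

Definition PhiRE (rho : stokes_data) : int -> 'I_n -> C :=
  fun i j => coef_sign (period_rep i) j.+1 *
    stokes_entry rho (i0 + (period_rep i)%:Z - 1) l0 j.+1.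

(* Its m-th column, counted from 0, is v'_{m+1}.                              *)
Definition recessive_polygon (rho : stokes_data) : 'M[C]_(n.+1, b) :=
  \matrix_(k, m)
    invmx (stokes_product_upto rho
             (decay_angle (i0 + (m : nat)%:Z) l0 + 2 * pi))
      k (residue (i0 + (m : nat)%:Z - b%:Z)).

End Representations.

(* A b-gon in the projective space of C^a is represented by an a x b matrix   *)
(* whose columns are homogeneous coordinates of its vertices.                 *)
Definition nondegenerate (M : 'M[C]_(n.+1, b)) : Prop :=
  forall m : 'I_b,
    colsub (fun t : 'I_n.+1 => iter t (@ordS b) m) M \in unitmx.

Definition projective_equiv (M M' : 'M[C]_(n.+1, b)) : Prop :=
  exists (g : 'M[C]_n.+1) (d : 'rV[C]_b),
    [/\ g \in unitmx, forall m, d 0 m != 0 & M' = g *m M *m diag_mx d].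

Definition polygons : variety C :=
  affine_variety [set M | nondegenerate M]
    [set f | exists k m, f = fun M : 'M[C]_(n.+1, b) => M k m].

Definition Pab : variety C := git_quotient (X := polygons) projective_equiv.

Definition polygon_class (M : 'M[C]_(n.+1, b)) : set 'M[C]_(n.+1, b) :=
  git_class (X := polygons) projective_equiv M.

Definition solution (alpha : int -> 'I_n -> C) (v : int -> C) : Prop :=
  forall i : int,
    v i = \sum_(j < n) (-1) ^+ j * alpha i j * v (i - j.+1%:Z)
          + (-1) ^+ n * v (i - a%:Z).

Definition superperiodic : set (int -> 'I_n -> C) := [set alpha |
  (forall i j, alpha (i + b%:Z) j = alpha i j) /\
  forall v, solution alpha v -> forall i : int, v (i + b%:Z) = (-1) ^+ n * v i].

Definition Eab : variety C :=
  affine_variety superperiodic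
    [set f | exists i j, f = fun alpha : int -> 'I_n -> C => alpha i j].

(* The coordinates of V form a basis of the space of solutions.               *)
Definition solution_basis (alpha : int -> 'I_n -> C)
    (V : int -> 'cV[C]_n.+1) : Prop :=
  (forall k, solution alpha (fun i => V i k 0)) /\
  forall v, solution alpha v ->
    exists! c : 'rV[C]_n.+1, forall i, v i = (c *m V i) 0 0.

(* The b-gon (v_1, ..., v_b).                                                 *)
Definition basis_polygon (V : int -> 'cV[C]_n.+1) : 'M[C]_(n.+1, b) :=
  \matrix_(k, m) V (m.+1)%:Z k 0.

(* The map from Eab to Pab; the class does not depend on the choice of V.     *)
Definition equation_class (alpha : int -> 'I_n -> C) : set 'M[C]_(n.+1, b) :=
  [set M | exists V, solution_basis alpha V /\
                     polygon_class (basis_polygon V) M].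

Definition frieze_width : nat := (b - a - 1)%N.

(* The array whose nontrivial rows are d _ 0, ..., d _ (w - 1), in matrix     *)
(* form: the row number k of the frieze is the diagonal of the entries        *)
(* (i, i + k). The rows of 1's are the diagonals -1 and w, and the rows of    *)
(* 0's are the diagonals -a, ..., -2 and w + 1, ..., w + a - 1; the entries   *)
(* on other diagonals do not belong to the frieze and are not used below.     *)
Definition frieze_array (d : int -> 'I_frieze_width -> C) (i j : int) : C :=
  if (j - i == -1) || (j - i == frieze_width%:Z) then 1
  else if j - i is Posz k then
    if insub k is Some k' then d i k' else 0
  else 0.

Definition adjacent_minor (d : int -> 'I_frieze_width -> C) (q : nat)
    (i j : int) : C :=
  \det (\matrix_(x < q, y < q)
          frieze_array d (i + (x : nat)%:Z) (j + (y : nat)%:Z)).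

(* The bounds on j - i express that the minor lies inside the frieze.         *)
Definition tame_frieze : set (int -> 'I_frieze_width -> C) := [set d |
  (forall i j : int, -1 <= j - i <= frieze_width%:Z ->
     adjacent_minor d a i j = 1) /\
  (forall i j : int, 0 <= j - i < frieze_width%:Z ->
     adjacent_minor d a.+1 i j = 0)].

Definition Fab : variety C :=
  affine_variety tame_frieze
    [set f | exists i k, f = fun d : int -> 'I_frieze_width -> C => d i k].

End StokesData.

(* Main.v *)
(* Continue the frame of solutions given by a Stokes representation along the
   universal cover of the circle, and follow each column to the direction where
   its exponential factor decays the fastest. The resulting sequence V of
   recessive vectors satisfies
     V x = sum_(0 < j < a) c x j *: V (x - j) + V (x - a),
   the coefficients c being the entries of the Stokes matrices, because between
   two consecutive positions of fastest decay of the same exponential factor the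
   column is modified exactly once by each of the a - 1 arrows leaving it. The
   relation h S_N ... S_1 = 1 then says that V is quasi-periodic:
   V (x - b) = H x *: V x, where H x is an entry of the formal monodromy h.
   Writing x = iota + k a - l b, the signs (-1)^((a - 1) (k + l)) turn the
   recurrence and its quasi-periodicity into a superperiodic difference equation
   exactly when h is the frieze-compatible formal monodromy.

   Conversely, the vertices of a nondegenerate polygon satisfy a recurrence of
   order a with nonzero last coefficient. They can be rescaled, by a product of
   these coefficients along the same lattice, so that this coefficient becomes 1
   and the monodromy becomes reduced; this inverts the map from representations
   to polygons up to framing and projective transformations. Both constructions
   are regular, so they identify the rings of invariants, hence the affine
   quotients. When a and b are coprime, comparing the determinants of a
   consecutive vectors before and after a turn forces the only monodromy
   parameter to be the frieze-compatible one, and the torus acts trivially.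

   The rows of the frieze of an equation are the solutions with initial values
   0, ..., 0, 1; conversely the minors of a tame frieze give the relation of
   order a between its consecutive columns. *)

Require Import Defs.
From mathcomp Require Import all_boot all_order all_algebra.
From mathcomp Require Import complex.
From mathcomp Require Import all_classical all_reals all_analysis.
From mathcomp Require Import zify ring lra.

Set Implicit Arguments.
Unset Strict Implicit.
Unset Printing Implicit Defensive.

Import Order.TTheory GRing.Theory Num.Theory.
Import numFieldNormedType.Exports.

Local Open Scope classical_set_scope.
Local Open Scope ring_scope.

(** * Affine varieties and invariants *)

(** Time is the integer [t] of [angle]: four units separate consecutive directions of fastest decay,
    so a turn is 4b units, the factor of index x decays fastest at time -4x, and its arrow with
    superscript j acts at time a + 2j - 4x. Put u = 4x + t. The arrows leaving x have a < u < 3a,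
    while for the target x - j the same quantity is a - 2j, inside the interval [-a, a] where the
    target column equals its recessive vector. Hence each jump adds a term of the sequence itself,
    and at u = 4a, where x and x - a have the same residue, the recurrence closes with last
    coefficient 1.

    The Stokes matrices are given for one turn, whereas the recurrence needs coefficients at all
    integers. The condition [twisted] extends them: conjugation by h relates the matrices of
    successive turns.

    The frieze-compatible value of h measures how (-1)^((a - 1)(k + l)) fails to be b-periodic up to
    sign: as s a = r b, the coordinate l is kept in [0, r), and where subtracting b wraps l from r -
    1 to 0, the sum k + l changes by -(s + r - 1) instead of 1. *)

Section GeneratedClosure.
Variables (K : fieldType) (T : Type) (X : set T) (G : set (T -> K)).
Local Notation regular := (generated X G).

Lemma generated_sum (I : Type) (r : seq I) (P : pred I) (F : I -> T -> K) :
  (forall i, P i -> regular (F i)) ->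
  regular (fun x => \sum_(i <- r | P i) F i x).
Proof.
move=> HF; elim: r => [|i r IH].
  by apply: (@gen_ext _ _ _ _ (fun=> 0)) => [|x _]; rewrite ?big_nil //; constructor.
case: (boolP (P i)) => Pi.
  apply: (@gen_ext _ _ _ _ (fun x => F i x + \sum_(i <- r | P i) F i x)).
    by apply: gen_add => //; apply: HF.
  by move=> x _; rewrite big_cons Pi.
by apply: (gen_ext IH) => x _; rewrite big_cons (negbTE Pi).
Qed.

Lemma generated_prod (I : Type) (r : seq I) (P : pred I) (F : I -> T -> K) :
  (forall i, P i -> regular (F i)) ->
  regular (fun x => \prod_(i <- r | P i) F i x).
Proof.
move=> HF; elim: r => [|i r IH].
  by apply: (@gen_ext _ _ _ _ (fun=> 1)) => [|x _]; rewrite ?big_nil //; constructor.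
case: (boolP (P i)) => Pi.
  apply: (@gen_ext _ _ _ _ (fun x => F i x * \prod_(i <- r | P i) F i x)).
    by apply: gen_mul => //; apply: HF.
  by move=> x _; rewrite big_cons Pi.
by apply: (gen_ext IH) => x _; rewrite big_cons (negbTE Pi).
Qed.

Lemma generated_scale (e : K) (f : T -> K) :
  regular f -> regular (fun x => e * f x).
Proof. by move=> Hf; apply: gen_mul => //; constructor. Qed.

Definition regular_mx m p (A : T -> 'M[K]_(m, p)) :=
  forall i j, regular (fun x => A x i j).

Lemma regular_const_mx m p (A : 'M[K]_(m, p)) : regular_mx (fun=> A).
Proof. by move=> i j; constructor. Qed.

Lemma regular_mulmx m p q (A : T -> 'M[K]_(m, p)) (B : T -> 'M[K]_(p, q)) :
  regular_mx A -> regular_mx B -> regular_mx (fun x => A x *m B x).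
Proof.
move=> HA HB i j.
apply: (@gen_ext _ _ _ _ (fun x => \sum_k A x i k * B x k j)).
  by apply: generated_sum => k _; apply: gen_mul.
by move=> x _; rewrite mxE.
Qed.

Lemma regular_det m (A : T -> 'M[K]_m) :
  regular_mx A -> regular (fun x => \det (A x)).
Proof.
move=> HA; apply: generated_sum => s _.
by apply: generated_scale; apply: generated_prod => i _.
Qed.

(** By the cofactor formula the only division is by the determinant, which does not vanish on
    [X]. *)
Lemma regular_invmx m (A : T -> 'M[K]_m) :
  regular_mx A -> (forall x, X x -> A x \in unitmx) ->
  regular_mx (fun x => invmx (A x)).
Proof.
move=> HA uA i j.
apply: (@gen_ext _ _ _ _ (fun x => (\det (A x))^-1 * cofactor (A x) j i)).
  apply: gen_mul.
    apply: gen_inv; first exact: regular_det.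
    by move=> x /uA; rewrite unitmxE unitfE.
  apply: generated_scale; apply: regular_det => k l.
  by apply: (gen_ext (HA (lift j k) (lift i l))) => x _; rewrite !mxE.
by move=> x Xx; rewrite /invmx uA // !mxE.
Qed.

Lemma regular_prod_mx m (I : Type) (r : seq I) (P : pred I)
    (A : I -> T -> 'M[K]_m.+1) :
  (forall i, P i -> regular_mx (A i)) ->
  regular_mx (fun x => \prod_(i <- r | P i) A i x).
Proof.
move=> HA; elim: r => [|i r IH].
  move=> k l; apply: (gen_ext (regular_const_mx 1 k l)) => x _.
  by rewrite big_nil.
case: (boolP (P i)) => Pi k l.
  have H := regular_mulmx (HA i Pi) IH k l.
  by apply: (gen_ext H) => x _; rewrite big_cons Pi.
by apply: (gen_ext (IH k l)) => x _; rewrite big_cons (negbTE Pi).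
Qed.

End GeneratedClosure.

Lemma generated_pullback (K : fieldType) (T U : Type) (X : set T) (Y : set U)
    (G : set (T -> K)) (G' : set (U -> K)) (F : T -> U) :
  (forall x, X x -> Y (F x)) ->
  (forall g, G' g -> generated X G (fun x => g (F x))) ->
  forall f, generated Y G' f -> generated X G (fun x => f (F x)).
Proof.
move=> XY HG f; elim=> {f} [f Gf|e|f g _ IHf _ IHg|f g _ IHf _ IHg|f _ IHf nz|f g _ IHf fg].
- exact: HG.
- by constructor.
- exact: gen_add.
- exact: gen_mul.
- by apply: gen_inv => // x /XY /nz.
- by apply: (gen_ext IHf) => x /XY /fg.
Qed.

Section Isomorphisms.
Variable K : fieldType.

(** Nothing in the record [variety] forces membership in [regfun] to depend only on values at the
    points; affine varieties satisfy this by [gen_ext], and comparing rings of functions relies on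
    it. *)
Definition ext_closed (X : variety K) :=
  forall f g : ambient X -> K, regfun f ->
    (forall x, @points _ X x -> f x = g x) -> regfun g.

Lemma affine_ext_closed T (X : set T) (G : set (T -> K)) :
  ext_closed (affine_variety X G).
Proof. by move=> f g; apply: gen_ext. Qed.

Lemma isomorphism_of_inverse (X Y : variety K)
    (F : ambient X -> ambient Y) (F' : ambient Y -> ambient X) :
  ext_closed Y ->
  (forall x, @points _ X x -> @points _ Y (F x)) ->
  (forall y, @points _ Y y -> @points _ X (F' y)) ->
  (forall x, @points _ X x -> F' (F x) = x) ->
  (forall y, @points _ Y y -> F (F' y) = y) ->
  (forall f, @regfun _ Y f -> @regfun _ X (fun x => f (F x))) ->
  (forall f, @regfun _ X f -> @regfun _ Y (fun y => f (F' y))) ->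
  isomorphism F.
Proof.
move=> eY XY YX F'F FF' pF pF'; split.
  split.
  - by move=> x Xx; apply: XY.
  - move=> x x' /set_mem Xx /set_mem Xx' e.
    by rewrite -(F'F x) // e F'F.
  - by move=> y Yy; exists (F' y); [apply: YX|apply: FF'].
move=> f; split; first exact: pF.
move=> /pF' Hf; apply: eY Hf _ => y Yy /=; by rewrite FF'.
Qed.

Lemma isomorphism_comp (X Y Z : variety K) (F : ambient X -> ambient Y)
    (F' : ambient Y -> ambient Z) :
  isomorphism F -> isomorphism F' ->
  isomorphism (X := X) (Y := Z) (fun x => F' (F x)).
Proof.
move=> [[FXY Finj Fsurj] Freg] [[F'XY F'inj F'surj] F'reg]; split.
  split.
  - by move=> x Xx; apply: F'XY; apply: FXY.
  - move=> x x' Xx Xx' /F'inj e; apply: Finj => //; apply: e;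
    by apply/mem_set/FXY/set_mem.
  - by move=> z /F'surj [y /Fsurj [x Xx <-] <-]; exists x.
by move=> f; rewrite F'reg Freg.
Qed.

Lemma isomorphism_ext (X Y : variety K) (F F' : ambient X -> ambient Y) :
  ext_closed X -> (forall x, @points _ X x -> F x = F' x) ->
  isomorphism F -> isomorphism F'.
Proof.
move=> eX FF' [[FXY Finj Fsurj] Freg]; split.
  split.
  - by move=> x Xx; rewrite /= -FF' //; apply: FXY.
  - move=> x x' Xx Xx'; rewrite -!FF'; first exact: Finj.
      exact: set_mem Xx'.
    exact: set_mem Xx.
  - by move=> y /Fsurj [x Xx <-]; exists x => //; rewrite FF'.
move=> f; rewrite Freg; split => Hf; apply: (eX _ _ Hf) => x Xx; by rewrite FF'.
Qed.

End Isomorphisms.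

Lemma git_class_eq (K : fieldType) (Z : variety K) (E : ambient Z -> ambient Z -> Prop) x y :
  @points _ Z y ->
  git_class (X := Z) E x = git_class (X := Z) E y <-> git_equiv (X := Z) E x y.
Proof.
move=> Zy; split => [e|xy].
  have : git_class (X := Z) E y y by split => // f.
  by rewrite -e => -[].
apply/seteqP; split => z [Zz Hz]; split => // f Hf.
  by rewrite -(xy f Hf); apply: Hz.
by rewrite (xy f Hf); apply: Hz.
Qed.

Lemma git_equiv_of_orbit (K : fieldType) (Z : variety K) (E : ambient Z -> ambient Z -> Prop)
    x y :
  @points _ Z x -> @points _ Z y -> E x y -> git_equiv (X := Z) E x y.
Proof. by move=> Zx Zy Exy f [_ Hf]; apply: Hf. Qed.

(** * Comparison of affine quotients through maps inverse to each other up to orbits *)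

Section GITComparison.
Variables (K : fieldType) (X Y : variety K).
Variables (EX : ambient X -> ambient X -> Prop).
Variables (EY : ambient Y -> ambient Y -> Prop).
Variables (F : ambient X -> ambient Y) (F' : ambient Y -> ambient X).
Hypotheses (eX : ext_closed X) (eY : ext_closed Y).
Hypothesis FXY : forall x, @points _ X x -> @points _ Y (F x).
Hypothesis F'YX : forall y, @points _ Y y -> @points _ X (F' y).
Hypothesis FE : forall x x', @points _ X x -> @points _ X x' ->
  (EX x x' <-> EY (F x) (F x')).
Hypothesis FF' : forall y, @points _ Y y -> EY (F (F' y)) y.
Hypothesis EYsym : forall y y', @points _ Y y -> @points _ Y y' ->
  EY y y' -> EY y' y.
Hypothesis EYtrans : forall y y' y'', @points _ Y y -> @points _ Y y' ->
  @points _ Y y'' -> EY y y' -> EY y' y'' -> EY y y''.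
Hypothesis pF : forall f, @regfun _ Y f -> @regfun _ X (fun x => f (F x)).
Hypothesis pF' : forall f, @regfun _ X f -> @regfun _ Y (fun y => f (F' y)).

Lemma inverse_orbit x : @points _ X x -> EX (F' (F x)) x.
Proof.
move=> Xx; apply/FE => //; first exact/F'YX/FXY.
exact/FF'/FXY.
Qed.

Lemma invariant_pull f : Defs.invariant (X := Y) EY f ->
  Defs.invariant (X := X) EX (fun x => f (F x)).
Proof.
move=> [rf Ef]; split; first exact: pF.
by move=> x y Xx Xy /FE e; apply: Ef; [exact: FXY|exact: FXY|exact: e].
Qed.

Lemma invariant_push f : Defs.invariant (X := X) EX f ->
  Defs.invariant (X := Y) EY (fun y => f (F' y)).
Proof.
move=> [rf Ef]; split; first exact: pF'.
move=> y y' Yy Yy' e; apply: Ef; [exact: F'YX|exact: F'YX|].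
have Y1 := FXY (F'YX Yy); have Y2 := FXY (F'YX Yy').
apply/FE; [exact: F'YX|exact: F'YX|].
apply: (EYtrans Y1 Yy Y2 (FF' Yy)).
apply: (EYtrans Yy Yy' Y2 e).
exact: EYsym (FF' Yy').
Qed.

(** Invariants can be transported both ways, and the round trip is the identity on them because
    [F' (F z)] lies in the orbit of [z]. *)
Lemma git_equiv_iff x x' : @points _ X x -> @points _ X x' ->
  git_equiv (X := X) EX x x' <-> git_equiv (X := Y) EY (F x) (F x').
Proof.
move=> Xx Xx'; split => H f Hf.
  exact: (H _ (invariant_pull Hf)).
have := H _ (invariant_push Hf) => /=.
case: Hf => rf Ef.
have fF'F z : @points _ X z -> f (F' (F z)) = f z.
  by move=> Xz; apply: Ef => //; [exact/F'YX/FXY|exact: inverse_orbit].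
by rewrite !fF'F.
Qed.

(** Neither composite of [F] and [F'] needs to be the identity: orbits are not separated by
    invariants, so both composites become the identity on classes. *)
Lemma git_isomorphism :
  exists beta : ambient (git_quotient (X := X) EX) ->
                ambient (git_quotient (X := Y) EY),
    isomorphism beta /\
    forall x, @points _ X x ->
      beta (git_class (X := X) EX x) = git_class (X := Y) EY (F x).
Proof.
(* A map on arbitrary sets of points is needed; on a class all the classes in this union
   coincide. *)
pose beta (A : set (ambient X)) : set (ambient Y) :=
  [set y | exists2 x, A x & git_class (X := Y) EY (F x) y].
have Hb x : @points _ X x ->
    beta (git_class (X := X) EX x) = git_class (X := Y) EY (F x).
  move=> Xx; apply/seteqP; split => y.
    move=> [x' [Xx' xx']].
    have -> // : git_class (X := Y) EY (F x') = git_class (X := Y) EY (F x).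
    apply/esym/git_class_eq; first exact: FXY.
    exact/git_equiv_iff.
  by move=> Hy; exists x => //; split => // f.
exists beta; split => //; split.
  split.
  - by move=> _ [x Xx <-]; rewrite /= Hb //; exists (F x) => //; exact: FXY.
  - move=> A B /set_mem [x Xx <-] /set_mem [x' Xx' <-].
    rewrite !Hb // => /(git_class_eq _ _ (FXY Xx')) /(git_equiv_iff Xx Xx') e.
    exact/git_class_eq.
  - move=> _ [y Yy <-]; exists (git_class (X := X) EX (F' y)).
      by exists (F' y) => //; exact: F'YX.
    rewrite Hb; last exact: F'YX.
    apply/git_class_eq => //; apply: git_equiv_of_orbit => //.
      exact/FXY/F'YX.
    exact: FF'.
move=> f; split.
  move=> /pF Hf; apply: eX Hf _ => x Xx /=; by rewrite Hb.
move=> /pF' Hf; apply: eY Hf _ => y Yy /=.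
rewrite Hb; last exact: F'YX.
congr f; apply/git_class_eq => //; apply: git_equiv_of_orbit => //.
  exact/FXY/F'YX.
exact: FF'.
Qed.

End GITComparison.

(** When orbits are single points every regular function is invariant, and the generators already
    separate points. *)
Lemma git_trivial (K : fieldType) (T : Type) (X : set T) (G : set (T -> K))
    (E : T -> T -> Prop) :
  (forall x y, X x -> X y -> E x y -> x = y) ->
  (forall x y, (forall g, G g -> g x = g y) -> x = y) ->
  isomorphism (X := affine_variety X G)
    (Y := git_quotient (X := affine_variety X G) E)
    (git_class (X := affine_variety X G) E).
Proof.
move=> Etriv Gsep; split=> //; split=> [x Xx|x y /set_mem Xx /set_mem Xy|].
- by exists x.
- move=> /(git_class_eq _ _ Xy) xy; apply: Gsep => g Gg; apply: xy.
  split; first exact: gen_base.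
  by move=> u v Xu Xv /(Etriv _ _ Xu Xv) ->.
- by move=> _ [x Xx <-]; exists x.
Qed.

(** * Linear recurrences *)

Lemma int_ind_pm (P : int -> Prop) (m : int) :
  P m -> (forall x, P x -> P (x + 1)) -> (forall x, P x -> P (x - 1)) ->
  forall x, P x.
Proof.
move=> Pm Pp Pn x.
have Pk (k : nat) : P (m + k%:Z) /\ P (m - k%:Z).
  elim: k => [|k [IHp IHn]]; first by split; rewrite ?subr0 ?addr0.
  split.
    have -> : m + k.+1%:Z = m + k%:Z + 1 by lia.
    exact: Pp.
  have -> : m - k.+1%:Z = m - k%:Z - 1 by lia.
  exact: Pn.
have [h|h] : (exists k : nat, x = m + k%:Z) \/ (exists k : nat, x = m - k%:Z).
  case: (leP m x) => h; [left|right]; exists `|x - m|%N; lia.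
- by case: h => k ->; case: (Pk k).
- by case: h => k ->; case: (Pk k).
Qed.

Section IntegerProducts.
Variable A : unitRingType.

(* The solution, normalised at 0, of F (z - 1) = F z * f z. *)
Definition zprod (f : int -> A) (z : int) : A :=
  match z with
  | Posz k => \prod_(i < k) (f i.+1%:Z)^-1
  | Negz k => \prod_(i < k.+1) f (- i%:Z)
  end.

Lemma zprod0 f : zprod f 0 = 1.
Proof. exact: big_ord0. Qed.

Lemma zprodP f : (forall z, f z \is a GRing.unit) ->
  forall z, zprod f (z - 1) = zprod f z * f z.
Proof.
move=> uf [[|k]|k].
- by rewrite [_ - 1](_ : _ = Negz 0) // zprod0 mul1r /zprod big_ord1.
- have -> : k.+1%:Z - 1 = k%:Z by lia.
  by rewrite /zprod big_ord_recr /= -mulrA mulVr // mulr1.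
- have -> : Negz k - 1 = Negz k.+1 by lia.
  by rewrite /zprod big_ord_recr.
Qed.

Lemma zprod_unit f : (forall z, f z \is a GRing.unit) ->
  forall z, zprod f z \is a GRing.unit.
Proof.
move=> uf [k|k]; rewrite /zprod; apply: rpred_prod => i _ //.
by rewrite unitrV.
Qed.

Lemma zprod_uniq f (F F' : int -> A) m : (forall z, f z \is a GRing.unit) ->
  (forall z, F (z - 1) = F z * f z) -> (forall z, F' (z - 1) = F' z * f z) ->
  F m = F' m -> forall z, F z = F' z.
Proof.
move=> uf HF HF' e; apply: (@int_ind_pm _ m) => // x ex.
  apply: (mulIr (uf (x + 1))).
  by rewrite -HF -HF' addrK.
by rewrite HF HF' ex.
Qed.

Lemma zprod_scale f (F : int -> A) : (forall z, f z \is a GRing.unit) ->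
  (forall z, F (z - 1) = F z * f z) -> forall z, F z = F 0 * zprod f z.
Proof.
move=> uf HF; apply: (zprod_uniq (m := 0) uf HF) => [z|].
  by rewrite zprodP // mulrA.
by rewrite zprod0 mulr1.
Qed.

End IntegerProducts.

Lemma row_scale_eq0 (K : fieldType) m (xi : 'rV[K]_m) (w : 'cV[K]_m) h :
  h != 0 -> (xi *m (h *: w) == 0) = (xi *m w == 0).
Proof. by move=> h0; rewrite -scalemxAr scaler_eq0 (negbTE h0). Qed.

Section LinearRecurrence.
Variables (K : fieldType) (n : nat).
Local Notation a := n.+1.

Definition solves (c : int -> 'I_n -> K) (e : K) (v : int -> K) :=
  forall x, v x = \sum_(j < n) c x j * v (x - j.+1%:Z) + e * v (x - a%:Z).

(** A block of a zeros propagates upwards by the recurrence and, since the last coefficient is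
    invertible, downwards as well. *)
Lemma solves_eq0 c e v m : e != 0 -> solves c e v ->
  (forall y : 'I_a, v (m - (y : nat)%:Z) = 0) -> forall x, v x = 0.
Proof.
move=> e0 Hv Hm.
pose P x := forall y : 'I_a, v (x - (y : nat)%:Z) = 0.
suff HP x : P x by move=> x; have := HP x ord0; rewrite subr0.
apply: (@int_ind_pm P m) => {x} // x Px y.
  case: y => [[|y] hy] /=.
    rewrite subr0 Hv big1 => [|j _].
      have -> : x + 1 - a%:Z = x - n%:Z by lia.
      by rewrite (Px ord_max) mulr0 addr0.
    have -> : x + 1 - j.+1%:Z = x - j%:Z by lia.
    by rewrite (Px (widen_ord (leqnSn n) j)) mulr0.
  have -> : x + 1 - y.+1%:Z = x - y%:Z by lia.
  exact: (Px (Ordinal (ltnW hy))).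
have [hy|hy] := ltnP y n.
  have -> : x - 1 - y%:Z = x - y.+1%:Z by lia.
  exact: (Px (Ordinal (hy : y.+1 < a)%N)).
have -> : x - 1 - y%:Z = x - a%:Z by have := ltn_ord y; lia.
apply: (mulfI e0); rewrite mulr0.
have := Hv x; rewrite big1 => [|j _].
  by rewrite add0r => <-; have := Px ord0; rewrite subr0.
by rewrite (Px (Ordinal (ltn_ord j : (j.+1 < a)%N))) mulr0.
Qed.

Definition vsolves (c : int -> 'I_n -> K) (e : K) (V : int -> 'cV[K]_a) :=
  forall x, V x = \sum_(j < n) c x j *: V (x - j.+1%:Z) + e *: V (x - a%:Z).

(** The Casorati matrix, with columns by decreasing index, so that one step of the recurrence is
    right multiplication by [companion]. *)
Definition window (V : int -> 'cV[K]_a) (m : int) : 'M[K]_a :=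
  \matrix_(k, y) V (m - (y : nat)%:Z) k 0.

Lemma vsolves_row c e V (xi : 'rV[K]_a) : vsolves c e V ->
  solves c e (fun x => (xi *m V x) 0 0).
Proof.
move=> HV x; rewrite {1}HV mulmxDr mulmx_sumr mxE summxE -scalemxAr; congr (_ + _).
  by apply: eq_bigr => j _; rewrite -scalemxAr mxE.
by rewrite mxE.
Qed.

Lemma vsolves_mul c e V (g : 'M[K]_a) : vsolves c e V ->
  vsolves c e (fun x => g *m V x).
Proof.
move=> HV x; rewrite {1}HV mulmxDr mulmx_sumr -scalemxAr; congr (_ + _).
by apply: eq_bigr => j _; rewrite -scalemxAr.
Qed.

Lemma vsolvesP c e V :
  vsolves c e V <-> forall k, solves c e (fun x => V x k 0).
Proof.
split=> HV.
  move=> k x; rewrite {1}HV mxE summxE; congr (_ + _); last by rewrite mxE.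
  by apply: eq_bigr => j _; rewrite mxE.
move=> x; apply/matrixP => k z; rewrite ord1 HV mxE summxE.
congr (_ + _); last by rewrite mxE.
by apply: eq_bigr => j _; rewrite mxE.
Qed.

Lemma row_window V m (xi : 'rV[K]_a) y :
  (xi *m window V m) 0 y = (xi *m V (m - (y : nat)%:Z)) 0 0.
Proof. by rewrite !mxE; apply: eq_bigr => k _; rewrite mxE. Qed.

Lemma window_mul (g : 'M[K]_a) V m :
  window (fun x => g *m V x) m = g *m window V m.
Proof.
apply/matrixP => k y; rewrite !mxE.
by apply: eq_bigr => l _; rewrite mxE.
Qed.

Lemma unitmx_kernel (B : 'M[K]_a) :
  (forall xi : 'rV[K]_a, xi *m B = 0 -> xi = 0) -> B \in unitmx.
Proof. by move=> HB; rewrite -row_free_unit; apply: inj_row_free. Qed.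

Lemma vsolves_row_eq0 c e V m (xi : 'rV[K]_a) : e != 0 -> vsolves c e V ->
  xi *m window V m = 0 -> forall x, xi *m V x = 0.
Proof.
move=> e0 HV H x; apply/matrixP => k l; rewrite !ord1 [RHS]mxE.
apply: (solves_eq0 (m := m) e0 (vsolves_row xi HV)) => y.
by rewrite -row_window H mxE.
Qed.

Lemma window_unit c e V m m' : e != 0 -> vsolves c e V ->
  window V m \in unitmx -> window V m' \in unitmx.
Proof.
move=> e0 HV um; apply: unitmx_kernel => xi H.
have H0 := vsolves_row_eq0 e0 HV H.
apply: (can_inj (mulmxK um)); rewrite mul0mx.
by apply/matrixP => k y; rewrite ord1 row_window H0 !mxE.
Qed.

(** The row is chosen to reproduce [v] on one window; the difference is then a solution with a block
    of zeros. *)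
Lemma solves_expand c e V m v : e != 0 -> vsolves c e V ->
  window V m \in unitmx -> solves c e v ->
  exists xi : 'rV[K]_a, forall x, v x = (xi *m V x) 0 0.
Proof.
move=> e0 HV um Hv.
pose xi : 'rV[K]_a := (\row_y v (m - (y : nat)%:Z)) *m invmx (window V m).
exists xi => x; apply/eqP; rewrite -subr_eq0; apply/eqP.
apply: (@solves_eq0 c e (fun x => v x - (xi *m V x) 0 0) m) => // [z|y].
  rewrite {1}Hv {1}(vsolves_row xi HV) opprD addrACA -sumrB -mulrBr.
  by congr (_ + _); apply: eq_bigr => j _; rewrite mulrBr.
by rewrite -row_window mulmxKV // mxE subrr.
Qed.

Lemma vsolves_expand c e V V' m : e != 0 -> vsolves c e V ->
  window V m \in unitmx -> vsolves c e V' ->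
  exists g : 'M[K]_a, forall x, V' x = g *m V x.
Proof.
move=> e0 HV um /vsolvesP HV'.
have /choice [g Hg] : forall k, exists xi : 'rV[K]_a,
  forall x, V' x k 0 = (xi *m V x) 0 0 by move=> k; apply: solves_expand e0 HV um (HV' k).
exists (\matrix_k g k) => x; apply/matrixP => k l; rewrite ord1 Hg !mxE.
by apply: eq_bigr => y _; rewrite mxE.
Qed.

Lemma row_expand_uniq V m (xi xi' : 'rV[K]_a) :
  window V m \in unitmx -> (forall x, (xi *m V x) 0 0 = (xi' *m V x) 0 0) ->
  xi = xi'.
Proof.
move=> um H; apply: (can_inj (mulmxK um)).
by apply/matrixP => k y; rewrite ord1 !row_window H.
Qed.

Lemma window_mulE V m (u : 'cV_a) :
  window V m *m u =
    \sum_(j < n) u (widen_ord (leqnSn n) j) 0 *: V (m - (j : nat)%:Z)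
    + u ord_max 0 *: V (m - n%:Z).
Proof.
apply/matrixP => k l; rewrite ord1 !mxE big_ord_recr /= summxE mxE.
congr (_ + _); last by rewrite ?mxE mulrC.
by apply: eq_bigr => j _; rewrite !mxE mulrC.
Qed.

Lemma coef_uniq V x (c c' : 'I_n -> K) e e' : window V (x - 1) \in unitmx ->
  \sum_(j < n) c j *: V (x - j.+1%:Z) + e *: V (x - a%:Z) =
  \sum_(j < n) c' j *: V (x - j.+1%:Z) + e' *: V (x - a%:Z) ->
  c =1 c' /\ e = e'.
Proof.
move=> um H.
pose u (d : 'I_n -> K) f : 'cV[K]_a :=
  \col_y if unlift ord_max y is Some j then d j else f.
have uE d f : window V (x - 1) *m u d f =
    \sum_(j < n) d j *: V (x - j.+1%:Z) + f *: V (x - a%:Z).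
  rewrite window_mulE; congr (_ + _).
    apply: eq_bigr => j _; rewrite mxE.
    have -> : widen_ord (leqnSn n) j = lift ord_max j.
      by apply: val_inj; rewrite /= /bump leqNgt ltn_ord.
    by rewrite liftK; congr (_ *: V _); lia.
  by rewrite mxE unlift_none; congr (_ *: V _); lia.
have /(can_inj (mulKmx um)) /matrixP Hu :
  window V (x - 1) *m u c e = window V (x - 1) *m u c' e' by rewrite !uE.
split=> [j|].
  by have := Hu (lift ord_max j) 0; rewrite !mxE liftK.
by have := Hu ord_max 0; rewrite !mxE unlift_none.
Qed.

Definition companion (c : 'I_n -> K) (e : K) : 'M[K]_a :=
  \matrix_(y, z) if unlift ord0 z is Some z' then (y == z' :> nat)%:R
  else if unlift ord_max y is Some j then c j else e.

Lemma det_companion c e : \det (companion c e) = (-1) ^+ n * e.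
Proof.
have minor1 : row' ord_max (col' ord0 (companion c e)) = 1%:M.
  apply/matrixP => y z; rewrite !mxE liftK.
  by rewrite /= /bump leqNgt ltn_ord.
rewrite (expand_det_row _ ord_max) (bigD1 ord0) //= big1 => [|z hz].
  rewrite /cofactor minor1 det1 mulr1 addr0 addn0 mulrC; congr (_ * _).
  by rewrite mxE !unlift_none.
rewrite mxE; case: (unliftP ord0 z) hz => [z'|] -> //= _.
by rewrite (gtn_eqF (ltn_ord z')) mul0r.
Qed.

Lemma mul_companion_lift m (B : 'M[K]_(m, a)) c e k (z : 'I_n) :
  (B *m companion c e) k (lift ord0 z) = B k (widen_ord (leqnSn n) z).
Proof.
rewrite mxE big_ord_recr /= (bigD1 z) //= big1 => [|i hi].
  by rewrite !mxE liftK eqxx mulr1 addr0 (gtn_eqF (ltn_ord z)) mulr0 addr0.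
rewrite !mxE liftK; case: eqP => e'; last by rewrite mulr0.
by case/eqP: hi; apply: val_inj.
Qed.

Lemma mul_companion0 m (B : 'M[K]_(m, a)) c e k :
  (B *m companion c e) k ord0 =
    \sum_(j < n) c j * B k (widen_ord (leqnSn n) j) + e * B k ord_max.
Proof.
rewrite mxE big_ord_recr /= mxE !unlift_none; congr (_ + _); last exact: mulrC.
apply: eq_bigr => j _; rewrite mxE unlift_none mulrC.
have -> : unlift ord_max (widen_ord (leqnSn n) j) = Some j => //.
rewrite (_ : widen_ord _ _ = lift ord_max j) ?liftK //.
by apply: val_inj; rewrite /= /bump leqNgt ltn_ord.
Qed.

Lemma window_companion (c : 'I_n -> K) e V m :
  V m = \sum_(j < n) c j *: V (m - j.+1%:Z) + e *: V (m - a%:Z) ->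
  window V m = window V (m - 1) *m companion c e.
Proof.
move=> HV; apply/matrixP => k z; case: (unliftP ord0 z) => [z'|] ->.
  rewrite mul_companion_lift !mxE; congr (V _ _ _).
  by rewrite /= /bump /=; lia.
rewrite mul_companion0 mxE subr0 {1}HV mxE summxE; congr (_ + _).
  apply: eq_bigr => j _; rewrite !mxE; congr (_ * V _ _ _).
  by rewrite /=; lia.
by rewrite !mxE; congr (_ * V _ _ _); rewrite /=; lia.
Qed.

Lemma det_window_step (c : 'I_n -> K) e V m :
  V m = \sum_(j < n) c j *: V (m - j.+1%:Z) + e *: V (m - a%:Z) ->
  \det (window V m) = (-1) ^+ n * e * \det (window V (m - 1)).
Proof. by move=> /window_companion ->; rewrite det_mulmx det_companion mulrC. Qed.

Lemma det_window c e V m : vsolves c e V ->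
  \det (window V m) = (-1) ^+ n * e * \det (window V (m - 1)).
Proof. by move=> HV; apply: det_window_step (HV m). Qed.

End LinearRecurrence.

(** * Stokes matrices and recessive solutions *)

(** Indices modulo a are handled through integer positions; this turns equality of residues of
    nearby positions into equality. *)
Lemma dvdz_small (d z : int) : (d %| z)%Z -> - d < z < d -> z = 0.
Proof.
rewrite dvdzE => h hz; apply/eqP/negbNE/negP => z0.
have := dvdn_leq _ h; rewrite absz_gt0 z0 => /(_ isT); lia.
Qed.

Section Residues.
Variable n : nat.
Local Notation a := n.+1.

Lemma val_residue x : (residue n x : nat)%:Z = (x %% a%:Z)%Z.
Proof.
have h1 : (0 <= x %% a%:Z)%Z by rewrite modz_ge0.
have h2 : (x %% a%:Z < a%:Z)%Z by rewrite ltz_pmod.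
rewrite /residue inordK ?gez0_abs //; lia.
Qed.

Lemma residue_eq x y : (residue n x == residue n y) = (a%:Z %| x - y)%Z.
Proof.
apply/eqP/idP => [e|].
  by rewrite -eqz_mod_dvd; apply/eqP; rewrite -!val_residue e.
rewrite -eqz_mod_dvd => /eqP e; apply: val_inj; apply/eqP.
by rewrite -eqz_nat /= !val_residue e.
Qed.

Lemma residue_ord (k : 'I_a) : residue n (k : nat)%:Z = k.
Proof.
apply: val_inj; apply/eqP; rewrite -eqz_nat val_residue modz_small //.
by have := ltn_ord k; lia.
Qed.

End Residues.

Section Frames.
Variables (K : fieldType) (n b : nat) (i0 : int).
Local Notation a := n.+1.
Local Notation res x := (residue n (i0 + x)).

Lemma res_eq x y : (res x == res y) = (a%:Z %| x - y)%Z.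
Proof. by rewrite residue_eq; congr (_ %| _)%Z; lia. Qed.

Lemma res_lift (k : 'I_a) : res ((k : nat)%:Z - i0) = k.
Proof. by rewrite addrC subrK residue_ord. Qed.

Lemma res_neq x (d : nat) : (0 < d < a)%N -> res (x - d%:Z) != res x.
Proof.
by move=> hd; rewrite res_eq; apply/negP => /dvdz_small; move: hd; lia.
Qed.

Definition basis_vec x : 'cV[K]_a := delta_mx (res x) 0.

Lemma basis_vec_eq x y : (a%:Z %| x - y)%Z -> basis_vec x = basis_vec y.
Proof. by rewrite -res_eq => /eqP e; rewrite /basis_vec e. Qed.

(* The position of an arrow with superscript j.+1 among those at time t. *)
Definition arrow_pos (t : int) (j : 'I_n) : int :=
  ((a%:Z + j.+1.*2%:Z - t) %/ 4)%Z.

(** At time t an arrow with superscript j + 1 can only start at the integer x with 4x + t = a + 2(j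
    + 1), so each superscript contributes at most one term. *)
Definition arrow_sum (c : int -> 'I_n -> K) (t : int) : 'M[K]_a :=
  \sum_(j < n | (4 %| a%:Z + j.+1.*2%:Z - t)%Z)
    c (arrow_pos t j) j *:
      delta_mx (res (arrow_pos t j - j.+1%:Z)) (res (arrow_pos t j)).

Definition stokes_mx (c : int -> 'I_n -> K) (t : int) : 'M[K]_a :=
  1 + arrow_sum c t.

Lemma arrow_posP t (j : 'I_n) : (4 %| a%:Z + j.+1.*2%:Z - t)%Z ->
  4 * arrow_pos t j + t = a%:Z + j.+1.*2%:Z.
Proof. by move=> /divzK; rewrite /arrow_pos; lia. Qed.

Lemma arrow_pos_eq t (j : 'I_n) x : 4 * x + t = a%:Z + j.+1.*2%:Z ->
  (4 %| a%:Z + j.+1.*2%:Z - t)%Z /\ arrow_pos t j = x.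
Proof.
move=> e; have e' : a%:Z + j.+1.*2%:Z - t = x * 4 by lia.
by rewrite /arrow_pos e' mulzK // dvdz_mull.
Qed.

(** The arrow sum has square zero: at a given time a source and a target are at positions whose
    difference lies strictly between 0 and a, so no arrow starts where another ends. *)
Lemma stokes_mx_unit c t : stokes_mx c t \is a GRing.unit.
Proof.
apply/unitrP; exists (1 - arrow_sum c t).
suff N0 : arrow_sum c t * arrow_sum c t = 0.
  rewrite /stokes_mx; split.
    by rewrite mulrBl mul1r mulrDr mulr1 N0 addr0 addrK.
  by rewrite mulrDl mul1r mulrBr mulr1 N0 subr0 subrK.
rewrite mulr_suml big1 // => j /arrow_posP hj.
rewrite mulr_sumr big1 // => j' /arrow_posP hj'.
rewrite -mulmxE -scalemxAl -scalemxAr mul_delta_mx_cond res_eq.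
case: (boolP (_ %| _)%Z) => [/dvdz_small h|_]; last by rewrite mulr0n !scaler0.
exfalso; have := ltn_ord j; have := ltn_ord j'; lia.
Qed.

(** The bounds exclude every other representative of x modulo a: moving x by a nonzero multiple of a
    takes 4x + t out of the open interval from a to 3a where arrows start. *)
Lemma stokes_mx_vec c (t x : int) : - a%:Z <= 4 * x + t <= 4 * a%:Z ->
  stokes_mx c t *m basis_vec x = basis_vec x +
    \sum_(j < n | 4 * x + t == a%:Z + j.+1.*2%:Z)
      c x j *: basis_vec (x - j.+1%:Z).
Proof.
move=> hx; rewrite mulmxDl mul1mx mulmx_suml; congr (_ + _).
rewrite big_mkcond [RHS]big_mkcond; apply: eq_bigr => j _.
case: (boolP (_ == _)) => [/eqP /arrow_pos_eq [-> ->]|/eqP ne].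
  by rewrite -scalemxAl mul_delta_mx_cond eqxx.
case: ifP => // /arrow_posP hj.
rewrite -scalemxAl mul_delta_mx_cond res_eq.
case: (boolP (_ %| _)%Z) => [/dvdz_small h|_]; last by rewrite mulr0n scaler0.
exfalso; apply: ne; have := ltn_ord j; lia.
Qed.

Lemma arrow_term_entry t j k k' :
  (delta_mx (res (arrow_pos t j - j.+1%:Z)) (res (arrow_pos t j)) : 'M[K]_a) k k'
  = ((k == res (arrow_pos t j - j.+1%:Z)) && (k' == res (arrow_pos t j)))%:R.
Proof. by rewrite mxE. Qed.

Lemma stokes_mx_diag c t k : stokes_mx c t k k = 1.
Proof.
rewrite !mxE eqxx summxE big1 ?addr0 // => j _.
rewrite mxE arrow_term_entry; case: eqP => [e1|_]; last by rewrite mulr0.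
case: eqP => [e2|_]; last by rewrite mulr0.
have /negP[] : res (arrow_pos t j - j.+1%:Z) != res (arrow_pos t j).
  by rewrite res_neq //= ltnS.
by rewrite -e1 -e2.
Qed.

Lemma stokes_mx_entry c t x (j : 'I_n) : 4 * x + t = a%:Z + j.+1.*2%:Z ->
  stokes_mx c t (res (x - j.+1%:Z)) (res x) = c x j.
Proof.
move=> e; rewrite !mxE summxE (negbTE (res_neq _ _)) ?add0r; last by rewrite /= ltnS.
have [hj hx] := arrow_pos_eq e.
rewrite (bigD1 j) //= mxE arrow_term_entry hx !eqxx mulr1 big1 ?addr0 // => j'.
case/andP => /arrow_posP hj' ne.
rewrite mxE arrow_term_entry andbC res_eq.
case: (boolP (_ %| _)%Z) => [/dvdz_small h|_]; last by rewrite mulr0.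
case/eqP: ne; apply: val_inj.
by have := ltn_ord j; have := ltn_ord j'; rewrite /=; lia.
Qed.

Definition is_arrow t (k' k : 'I_a) := exists x (j : 'I_n),
  [/\ 4 * x + t = a%:Z + j.+1.*2%:Z, k' = res x & k = res (x - j.+1%:Z)].

Lemma is_arrow_neq t k' k : is_arrow t k' k -> k' != k.
Proof.
by move=> [x [j [_ -> ->]]]; rewrite eq_sym res_neq //= ltnS.
Qed.

Lemma stokes_mx0 c t k k' : k != k' -> ~ is_arrow t k' k ->
  stokes_mx c t k k' = 0.
Proof.
move=> ne na; rewrite !mxE summxE (negbTE ne) add0r big1 // => j /arrow_posP hj.
rewrite mxE arrow_term_entry; case: eqP => [e1|_]; last by rewrite mulr0.
case: eqP => [e2|_]; last by rewrite mulr0.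
by case: na; exists (arrow_pos t j), j.
Qed.

Lemma stokes_mx_uniq c t (B : 'M[K]_a) :
  (forall k, B k k = 1) ->
  (forall k k', k != k' -> ~ is_arrow t k' k -> B k k' = 0) ->
  (forall x (j : 'I_n), 4 * x + t = a%:Z + j.+1.*2%:Z ->
     B (res (x - j.+1%:Z)) (res x) = c x j) ->
  stokes_mx c t = B.
Proof.
move=> B1 B0 Bc; apply/matrixP => k k'.
have [<-|ne] := eqVneq k k'; first by rewrite stokes_mx_diag B1.
have [[x [j [e -> ->]]]|na] := pselect (is_arrow t k' k).
  by rewrite stokes_mx_entry // Bc.
by rewrite stokes_mx0 // B0.
Qed.

(** * Frames continued in time and the recurrence of their recessive vectors *)

Section FrameSequence.
Variables (c : int -> 'I_n -> K) (F : int -> 'M[K]_a).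
Hypothesis HF : forall t : int, F (t - 1) = F t * stokes_mx c t.

(* Its value at x is the column of F of index x at the time when the decay of
   the corresponding exponential factor is the fastest; by frame_const this
   column does not jump around that time. *)
Definition frame_seq (x : int) : 'cV[K]_a := F (- (4 * x)) *m basis_vec x.

Lemma frame_step (x t : int) : - a%:Z <= 4 * x + t <= 4 * a%:Z ->
  F (t - 1) *m basis_vec x = F t *m basis_vec x +
    \sum_(j < n | 4 * x + t == a%:Z + j.+1.*2%:Z)
      c x j *: (F t *m basis_vec (x - j.+1%:Z)).
Proof.
move=> hx; rewrite HF -mulmxE -mulmxA stokes_mx_vec // mulmxDr mulmx_sumr.
by congr (_ + _); apply: eq_bigr => j _; rewrite scalemxAr.
Qed.

Lemma frame_step0 (x t : int) : - a%:Z <= 4 * x + t <= a%:Z + 1 ->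
  F (t - 1) *m basis_vec x = F t *m basis_vec x.
Proof.
move=> hx; rewrite frame_step; last by lia.
by rewrite big_pred0 ?addr0 // => j; apply/negP => /eqP; lia.
Qed.

(** The first arrow leaving x acts at 4x + t = a + 2, and the symmetric bound covers the targets of
    all arrows at the times when they are hit. *)
Lemma frame_const (x t : int) : - a%:Z <= 4 * x + t <= a%:Z ->
  F t *m basis_vec x = frame_seq x.
Proof.
have up (d : nat) : (d <= a)%N ->
    F (- (4 * x) + d%:Z) *m basis_vec x = frame_seq x.
  elim: d => [|d IH] hd; first by rewrite /frame_seq addr0.
  rewrite -IH 1?ltnW // -frame_step0; last by lia.
  by congr (F _ *m _); lia.
have down (d : nat) : (d <= a)%N ->
    F (- (4 * x) - d%:Z) *m basis_vec x = frame_seq x.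
  elim: d => [|d IH] hd; first by rewrite /frame_seq subr0.
  rewrite -IH 1?ltnW // -[RHS]frame_step0; last by lia.
  by congr (F _ *m _); lia.
move=> ht; have [h|h] := leP 0 (4 * x + t).
  by rewrite -(up `|(4 * x + t)%R|%N); [congr (F _ *m _); lia|lia].
by rewrite -(down `|(4 * x + t)%R|%N); [congr (F _ *m _); lia|lia].
Qed.

(** Going forward from the fastest decay of x, each arrow met adds the target column at that time,
    which [frame_const] identifies with its recessive vector. *)
Lemma frame_jumps x (X : nat) : (X <= 4 * a)%N ->
  frame_seq x = F (X%:Z - 4 * x) *m basis_vec x +
    \sum_(j < n | (a + j.+1.*2 <= X)%N) c x j *: frame_seq (x - j.+1%:Z).
Proof.
elim: X => [|X IH] hX.
  by rewrite big_pred0 => [|j]; rewrite ?addr0 /frame_seq ?sub0r //; lia.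
rewrite IH; last by lia.
have -> : X%:Z - 4 * x = X.+1%:Z - 4 * x - 1 by lia.
rewrite frame_step; last by lia.
rewrite -addrA; congr (_ + _).
rewrite big_mkcond [X in _ + X]big_mkcond [RHS]big_mkcond -big_split.
apply: eq_bigr => j _ /=.
have -> : (4 * x + (X.+1%:Z - 4 * x) == a%:Z + j.+1.*2%:Z) = (X.+1 == a + j.+1.*2)%N.
  by apply/eqP/eqP; lia.
case: eqP => h.
  rewrite h leqnn (_ : (_ <= X)%N = false) ?addr0; last by lia.
  by rewrite frame_const //; have := ltn_ord j; lia.
rewrite add0r; congr (if _ then _ else _); lia.
Qed.

Lemma frame_seq_vsolves : vsolves c 1 frame_seq.
Proof.
move=> x; rewrite (@frame_jumps x (4 * a)) // scale1r addrC; congr (_ + _).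
  by apply: eq_bigl => j; have := ltn_ord j; lia.
(* After 4a units the same column, renamed x - a, is at its next fastest decay. *)
rewrite (@basis_vec_eq x (x - a%:Z)); last by rewrite opprB addrC subrK.
by rewrite /frame_seq; congr (F _ *m _); lia.
Qed.

(** A row vanishing on all recessive vectors vanishes on every column of [F 0]: for 0 <= x < a,
    stopping [frame_jumps] at time 0 writes that column as a combination of recessive vectors. *)
Lemma frame_window_unit m : F 0 \in unitmx -> window frame_seq m \in unitmx.
Proof.
move=> uF; apply: unitmx_kernel => xi H.
have H0 := vsolves_row_eq0 (oner_neq0 _) frame_seq_vsolves H.
apply: (can_inj (mulmxK uF)); rewrite mul0mx.
apply/matrixP => i k; rewrite !ord1 [RHS]mxE.
pose x := (((k : nat)%:Z - i0) %% a%:Z)%Z.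
have kx : k = res x.
  apply/eqP; rewrite -{1}[k]res_lift res_eq -eqz_mod_dvd; apply/eqP.
  by rewrite modz_mod.
have hx1 : (0 <= x)%Z by rewrite modz_ge0.
have hx2 : (x < a%:Z)%Z by rewrite ltz_pmod.
have := @frame_jumps x (4 * `|x|)%N.
have -> : (4 * `|x|)%N%:Z - 4 * x = 0 by lia.
move=> /(_ _) E; have {E} : xi *m frame_seq x = xi *m (F 0 *m basis_vec x).
  rewrite E; last by lia.
  rewrite mulmxDr mulmx_sumr big1 ?addr0 // => j _.
  by rewrite -scalemxAr H0 scaler0.
rewrite H0 mulmxA /basis_vec -kx -colE => /matrixP /(_ 0 0).
by rewrite !mxE => <-.
Qed.

End FrameSequence.

End Frames.

Lemma dvdz_addM (d q m : int) : (d %| m + q * d)%Z = (d %| m)%Z.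
Proof. by rewrite rpredDr // dvdz_mull. Qed.

Lemma periodic_eq (T : Type) (f : int -> T) (d : int) :
  (forall x, f (x - d) = f x) -> forall x y, (d %| x - y)%Z -> f x = f y.
Proof.
move=> fd x y /dvdzP [q e]; have -> : x = y + q * d by lia.
apply: (@int_ind_pm (fun q => f (y + q * d) = f y) 0) => [|{e} {}q|{e} {}q].
- by rewrite mul0r addr0.
- by move=> <-; rewrite -[LHS]fd; congr f; lia.
- by move=> <-; rewrite -[RHS]fd; congr f; lia.
Qed.

(** * Formal monodromy and quasi-periodicity *)

Section Monodromy.
Variables (K : fieldType) (n b : nat) (i0 : int).
Local Notation a := n.+1.
Local Notation res x := (residue n (i0 + x)).
Local Notation basis_vec := (basis_vec K n i0).
Local Notation stokes_mx := (stokes_mx i0).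
Local Notation frame_seq := (frame_seq i0).
Variable H : int -> K.
Hypothesis Ha : forall x, H (x - a%:Z) = H x.
Hypothesis H0 : forall x, H x != 0.

Definition hmx : 'M[K]_a :=
  \matrix_(k, k') if k == residue n ((k' : nat)%:Z + b%:Z)
                  then H ((k : nat)%:Z - i0) else 0.

Lemma hmxE x y : hmx (res x) (res y) = if (a%:Z %| x - b%:Z - y)%Z then H x else 0.
Proof.
have modE z : exists q, (res z : nat)%:Z = i0 + z + q * a%:Z.
  by exists (- ((i0 + z) %/ a%:Z)%Z); rewrite val_residue /modz; lia.
have [q hq] := modE x; have [q' hq'] := modE y.
rewrite mxE residue_eq hq hq'.
have -> : i0 + x - (i0 + y + q' * a%:Z + b%:Z) = (x - b%:Z - y) + (- q') * a%:Z by lia.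
rewrite dvdz_addM; case: ifP => // _.
apply: (periodic_eq Ha); rewrite (_ : _ - _ = q * a%:Z); last by lia.
exact: dvdz_mull.
Qed.

Lemma lift_res (k : 'I_a) : exists x, k = res x.
Proof. by exists ((k : nat)%:Z - i0); rewrite res_lift. Qed.

Lemma hmx_delta x (k : 'I_1) :
  hmx *m delta_mx (res (x - b%:Z)) k = H x *: delta_mx (res x) k.
Proof.
apply/matrixP => l i; rewrite !ord1 -colE mxE [RHS]mxE [delta_mx _ _ _ _]mxE eqxx andbT.
have [y ->] := lift_res l; rewrite hmxE.
rewrite res_eq (_ : y - b%:Z - (x - b%:Z) = y - x); last by lia.
case: (boolP (_ %| _)%Z) => [h|_]; last by rewrite mulr0.
by rewrite mulr1 (periodic_eq Ha h).
Qed.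

Lemma hmx_basis x : hmx *m basis_vec (x - b%:Z) = H x *: basis_vec x.
Proof. exact: hmx_delta. Qed.

Lemma hmx_unit : hmx \is a GRing.unit.
Proof.
apply: unitmx_kernel => xi Hxi; apply/matrixP => i k; rewrite !ord1 [RHS]mxE.
have [x ->] := lift_res k.
have : xi *m hmx *m basis_vec (x - b%:Z) = 0 by rewrite Hxi mul0mx.
rewrite -mulmxA hmx_basis -scalemxAr -colE => /matrixP /(_ 0 0).
by rewrite !mxE => /eqP; rewrite mulf_eq0 (negbTE (H0 x)) => /eqP.
Qed.

(** The condition obtained by substituting V (x - b) = H x V x in the recurrence at x - b and
    comparing coefficients, written without division. *)
Definition twisted (c : int -> 'I_n -> K) :=
  forall x j, c (x - b%:Z) j * H (x - j.+1%:Z) = H x * c x j.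

Lemma basis_vec_ext (A B : 'M[K]_a) :
  (forall x, A *m basis_vec x = B *m basis_vec x) -> A = B.
Proof.
move=> AB; apply/matrixP => i k; have [x ->] := lift_res k.
by have /matrixP /(_ i 0) := AB x; rewrite -!colE !mxE.
Qed.

(** Moving t by 4b and x by -b leaves 4x + t unchanged, so the same arrows occur; [twisted] accounts
    for the factors of h at their ends. *)
Lemma stokes_mx_twist c t : twisted c ->
  hmx * stokes_mx c (t + 4 * b%:Z) = stokes_mx c t * hmx.
Proof.
move=> tc; apply: basis_vec_ext => y.
(* The representative x of y + b modulo a is chosen in the range where [stokes_mx_vec] applies. *)
pose q := ((4 * (y + b%:Z) + t) %/ (4 * a%:Z))%Z.
pose x := y + b%:Z - q * a%:Z.
have hq : 0 <= 4 * x + t < 4 * a%:Z.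
  rewrite (_ : 4 * x + t = ((4 * (y + b%:Z) + t) %% (4 * a%:Z))%Z).
    by rewrite modz_ge0 // ltz_pmod.
  by rewrite /x /modz -/q; lia.
have <- : basis_vec (x - b%:Z) = basis_vec y.
  by apply: basis_vec_eq; rewrite /x (_ : _ - _ = (- q) * a%:Z) ?dvdz_mull //; lia.
rewrite -!mulmxE -!mulmxA hmx_basis -scalemxAr !stokes_mx_vec; last 2 first.
- by lia.
- by lia.
rewrite mulmxDr hmx_basis scalerDr; congr (_ + _).
rewrite mulmx_sumr scaler_sumr; apply: eq_big => [j|j _]; first by apply/eqP/eqP; lia.
rewrite -scalemxAr scalerA -tc.
rewrite (_ : x - b%:Z - j.+1%:Z = x - j.+1%:Z - b%:Z); last by lia.
by rewrite hmx_basis scalerA.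
Qed.

Section Twisted.
Variables (c : int -> 'I_n -> K) (F : int -> 'M[K]_a).
Hypothesis tc : twisted c.
Hypothesis HF : forall t : int, F (t - 1) = F t * stokes_mx c t.
Hypothesis F0 : F 0 = 1.

(** [F (t + 4b)] and [F (4b) h^-1 F t h] satisfy the same first-order equation in t and agree at
    0. *)
Lemma frame_seq_shift x : frame_seq F (x - b%:Z) =
  H x *: (F (4 * b%:Z) * hmx^-1 *m frame_seq F x).
Proof.
have FE t : F (t + 4 * b%:Z) = F (4 * b%:Z) * hmx^-1 * F t * hmx.
  have uS u : stokes_mx c (u + 4 * b%:Z) \is a GRing.unit by exact: stokes_mx_unit.
  apply: (zprod_uniq (m := 0) uS (F := fun t => F (t + 4 * b%:Z))
    (F' := fun t => F (4 * b%:Z) * hmx^-1 * F t * hmx)) => [z|z|].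
  - by rewrite -HF; congr F; lia.
  - by rewrite HF -!mulrA stokes_mx_twist.
  - by rewrite F0 mulr1 mulrVK ?hmx_unit // add0r.
rewrite /frame_seq (_ : - (4 * (x - b%:Z)) = - (4 * x) + 4 * b%:Z); last by lia.
by rewrite FE -mulmxE -mulmxA hmx_basis -scalemxAr mulmxA.
Qed.

Lemma frame_quasiperiodic : F (4 * b%:Z) = hmx ->
  forall x, frame_seq F (x - b%:Z) = H x *: frame_seq F x.
Proof. by move=> e x; rewrite frame_seq_shift e mulrV ?hmx_unit // mul1mx. Qed.

(** One quasi-periodic basis of solutions suffices: the frame sequence is a linear image of it, so
    it is fixed by [F (4b) h^-1], and its windows are invertible. *)
Lemma frame_monodromy V m : vsolves c 1 V -> window V m \in unitmx ->
  (forall x, V (x - b%:Z) = H x *: V x) -> F (4 * b%:Z) = hmx.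
Proof.
move=> HV um VH.
have sF := frame_seq_vsolves HF.
have [g gV] := vsolves_expand (oner_neq0 _) HV um sF.
have fix_seq x : F (4 * b%:Z) * hmx^-1 *m frame_seq F x = frame_seq F x.
  apply: (scalerI (H0 x)); rewrite -frame_seq_shift !gV VH.
  by rewrite scalemxAr.
have uw : window (frame_seq F) 0 \in unitmx.
  by apply: (frame_window_unit (F := F) HF); rewrite F0 unitmx1.
suff e : F (4 * b%:Z) * hmx^-1 = 1.
  by rewrite -[hmx]mul1r -e mulrVK ?hmx_unit.
apply: (can_inj (mulmxK uw)); rewrite mul1mx -window_mul.
by congr window; apply/funext.
Qed.

End Twisted.

End Monodromy.

(** * Signs and potentials on Z *)

Lemma signr_neq0 (K : fieldType) (m : nat) : (-1) ^+ m != 0 :> K.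
Proof. by rewrite signr_eq0. Qed.
Arguments signr_neq0 {K m}.

Lemma signr_sqr (K : fieldType) (m : nat) : (-1) ^+ m * (-1) ^+ m = 1 :> K.
Proof. by rewrite -exprMn mulrNN mulr1 expr1n. Qed.
Arguments signr_sqr {K m}.

Section Lattice.
Variables (a b : nat).
Hypotheses (a0 : (0 < a)%N) (b0 : (0 < b)%N).
Local Notation p := (gcdn a b).
Local Notation r := (a %/ p)%N.
Local Notation s := (b %/ p)%N.

Lemma lattice_gcd0 : (0 < p)%N. Proof. by rewrite gcdn_gt0 a0. Qed.

Lemma lattice_a : a%:Z = r%:Z * p%:Z.
Proof. by rewrite -PoszM divnK // dvdn_gcdl. Qed.

Lemma lattice_b : b%:Z = s%:Z * p%:Z.
Proof. by rewrite -PoszM divnK // dvdn_gcdr. Qed.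

Lemma lattice_r0 : (0 < r)%N.
Proof. by rewrite divn_gt0 ?lattice_gcd0 // dvdn_leq // dvdn_gcdl. Qed.

Lemma lattice_coprime : coprime r s.
Proof.
have := lattice_gcd0; have e : (gcdn r s * p = p)%N.
  by rewrite muln_gcdl !divnK ?dvdn_gcdl ?dvdn_gcdr.
by rewrite /coprime; nia.
Qed.

(** Positions are counted from 0, so z = m - 1 has first coordinate iota_m - 1. Bounding l by r
    makes the triple unique, since s a = r b is the relation between the two steps. *)
Definition lattice_coords (z : int) (t : int * int * int) :=
  [/\ 0 <= t.1.1 < p%:Z, 0 <= t.2 < r%:Z
    & z = t.1.1 + t.1.2 * a%:Z - t.2 * b%:Z].

Lemma lattice_coords_exists z : exists t, lattice_coords z t.
Proof.
have p0 := lattice_gcd0; have r0 := lattice_r0.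
have /eqP g1 := lattice_coprime.
have [u [v uv]] := Bezoutz r%:Z s%:Z.
have {}uv : u * r%:Z + v * s%:Z = 1 by rewrite uv /gcdz /= g1.
(* The Bezout coefficients give one solution; l is then reduced modulo r and the quotient absorbed
   in k. *)
pose y := (z %/ p%:Z)%Z; pose l0 := - (y * v).
pose l := (l0 %% r%:Z)%Z; pose q := (l0 %/ r%:Z)%Z.
have el : l0 = q * r%:Z + l by exact: divz_eq.
exists ((z %% p%:Z)%Z, y * u - q * s%:Z, l); split => /=.
- by rewrite modz_ge0 ?ltz_pmod //; lia.
- by rewrite modz_ge0 ?ltz_pmod //; lia.
rewrite lattice_a lattice_b.
have -> : (z %% p%:Z)%Z + (y * u - q * s%:Z) * (r%:Z * p%:Z) - l * (s%:Z * p%:Z) =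
  (z %% p%:Z)%Z + (y * (u * r%:Z) - (q * r%:Z + l) * s%:Z) * p%:Z by ring.
rewrite -el /l0 mulNr opprK -mulrA -mulrDr uv mulr1 addrC.
exact: divz_eq.
Qed.

Lemma lattice_coords_uniq z t t' :
  lattice_coords z t -> lattice_coords z t' -> t = t'.
Proof.
case: t => [[i k] l]; case: t' => [[i' k'] l'] [/= hi hl e] [/= hi' hl' e'].
have p0 := lattice_gcd0; have r0 := lattice_r0.
move: (e); rewrite e' => {e'}e.
move: (e); rewrite lattice_a lattice_b => ee.
have ii : i - i' = 0.
  apply: (@dvdz_small p%:Z); last by lia.
  apply/dvdzP; exists (k' * r%:Z - l' * s%:Z - k * r%:Z + l * s%:Z).
  rewrite !mulrDl !mulNr -!mulrA; lia.
have kl : (k - k') * r%:Z = (l - l') * s%:Z.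
  have p1 : p%:Z != 0 by lia.
  apply: (mulIf p1); rewrite -!mulrA mulrBl [RHS]mulrBl; lia.
have ll : l - l' = 0.
  apply: (@dvdz_small r%:Z); last by lia.
  have : (r%:Z %| (l - l') * s%:Z)%Z by rewrite -kl dvdz_mull.
  by rewrite Gauss_dvdzl //= /coprimez /gcdz /=; apply: lattice_coprime.
have kk : k - k' = 0.
  by move/eqP: kl; rewrite ll mul0r mulf_eq0 => /orP [] /eqP; lia.
by congr (_, _, _); lia.
Qed.

Definition lattice_coord z := sval (cid (lattice_coords_exists z)).
Definition lat_i z := (lattice_coord z).1.1.
Definition lat_k z := (lattice_coord z).1.2.
Definition lat_l z := (lattice_coord z).2.

Lemma latP z : lattice_coords z (lat_i z, lat_k z, lat_l z).
Proof.
rewrite /lat_i /lat_k /lat_l /lattice_coord; case: cid => -[[i k] l] //=.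
Qed.

Lemma latE z i k l : lattice_coords z (i, k, l) ->
  [/\ lat_i z = i, lat_k z = k & lat_l z = l].
Proof. by move=> /(lattice_coords_uniq (latP z)) []. Qed.

(** These are the residues at which a reduced formal monodromy may differ from 1. *)
Definition low z := (z %% a%:Z < p%:Z)%Z.

Lemma lattice_p_le : p%:Z <= a%:Z.
Proof. by rewrite lez_nat dvdn_leq // dvdn_gcdl. Qed.

Lemma low_lat z : low z = (lat_l z == 0).
Proof.
have [/= hi hl e] := latP z; have pa := lattice_p_le.
apply/idP/eqP => [lo|l0].
  have c : lattice_coords z ((z %% a%:Z)%Z, (z %/ a%:Z)%Z, 0).
    split => /=; [by rewrite modz_ge0 ?lo //; lia|by have := lattice_r0; lia|].
    by rewrite mul0r subr0 addrC -divz_eq.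
  by have [_ _] := latE c.
rewrite /low e l0 mul0r subr0 addrC modzMDl modz_small; lia.
Qed.

Lemma low_mod z : low z -> lat_i z = (z %% a%:Z)%Z.
Proof.
rewrite low_lat => /eqP l0; have [/= hi hl {2}->] := latP z.
have pa := lattice_p_le.
by rewrite l0 mul0r subr0 addrC modzMDl modz_small //; lia.
Qed.

Lemma lat_subA z :
  [/\ lat_i (z - a%:Z) = lat_i z, lat_k (z - a%:Z) = lat_k z - 1
    & lat_l (z - a%:Z) = lat_l z].
Proof.
have [/= hi hl e] := latP z.
by apply: latE; split => //=; rewrite mulrBl mul1r; lia.
Qed.

Lemma lattice_ab : s%:Z * a%:Z = r%:Z * b%:Z.
Proof. by rewrite lattice_a lattice_b mulrCA. Qed.

(** Subtracting b raises l by one, except from r - 1, where r b = s a folds l back to 0 and lowers k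
    by s. The residue reached is low precisely in that exceptional case. *)
Lemma lat_subB_low z : low (z - b%:Z) ->
  [/\ lat_i (z - b%:Z) = lat_i z, lat_k (z - b%:Z) = lat_k z - s%:Z,
      lat_l (z - b%:Z) = 0 & lat_l z = r%:Z - 1].
Proof.
rewrite low_lat => /eqP l0; have [/= hi hl e] := latP z.
have ab := lattice_ab; have r0 := lattice_r0.
have [lr|lr] := eqVneq (lat_l z) (r%:Z - 1).
  have c : lattice_coords (z - b%:Z) (lat_i z, lat_k z - s%:Z, 0).
    by split => //=; lia.
  by have [-> -> ->] := latE c.
have c : lattice_coords (z - b%:Z) (lat_i z, lat_k z, lat_l z + 1).
  by split => //=; [lia|rewrite mulrDl mul1r; lia].
by have [_ _] := latE c; lia.
Qed.

Lemma lat_subB_high z : ~~ low (z - b%:Z) ->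
  [/\ lat_i (z - b%:Z) = lat_i z, lat_k (z - b%:Z) = lat_k z
    & lat_l (z - b%:Z) = lat_l z + 1].
Proof.
rewrite low_lat => /eqP l0; have [/= hi hl e] := latP z.
have ab := lattice_ab; have r0 := lattice_r0.
have [lr|lr] := eqVneq (lat_l z) (r%:Z - 1).
  have c : lattice_coords (z - b%:Z) (lat_i z, lat_k z - s%:Z, 0).
    by split => //=; lia.
  by have [_ _] := latE c.
by apply: latE; split => //=; [lia|rewrite mulrDl mul1r; lia].
Qed.

(** Every z is joined to [lat_i z] by steps of a and by fewer than r steps of b, none of which lands
    on a low residue; the endpoint depends only on z modulo p. *)
Lemma lattice_constant (T : Type) (f : int -> T) :
  (forall z, f (z - a%:Z) = f z) ->
  (forall z, ~~ low (z - b%:Z) -> f (z - b%:Z) = f z) ->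
  forall z z', (p%:Z %| z - z')%Z -> f z = f z'.
Proof.
move=> fa fb.
have walk i k (l : nat) : 0 <= i < p%:Z -> (l < r)%N ->
    f (i + k * a%:Z - l%:Z * b%:Z) = f i.
  move=> hi; elim: l => [|l IH] hl.
    apply: (periodic_eq fa); rewrite mul0r subr0 addrAC subrr add0r.
    exact: dvdz_mull.
  rewrite -(IH (ltnW hl)).
  have -> : i + k * a%:Z - l.+1%:Z * b%:Z = i + k * a%:Z - l%:Z * b%:Z - b%:Z by lia.
  rewrite fb // low_lat.
  have c : lattice_coords (i + k * a%:Z - l%:Z * b%:Z - b%:Z) (i, k, l.+1%:Z).
    by split => /=; lia.
  by have [_ _ ->] := latE c.
have fi z : f z = f (lat_i z).
  have [/= hi hl e] := latP z; rewrite {1}e.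
  by have := walk _ (lat_k z) `|lat_l z|%N hi; rewrite gez0_abs; [apply|]; lia.
move=> z z' /dvdzP [q hq]; rewrite fi (fi z'); congr f.
have [/= hi hl e] := latP z; have [/= hi' hl' e'] := latP z'.
apply/eqP; rewrite -subr_eq0; apply/eqP/(@dvdz_small p%:Z); last by lia.
apply/dvdzP; exists (q - (lat_k z - lat_k z') * r%:Z + (lat_l z - lat_l z') * s%:Z).
have -> : lat_i z - lat_i z' = q * p%:Z - (lat_k z - lat_k z') * a%:Z
    + (lat_l z - lat_l z') * b%:Z by lia.
by rewrite lattice_a lattice_b; ring.
Qed.

(** The term l b lies between 0 and (r - 1) b = s a - b, which confines k a. This reconciles the
    lattice coordinates with the range of k in [eps_sign]. *)
Lemma lat_k_range (m : nat) : (p < m <= a + b)%N ->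
  1 <= lat_k (m%:Z - 1) <= s%:Z.
Proof.
move=> hm; have [/= hi hl e] := latP (m%:Z - 1).
set k := lat_k _ in e *; set l := lat_l _ in hl e; set i := lat_i _ in hi e.
have lb : 0 <= l * b%:Z by rewrite mulr_ge0 //; lia.
have lb' : l * b%:Z <= (r%:Z - 1) * b%:Z by rewrite ler_wpM2r //; lia.
rewrite mulrBl -lattice_ab mul1r in lb'.
apply/andP; split.
  have : 0 < k * a%:Z by lia.
  by rewrite pmulr_lgt0 //; lia.
have : k * a%:Z < (s%:Z + 1) * a%:Z by rewrite mulrDl mul1r; lia.
by rewrite ltr_pM2r; lia.
Qed.

Lemma lat_nat (m i k l : nat) : (p < m)%N -> (1 <= i <= p)%N -> (k <= s)%N ->
  (m + l * b = i + k * a)%N ->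
  lat_k (m%:Z - 1) = k%:Z /\ lat_l (m%:Z - 1) = l%:Z.
Proof.
move=> hm hi hk e.
have hl : (l < r)%N.
  have ka : (k * a <= s * a)%N by rewrite leq_mul2r hk orbT.
  have ab : (s * a = r * b)%N by apply/eqP; rewrite -eqz_nat !PoszM lattice_ab.
  by rewrite -(ltn_pmul2r b0) -ab; lia.
have c : lattice_coords (m%:Z - 1) (i%:Z - 1, k%:Z, l%:Z).
  by split => /=; lia.
by have [_ -> ->] := latE c.
Qed.

(** * Multiplicative potentials for translation by a *)

Section Potential.
Variables (K : fieldType) (g : int -> K).
Hypothesis gb : forall z, g (z - b%:Z) = g z.
Hypothesis g0 : forall z, g z != 0.

(* A solution of P (z - a) = g z * P z which is b-periodic up to the factor
   potential_monodromy, itself a-periodic and equal to 1 off the low residues. *)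
Definition potential (z : int) : K :=
  zprod (fun k => g (lat_i z + k * a%:Z)) (lat_k z).

(** On a low residue this is the product of [g] over s successive steps of length a, a full cycle
    modulo b because s a = r b. *)
Definition potential_monodromy (z : int) : K :=
  if low z then zprod (fun k => g ((z %% a%:Z)%Z + k * a%:Z)) (- s%:Z) else 1.

Let gU i k : g (i + k * a%:Z) \is a GRing.unit.
Proof. by rewrite unitfE. Qed.

Lemma potential_neq0 z : potential z != 0.
Proof. by rewrite -unitfE zprod_unit // => k; exact: gU. Qed.

Lemma potential_monodromy_neq0 z : potential_monodromy z != 0.
Proof.
rewrite /potential_monodromy; case: ifP => _; last exact: oner_neq0.
by rewrite -unitfE zprod_unit // => k; exact: gU.
Qed.

Lemma potential_monodromy_periodic z :
  potential_monodromy (z - a%:Z) = potential_monodromy z.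
Proof.
have e : ((z - a%:Z) %% a%:Z)%Z = (z %% a%:Z)%Z.
  by rewrite (_ : z - a%:Z = -1 * a%:Z + z) ?modzMDl; last by rewrite mulN1r addrC.
by rewrite /potential_monodromy /low e.
Qed.

Lemma potential_subA z : potential (z - a%:Z) = g z * potential z.
Proof.
rewrite /potential; have [-> -> _] := lat_subA z.
rewrite zprodP => [|k]; last exact: gU.
rewrite mulrC; congr (_ * _); apply: (periodic_eq gb).
have [/= _ _ e] := latP z; apply/dvdzP; exists (lat_l z); lia.
Qed.

(** The potential ignores l, so it changes only where subtracting b wraps l around and lowers k by
    s. *)
Lemma potential_subB z :
  potential (z - b%:Z) = potential_monodromy (z - b%:Z) * potential z.
Proof.
rewrite /potential_monodromy; case: ifPn => lo.
  rewrite /potential; have [ei -> _ _] := lat_subB_low lo.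
  rewrite -low_mod // ei; set f := fun k => _.
  have uf k : f k \is a GRing.unit by exact: gU.
  (* Shifting k by s moves the argument of [g] by the multiple r b of b, so [F] solves the same
     first-order equation. *)
  pose F z := zprod f (z - s%:Z).
  rewrite -[LHS]/(F (lat_k z)) (zprod_scale uf (F := F)) => [|k].
    by rewrite /F sub0r.
  rewrite /F (_ : k - 1 - s%:Z = k - s%:Z - 1); last by lia.
  rewrite zprodP //; congr (_ * _); apply: (periodic_eq gb).
  rewrite mulrBl lattice_ab (_ : _ - _ = (- r%:Z) * b%:Z); last by lia.
  exact: dvdz_mull.
rewrite /potential; have [-> -> _] := lat_subB_high lo.
by rewrite mul1r.
Qed.

End Potential.

Section LatticeSigns.
Variables (K : fieldType) (n : nat).
Hypothesis rs : (r <= s)%N.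
Local Notation e := ((-1) ^+ n : K).

Definition lattice_sign (z : int) : K := e ^ (lat_k z + lat_l z).
Definition frieze_sign : K := (-1) ^+ ((s - r) * n).
Definition frieze_monodromy (z : int) : K := if low z then frieze_sign else 1.

Lemma frieze_signE : frieze_sign = e ^ (s%:Z - r%:Z).
Proof. by rewrite /frieze_sign mulnC exprM subzn // exprnP. Qed.

Lemma signr_exprz_sqr z : e ^ z * e ^ z = 1.
Proof. by rewrite -expfzMl signr_sqr exp1rz. Qed.

Lemma signr_exprzN z : e ^ (- z) = e ^ z.
Proof.
by rewrite -[LHS]mulr1 -[X in _ * X = _](signr_exprz_sqr z) mulrA -expfzDr ?signr_neq0 // addNr expr0z mul1r.
Qed.

Lemma lattice_sign_sqr z : lattice_sign z * lattice_sign z = 1.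
Proof. exact: signr_exprz_sqr. Qed.

Lemma frieze_monodromy_sqr z : frieze_monodromy z * frieze_monodromy z = 1.
Proof.
rewrite /frieze_monodromy; case: ifP => _; rewrite ?mulr1 //.
by rewrite frieze_signE signr_exprz_sqr.
Qed.

Lemma frieze_monodromy_periodic z :
  frieze_monodromy (z - a%:Z) = frieze_monodromy z.
Proof.
rewrite /frieze_monodromy /low.
by rewrite (_ : z - a%:Z = -1 * a%:Z + z) ?modzMDl; last by rewrite mulN1r addrC.
Qed.

Lemma lattice_sign_subA z : lattice_sign (z - a%:Z) = e * lattice_sign z.
Proof.
rewrite /lattice_sign; have [_ -> ->] := lat_subA z.
rewrite (_ : _ + _ = - 1 + (lat_k z + lat_l z)); last by lia.
by rewrite !expfzDr ?signr_neq0 // (signr_exprzN 1) expr1z.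
Qed.

(** Off the low residues k + l grows by one, giving (-1)^(a - 1). At a wrap it drops by s + r - 1,
    and the additional sign (-1)^((a - 1)(s - r)) is the frieze-compatible value. *)
Lemma lattice_sign_subB z :
  lattice_sign (z - b%:Z) = e * frieze_monodromy (z - b%:Z) * lattice_sign z.
Proof.
rewrite /frieze_monodromy /lattice_sign; case: ifPn => lo.
  have [_ -> -> ->] := lat_subB_low lo.
  rewrite frieze_signE -[e in e * _ * _]expr1z -!expfzDr ?signr_neq0 //.
  rewrite (_ : 1 + _ + _ = lat_k z + s%:Z); last by lia.
  by rewrite addr0 !expfzDr ?signr_neq0 // signr_exprzN.
have [_ -> ->] := lat_subB_high lo.
rewrite mulr1 (_ : lat_k z + (lat_l z + 1) = 1 + (lat_k z + lat_l z)); last by lia.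
by rewrite !expfzDr ?signr_neq0 // expr1z.
Qed.

End LatticeSigns.

End Lattice.

(** * Singular directions *)

Section Trigonometry.
Variable R : realType.
Implicit Types x y : R.

Lemma cosD2piz x (z : int) : cos (x + 2 * pi * z%:~R) = cos x.
Proof.
apply: (@int_ind_pm (fun z : int => cos (x + 2 * pi * z%:~R) = cos x) 0) => [|u <-|u <-].
- by rewrite mulr0 addr0.
- rewrite -[RHS](cosD2pi) intrD; congr cos; ring.
- rewrite -[LHS](cosD2pi) intrD; congr cos; rewrite intrN; ring.
Qed.

Lemma sinD2piz x (z : int) : sin (x + 2 * pi * z%:~R) = sin x.
Proof.
apply: (@int_ind_pm (fun z : int => sin (x + 2 * pi * z%:~R) = sin x) 0) => [|u <-|u <-].
- by rewrite mulr0 addr0.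
- rewrite -[RHS](sinD2pi) intrD; congr sin; ring.
- rewrite -[LHS](sinD2pi) intrD; congr sin; rewrite intrN; ring.
Qed.

Lemma reduce2pi x : exists z : int, - (pi / 2) <= x - 2 * pi * z%:~R < 3 * pi / 2.
Proof.
have p0 := pi_gt0 R.
pose z := Num.floor ((x + pi / 2) / (2 * pi)); exists z.
have /andP [h1 h2] := floor_itv ((x + pi / 2) / (2 * pi)).
rewrite ler_pdivlMr -/z in h1; last by lra.
have {}h2 : x + pi / 2 < (z%:~R + 1) * (2 * pi).
  by move: h2; rewrite ltr_pdivrMr ?intrD1 //; lra.
by apply/andP; split; lra.
Qed.

Lemma cos_lt0 x : cos x < 0 ->
  exists z : int, pi / 2 < x - 2 * pi * z%:~R < 3 * pi / 2.
Proof.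
move=> cx; have p0 := pi_gt0 R; have [z /andP [h1 h2]] := reduce2pi x.
exists z; rewrite h2 andbT ltNge; apply/negP => h3.
move: cx; rewrite -(cosD2piz _ (- z)) intrN mulrN ltNge => /negP; apply.
by apply: cos_ge0_pihalf; rewrite h1 h3.
Qed.

Lemma cos_eqN1 x : cos x = - 1 -> exists z : int, x = pi + 2 * pi * z%:~R.
Proof.
move=> cx; have p0 := pi_gt0 R.
have [|z /andP [h1 h2]] := @cos_lt0 x; first by rewrite cx; lra.
exists z; set y := x - _ in h1 h2.
have cy : cos y = - 1 by rewrite -cx /y -(cosD2piz x (- z)) intrN mulrN.
have ex : x = y + 2 * pi * z%:~R by rewrite /y; ring.
suff ey : y = pi by rewrite [LHS]ex ey.
have [yp|py] := leP y pi.
  by apply: cos_inj; rewrite ?in_itv /= ?cospi // ; apply/andP; split; lra.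
(* The cosine is injective only on [0, pi], so a value beyond pi is reflected. *)
have cy' : cos (2 * pi - y) = - 1.
  by rewrite -cosN opprB -cy -(cosD2piz y (-1)) mulrN1.
suff : 2 * pi - y = pi by lra.
by apply: cos_inj; rewrite ?in_itv /= ?cospi //; apply/andP; split; lra.
Qed.

End Trigonometry.

Section SingularAngles.
Variables (R : realType) (n b : nat) (i0 l0 : int).
Hypothesis (b0 : (0 < b)%N).
Hypothesis (hl0 : odd `|l0|%N).
Local Notation a := n.+1.
Local Notation res x := (residue n (i0 + x)).
Local Notation theta := (decay_angle R n b i0 l0).

(* Time t is measured from the reference direction in quarters of the interval
   between two consecutive directions of most rapid decay. *)
Definition angle (t : int) : R := theta + pi / (2 * b%:R) * t%:~R.

Let b0R : (0 : R) < b%:R. Proof. by rewrite ltr0n. Qed.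
Let a0R : (0 : R) < a%:R. Proof. by rewrite ltr0n. Qed.

Lemma ltr_angle t t' : (angle t < angle t') = (t < t').
Proof.
rewrite /angle ltrD2l ltr_pM2l ?ltr_int //.
by rewrite divr_gt0 ?pi_gt0 // mulr_gt0.
Qed.

Lemma ler_angle t t' : (angle t <= angle t') = (t <= t').
Proof. by rewrite !leNgt ltr_angle. Qed.

Lemma angle_inj : injective angle.
Proof. by move=> t t' e; apply/eqP; rewrite eq_le -!ler_angle e lexx. Qed.

Lemma angle_turn t z : angle t + 2 * pi * z%:~R = angle (t + 4 * b%:Z * z).
Proof.
rewrite /angle intrD !intrM /= -addrA; congr (_ + _).
by have := b0R; move=> ?; field; lra.
Qed.

Lemma decay_angleE x : decay_angle R n b (i0 + x) l0 = angle (- (4 * x)).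
Proof.
rewrite /angle /decay_angle intrN intrM intrD.
by have := b0R; move=> ?; field; lra.
Qed.

Lemma arrow_angleE x j :
  arrow_angle R n b (i0 + x) l0 j = angle (a%:Z + j.*2%:Z - 4 * x).
Proof.
rewrite /angle /decay_angle /arrow_angle -muln2 PoszM !intrD intrN !intrM.
by have := b0R; move=> ?; field; lra.
Qed.

(** Oddness of [l0] produces the half turn that makes the factor of index m equal to -1 when 4m + t
    = 0. *)
Lemma exp_factor_res x (t : R) (m : int) :
  x = theta + pi / (2 * b%:R) * t ->
  exp_factor n b (res m : nat)%:Z x =
  (- cos (pi / (2 * a%:R) * (4 * m%:~R + t)) +i*
   - sin (pi / (2 * a%:R) * (4 * m%:~R + t)))%C.
Proof.
move=> ex; rewrite /exp_factor.
have [q hq] : exists q, (res m : nat)%:Z = i0 + m + q * a%:Z.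
  by exists (- ((i0 + m) %/ a%:Z)%Z); rewrite val_residue /modz; lia.
have [l hl] : exists l : int, l0 = 2 * l + 1.
  exists ((l0 - 1) %/ 2)%Z; have : (2 %| l0 - 1)%Z by lia.
  by move=> /divzK; lia.
rewrite (_ : (2 * pi * _ + _) / _ =
  pi / (2 * a%:R) * (4 * m%:~R + t) + pi + 2 * pi * (q + l)%:~R); last first.
  rewrite hq ex /decay_angle hl !intrD !intrM.
  by have := b0R; have := a0R; move=> ? ?; field; lra.
by rewrite cosD2piz sinD2piz cosDpi sinDpi.
Qed.

(** Both factors lie on the unit circle, so a real nonzero difference forces them to be symmetric
    about the imaginary axis. Hence the arguments add up to an odd multiple of pi, which makes t an
    integer, and the sign of the cosine bounds the superscript. *)
Lemma stokes_arrowP x (k' k : 'I_a) : stokes_arrow b x k' k <->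
  exists t, x = angle t /\ is_arrow i0 t k' k.
Proof.
have p0 := pi_gt0 R; have [u ->] := lift_res i0 k'; have [v ->] := lift_res i0 k.
pose t : R := (x - theta) * (2 * b%:R) / pi.
have ex : x = theta + pi / (2 * b%:R) * t.
  by rewrite /t; have := b0R; move=> ?; field; lra.
pose Y (m : int) := pi / (2 * a%:R) * (4 * m%:~R + t).
have arrowE : stokes_arrow b x (res u) (res v) =
    ((sin (Y u) == sin (Y v)) && (cos (Y u) < cos (Y v))) :> Prop.
  rewrite /stokes_arrow subr_lt0 !(exp_factor_res _ ex) ltcE /= -/(Y u) -/(Y v).
  by rewrite eqr_opp ltrN2.
rewrite arrowE; split.
  case/andP => /eqP es lc.
  have cc : cos (Y v) = - cos (Y u).
    have : cos (Y v) ^+ 2 == cos (Y u) ^+ 2 by rewrite !cos2sin2 es.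
    rewrite eqf_sqr => /orP [] /eqP // e; move: lc; rewrite e ltxx //.
  have cu : cos (Y u) < 0 by move: lc; rewrite cc; lra.
  have [|z hz] := @cos_eqN1 R (Y u + Y v).
    by rewrite cosD cc es mulrN -opprD -!expr2 -es cos2Dsin2.
  have [y /andP [hy1 hy2]] := cos_lt0 cu.
  have {}hz : t = a%:R * (1 + 2 * z%:~R) - 2 * u%:~R - 2 * v%:~R.
    have e4 : (Y u + Y v) * (2 * a%:R / pi) = 4 * u%:~R + 4 * v%:~R + 2 * t.
      by rewrite /Y; have := a0R; move=> ?; field; lra.
    have e5 : (pi + 2 * pi * z%:~R) * (2 * a%:R / pi) = 2 * (a%:R * (1 + 2 * z%:~R)) :> R.
      by have := a0R; move=> ?; field; lra.
    by move: e4; rewrite hz e5; move: (a%:R * _) => w ?; lra.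
  (* Representatives of the two residues for which [Y u'] lies between pi/2 and 3 pi/2 and
     [Y u' + Y v'] is exactly pi; then u' - v' is the superscript. *)
  pose u' := u - a%:Z * y; pose v' := v + a%:Z * (y - z).
  have et : t = (a%:Z - 2 * u' - 2 * v')%:~R.
    rewrite hz /u' /v' !(intrD, intrN, intrM) /=; ring.
  have hY : Y u - 2 * pi * y%:~R = pi / (2 * a%:R) * (a%:Z + 2 * (u' - v'))%:~R.
    rewrite /Y et /u' /v' !(intrD, intrN, intrM) /=.
    by have := a0R; move=> ?; field; lra.
  have hj1 : (0 < u' - v')%R.
    move: hy1; rewrite hY (_ : pi / 2 = pi / (2 * a%:R) * a%:~R); last first.
      by have := a0R; move=> ?; field; lra.
    rewrite ltr_pM2l ?ltr_int; first by lia.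
    by rewrite divr_gt0 // mulr_gt0.
  have hj2 : (u' - v' < a%:Z)%R.
    move: hy2; rewrite hY (_ : 3 * pi / 2 = pi / (2 * a%:R) * (3 * a%:Z)%:~R); last first.
      by rewrite intrM; have := a0R; move=> ?; field; lra.
    rewrite ltr_pM2l ?ltr_int; first by lia.
    by rewrite divr_gt0 // mulr_gt0.
  have hj : (`|u' - v'|.-1 < n)%N by lia.
  exists (a%:Z - 2 * u' - 2 * v'); split; first by rewrite /angle -et.
  exists u', (Ordinal hj); split => /=.
  - by lia.
  - by apply/eqP; rewrite res_eq; apply/dvdzP; exists y; rewrite /u'; lia.
  - apply/eqP; rewrite res_eq; apply/dvdzP; exists (z - y); move: hj1; rewrite /v'; lia.
case=> t' [ex' [u' [j [hj eu ev]]]].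
have et : t = t'%:~R.
  by rewrite /t ex' /angle; have := b0R; move=> ?; field; lra.
have Yper w w' : res w = res w' ->
    exists z : int, Y w = Y w' + 2 * pi * z%:~R.
  move/eqP; rewrite res_eq => /dvdzP [q hq]; exists q.
  have -> : w = w' + q * a%:Z by lia.
  rewrite /Y intrD intrM; by have := a0R; move=> ?; field; lra.
have [z1 ->] := Yper _ _ eu; have [z2 ->] := Yper _ _ ev.
rewrite !cosD2piz !sinD2piz.
have a0R' := a0R.
have -> : Y u' = pi / a%:R * j.+1%:R + pi / 2.
  have : (4 * u' + t')%:~R = (a%:Z + (j.+1.*2)%:Z)%:~R :> R by rewrite hj.
  rewrite /Y et -muln2 !intrD !intrM /= => ->; rewrite -!pmulrn natrM; field; lra.
have -> : Y (u' - j.+1%:Z) = - (pi / a%:R * j.+1%:R) + pi / 2.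
  have : (4 * (u' - j.+1%:Z) + t')%:~R = (a%:Z - (j.+1.*2)%:Z)%:~R :> R.
    by congr (_%:~R); lia.
  rewrite /Y et -muln2 !(intrD, intrN, intrM) /= => ->; rewrite -!pmulrn natrM; field; lra.
rewrite !sinDpihalf !cosDpihalf cosN sinN eqxx /= opprK -subr_gt0 opprK.
suff : 0 < sin (pi / a%:R * j.+1%:R) :> R by lra.
apply: sin_gt0_pi; rewrite mulr_gt0 ?divr_gt0 //= mulrAC ltr_pdivrMr // ltr_pM2l //.
by rewrite ltr_nat ltnS.
Qed.

Section Times.
Variables (vt : R) (N : nat) (th : N.-tuple R).
Hypothesis hvt : angle 0 < vt < angle 1.
Hypothesis Hth : singular_angles n b vt th.

(** As [vt] lies between times 0 and 1, the end of its turn lies between times 4b and 4b + 1, so the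
    turn contains exactly the integer times from 1 to 4b. *)
Lemma singular_times : exists tm : 'I_N -> int,
  [/\ forall m, tnth th m = angle (tm m),
      forall m, 1 <= tm m <= 4 * b%:Z,
      forall t (k' k : 'I_a), 1 <= t <= 4 * b%:Z -> is_arrow i0 t k' k ->
        exists m, tm m = t &
      forall m m' : 'I_N, (m < m')%N -> tm m < tm m'].
Proof.
have [sth memth] := Hth; have /andP [h0 h1] := hvt.
have [turn1 turn2] : vt + 2 * pi < angle (1 + 4 * b%:Z) /\ angle (4 * b%:Z) < vt + 2 * pi.
  have := angle_turn 1 1; have := angle_turn 0 1; rewrite !mulr1 add0r => <- <-.
  by split; lra.
have /choice [tm tmE] : forall m : 'I_N, exists t, tnth th m = angle t.
  move=> m.
  have [/(_ (mem_tnth m th)) [[k' [k [_ /stokes_arrowP [t [-> _]]]]] _] _] := memth (tnth th m).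
  by exists t.
exists tm; split => //.
- move=> m; have [/(_ (mem_tnth m th)) [_ /andP [lo hi]] _] := memth (tnth th m).
  rewrite tmE in lo hi.
  have : angle 0 < angle (tm m) by exact: lt_trans h0 lo.
  have : angle (tm m) < angle (1 + 4 * b%:Z) by exact: lt_trans hi turn1.
  by rewrite !ltr_angle; lia.
- move=> t k' k ht ar.
  have : angle t \in th.
    apply/memth; split.
      exists k', k; split; first exact: (is_arrow_neq ar).
      by apply/stokes_arrowP; exists t.
    have : angle 1 <= angle t by rewrite ler_angle; lia.
    have : angle t <= angle (4 * b%:Z) by rewrite ler_angle; lia.
    by move=> ? ?; apply/andP; split; lra.
  by case/tnthP => m; rewrite tmE => /angle_inj ->; exists m.
- move=> m m' mm'; rewrite -ltr_angle -!tmE !(tnth_nth 0).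
  by apply: (sorted_ltn_nth lt_trans 0 sth) => //; rewrite inE size_tuple.
Qed.

End Times.

End SingularAngles.

(** * Polygons *)

Section Polygons.
Variables (K : fieldType) (n b : nat).
Hypothesis (b0 : (0 < b)%N).
Local Notation a := n.+1.

Lemma iter_ordS (m : 'I_b) t : iter t (@ordS b) m = ((m + t) %% b)%N :> nat.
Proof.
elim: t => [|t IH] /=; first by rewrite addn0 modn_small.
by rewrite IH addnS -[(_ %% _).+1]addn1 modnDml addn1.
Qed.

Lemma polygon_index_proof (x : int) : (`|(x %% b%:Z)%Z| < b)%N.
Proof.
have h1 : 0 <= (x %% b%:Z)%Z by rewrite modz_ge0; lia.
have h2 : (x %% b%:Z)%Z < b%:Z by rewrite ltz_pmod; lia.
lia.
Qed.

Definition polygon_index (x : int) : 'I_b := Ordinal (polygon_index_proof x).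

Lemma polygon_index_val x : (polygon_index x : nat)%:Z = (x %% b%:Z)%Z.
Proof. by rewrite /= gez0_abs // modz_ge0; lia. Qed.

Lemma polygon_index_sub x : polygon_index (x - b%:Z) = polygon_index x.
Proof.
apply: val_inj; apply/eqP; rewrite -eqz_nat !polygon_index_val.
by rewrite (_ : x - b%:Z = -1 * b%:Z + x) ?modzMDl //; lia.
Qed.

(** [recessive_polygon] reads the vertex m, counted from 0, at position m - b. *)
Lemma polygon_index_ord (m : 'I_b) : polygon_index ((m : nat)%:Z - b%:Z) = m.
Proof.
rewrite polygon_index_sub; apply: val_inj; apply/eqP; rewrite -eqz_nat.
by rewrite polygon_index_val modz_small //; have := ltn_ord m; lia.
Qed.

Section PolygonSequence.
Variable M : 'M[K]_(n.+1, b).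

Definition polygon_seq (x : int) : 'cV[K]_a := col (polygon_index x) M.

Lemma polygon_seq_sub x : polygon_seq (x - b%:Z) = polygon_seq x.
Proof. by rewrite /polygon_seq polygon_index_sub. Qed.

Definition polygon_coefs (x : int) : 'cV[K]_a :=
  invmx (window polygon_seq (x - 1)) *m polygon_seq x.

Definition polygon_coef (x : int) (j : 'I_n) : K :=
  polygon_coefs x (widen_ord (leqnSn n) j) 0.

Definition polygon_last (x : int) : K := polygon_coefs x ord_max 0.

(** The shift by b makes the factor for a turn ending at x - b equal to the monodromy at x, as in V
    (x - b) = H x V x. *)
Definition polygon_scale (x : int) : K :=
  potential (isT : (0 < a)%N) b0 polygon_last (x + b%:Z).

Definition polygon_monodromy (x : int) : K :=
  potential_monodromy a b polygon_last x.

Definition polygon_stokes (x : int) (j : 'I_n) : K :=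
  polygon_scale x / polygon_scale (x - j.+1%:Z) * polygon_coef x j.

Lemma polygon_coefs_sub x : polygon_coefs (x - b%:Z) = polygon_coefs x.
Proof.
rewrite /polygon_coefs polygon_seq_sub; congr (invmx _ *m _).
apply/matrixP => k y; rewrite !mxE -[in RHS]polygon_index_sub; congr (M _ (polygon_index _)); lia.
Qed.

Hypothesis HM : forall m : 'I_b,
  colsub (fun t : 'I_n.+1 => iter t (@ordS b) m) M \in unitmx.

(** Nondegeneracy lists vertices in increasing cyclic order and windows in decreasing order, whence
    [rev_ord]. *)
Lemma polygon_window x : window polygon_seq x \in unitmx.
Proof.
apply: unitmx_kernel => xi Hxi.
pose m := polygon_index (x - n%:Z).
apply: (can_inj (mulmxK (HM m))); rewrite mul0mx; apply/matrixP => i t.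
have E := congr1 (fun A : 'rV[K]_a => A 0 (rev_ord t)) Hxi.
rewrite /= row_window [RHS]mxE in E.
rewrite ord1 [RHS]mxE -E !mxE; apply: eq_bigr => k _.
rewrite !mxE; congr (_ * M _ _); apply: ord_inj; apply/eqP.
rewrite -eqz_nat polygon_index_val iter_ordS -modz_nat PoszD polygon_index_val.
rewrite modzDml; apply/eqP; congr (_ %% _)%Z; rewrite /=; have := ltn_ord t; lia.
Qed.

Lemma polygon_relation x : polygon_seq x =
  \sum_(j < n) polygon_coef x j *: polygon_seq (x - j.+1%:Z)
  + polygon_last x *: polygon_seq (x - a%:Z).
Proof.
have -> : polygon_seq x = window polygon_seq (x - 1) *m polygon_coefs x.
  by rewrite mulKVmx ?polygon_window.
rewrite window_mulE; congr (_ + _).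
  by apply: eq_bigr => j _; rewrite (_ : x - 1 - _ = x - j.+1%:Z) //; lia.
by rewrite (_ : x - 1 - _ = x - a%:Z) //; lia.
Qed.

(** If the last coefficient were 0, the functional dual to the vertex x - a would vanish on all of
    the window at x, which is invertible. *)
Lemma polygon_last_neq0 x : polygon_last x != 0.
Proof.
apply/eqP => L0; pose xi := row ord_max (invmx (window polygon_seq (x - 1))).
have xiE (y : 'I_a) : (xi *m polygon_seq (x - 1 - (y : nat)%:Z)) 0 0 = (ord_max == y)%:R.
  by rewrite -row_window -row_mul mulVmx ?polygon_window // !mxE.
have xi0 : xi *m window polygon_seq x = 0.
  apply/matrixP => i y; rewrite ord1 row_window [RHS]mxE.
  case: y => [[|y] hy] /=.
    by rewrite subr0 -row_mul mxE; exact: L0.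
  have ne : (ord_max == Ordinal (ltnW hy)) = false.
    by apply/eqP => /(congr1 val) /=; lia.
  have := xiE (Ordinal (ltnW hy)); rewrite ne mulr0n => <-.
  by rewrite /= (_ : x - 1 - y%:Z = x - y.+1%:Z) //; lia.
have e : xi = 0 by apply: (can_inj (mulmxK (polygon_window x))); rewrite mul0mx.
have := xiE ord_max; rewrite e mul0mx mxE eqxx => /esym/eqP.
by rewrite oner_eq0.
Qed.

Let last_sub x : polygon_last (x - b%:Z) = polygon_last x.
Proof. by rewrite /polygon_last polygon_coefs_sub. Qed.

Lemma polygon_scale_neq0 x : polygon_scale x != 0.
Proof. by apply: potential_neq0; apply: polygon_last_neq0. Qed.

Lemma polygon_monodromy_neq0 x : polygon_monodromy x != 0.
Proof. by apply: potential_monodromy_neq0; apply: polygon_last_neq0. Qed.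

Lemma polygon_scale_subA x :
  polygon_scale (x - a%:Z) = polygon_last x * polygon_scale x.
Proof.
rewrite /polygon_scale (_ : x - a%:Z + b%:Z = x + b%:Z - a%:Z); last by lia.
rewrite potential_subA; [|exact: last_sub|exact: polygon_last_neq0].
by rewrite -last_sub addrK.
Qed.

Lemma polygon_scale_subB x :
  polygon_scale (x - b%:Z) = polygon_monodromy x * polygon_scale x.
Proof.
rewrite /polygon_scale (_ : x - b%:Z + b%:Z = x + b%:Z - b%:Z); last by lia.
rewrite potential_subB; [|exact: last_sub|exact: polygon_last_neq0].
by rewrite addrK.
Qed.

Definition scaled_seq (x : int) : 'cV[K]_a := polygon_scale x *: polygon_seq x.

Lemma scaled_vsolves : vsolves polygon_stokes 1 scaled_seq.
Proof.
move=> x; rewrite /scaled_seq {1}polygon_relation scalerDr scaler_sumr.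
congr (_ + _); last by rewrite scale1r polygon_scale_subA scalerA mulrC.
apply: eq_bigr => j _; rewrite !scalerA /polygon_stokes; congr (_ *: _).
by rewrite mulrAC mulfVK // polygon_scale_neq0.
Qed.

Lemma scaled_window x : window scaled_seq x \in unitmx.
Proof.
apply: unitmx_kernel => xi Hxi.
apply: (can_inj (mulmxK (polygon_window x))); rewrite mul0mx.
apply/matrixP => i y; have E := congr1 (fun A : 'rV[K]_a => A 0 y) Hxi.
rewrite /= row_window [RHS]mxE in E.
rewrite ord1 row_window [RHS]mxE.
suff /eqP -> : xi *m polygon_seq (x - (y : nat)%:Z) == 0 by rewrite mxE.
rewrite -(row_scale_eq0 _ _ (polygon_scale_neq0 (x - (y : nat)%:Z))).
by apply/eqP/matrixP => k l; rewrite !ord1 [RHS]mxE.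
Qed.

Lemma scaled_turn x : scaled_seq (x - b%:Z) = polygon_monodromy x *: scaled_seq x.
Proof. by rewrite /scaled_seq polygon_seq_sub polygon_scale_subB scalerA. Qed.

Lemma polygon_stokes_twisted : twisted b polygon_monodromy polygon_stokes.
Proof.
move=> x j; rewrite /polygon_stokes /polygon_coef polygon_coefs_sub.
rewrite (_ : x - b%:Z - j.+1%:Z = x - j.+1%:Z - b%:Z); last by lia.
rewrite !polygon_scale_subB; move: (polygon_coefs _ _ _) => S.
by field; rewrite polygon_scale_neq0 polygon_monodromy_neq0.
Qed.

Lemma polygon_monodromy_periodic x :
  polygon_monodromy (x - a%:Z) = polygon_monodromy x.
Proof. by apply: potential_monodromy_periodic. Qed.

End PolygonSequence.

End Polygons.

(** * Regular dependence of the constructions on their data *)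

Section RegularConstructions.
Variables (K : fieldType) (n b : nat) (i0 : int).
Variables (T : Type) (X : set T) (G : set (T -> K)).
Local Notation regular := (generated X G).

Lemma regular_zprod (f : T -> int -> K) z :
  (forall k, regular (fun x => f x k)) ->
  (forall x k, X x -> f x k != 0) -> regular (fun x => zprod (f x) z).
Proof.
move=> rf f0; case: z => k; apply: generated_prod => i _ //.
by apply: gen_inv => // x; apply: f0.
Qed.

Lemma regular_stokes_mx (c : T -> int -> 'I_n -> K) t :
  (forall y j, regular (fun x => c x y j)) ->
  regular_mx X G (fun x => stokes_mx i0 (c x) t).
Proof.
move=> rc k k'.
pose term (j : 'I_n) x := c x (arrow_pos t j) j *
  (delta_mx (residue n (i0 + (arrow_pos t j - j.+1%:Z)))
            (residue n (i0 + arrow_pos t j)) : 'M[K]_n.+1) k k'.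
apply: (@gen_ext _ _ _ _ (fun x => (1 : 'M[K]_n.+1) k k' +
  \sum_(j < n | (4 %| n.+1%:Z + j.+1.*2%:Z - t)%Z) term j x)).
  apply: gen_add; first by constructor.
  by apply: generated_sum => j _; apply: gen_mul => //; constructor.
move=> x _; rewrite [RHS]mxE [X in _ = _ + X]summxE; congr (_ + _).
by apply: eq_bigr => j _; rewrite /term [RHS]mxE.
Qed.

Lemma regular_hmx (H : T -> int -> K) :
  (forall y, regular (fun x => H x y)) ->
  regular_mx X G (fun x => hmx n b i0 (H x)).
Proof.
move=> rH k k'.
apply: (@gen_ext _ _ _ _ (fun x => if k == residue n ((k' : nat)%:Z + b%:Z)
  then H x ((k : nat)%:Z - i0) else 0)) => [|x _]; last by rewrite mxE.
by case: (k == residue n ((k' : nat)%:Z + b%:Z)); [exact: rH|constructor].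
Qed.

End RegularConstructions.

Section RegularPolygons.
Variables (K : fieldType) (n b : nat).
Hypothesis (b0 : (0 < b)%N).
Local Notation a := n.+1.
Variable X : set 'M[K]_(n.+1, b).
Hypothesis HX : forall M, X M -> forall m : 'I_b,
  colsub (fun t : 'I_n.+1 => iter t (@ordS b) m) M \in unitmx.
Local Notation G :=
  [set f | exists k m, f = fun M : 'M[K]_(n.+1, b) => M k m].
Local Notation regular := (generated X G).

Lemma regular_polygon_seq x : regular_mx X G (fun M => polygon_seq b0 M x).
Proof.
move=> k i; apply: (@gen_ext _ _ _ _ (fun M : 'M[K]_(n.+1, b) => M k (polygon_index b0 x))).
  by apply: gen_base; exists k, (polygon_index b0 x).
by move=> M _; rewrite mxE.
Qed.

Lemma regular_polygon_coefs x : regular_mx X G (fun M => polygon_coefs b0 M x).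
Proof.
apply: regular_mulmx; last exact: regular_polygon_seq.
apply: regular_invmx => [k y|M /HX HM]; last exact: polygon_window.
apply: (gen_ext (regular_polygon_seq (x - 1 - (y : nat)%:Z) k 0)) => M _.
by rewrite [RHS]mxE.
Qed.

Lemma regular_polygon_last x : regular (fun M => polygon_last b0 M x).
Proof. exact: regular_polygon_coefs. Qed.

Lemma regular_polygon_scale x : regular (fun M => polygon_scale b0 M x).
Proof.
apply: regular_zprod => [k|M k XM]; first exact: regular_polygon_last.
exact/polygon_last_neq0/HX.
Qed.

Lemma regular_polygon_monodromy x : regular (fun M => polygon_monodromy b0 M x).
Proof.
rewrite /polygon_monodromy /potential_monodromy; case: (low _ _ x); last by constructor.
apply: regular_zprod => [k|M k XM]; first exact: regular_polygon_last.
exact/polygon_last_neq0/HX.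
Qed.

Lemma regular_polygon_stokes x j : regular (fun M => polygon_stokes b0 M x j).
Proof.
apply: gen_mul; last exact: regular_polygon_coefs.
apply: gen_mul; first exact: regular_polygon_scale.
apply: gen_inv; first exact: regular_polygon_scale.
by move=> M XM; apply: polygon_scale_neq0; apply: HX.
Qed.

End RegularPolygons.

(** * Change of signs *)

Section SignTwist.
Variables (K : fieldType) (n b : nat).
Local Notation a := n.+1.
Local Notation e := ((-1) ^+ n : K).
Variables (s H : int -> K).
Hypothesis ss : forall x, s x * s x = 1.
Hypothesis HH : forall x, H x * H x = 1.
Hypothesis sa : forall x, s (x - a%:Z) = e * s x.
Hypothesis sb : forall x, s (x - b%:Z) = e * H x * s x.

(* A solution V of the Stokes recurrence at position x corresponds to the
   solution s x * V x of the difference equation at index x + 1 + b. *)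
Local Notation d := (1 + b%:Z).

Definition sign_twist (c : int -> 'I_n -> K) (i : int) (j : 'I_n) : K :=
  (-1) ^+ j * (s (i - d) * s (i - d - j.+1%:Z) * c (i - d) j).

Definition sign_untwist (alpha : int -> 'I_n -> K) (x : int) (j : 'I_n) : K :=
  (-1) ^+ j * (s x * s (x - j.+1%:Z) * alpha (x + d) j).

Lemma sign_untwistK alpha : sign_twist (sign_untwist alpha) = alpha.
Proof.
apply/funext => i; apply/funext => j; rewrite /sign_twist /sign_untwist subrK.
set x := i - d; set y := x - _; set t := (-1) ^+ j; set z := alpha _ _.
have -> : t * (s x * s y * (t * (s x * s y * z))) =
  t * t * ((s x * s x) * (s y * s y)) * z by ring.
by rewrite signr_sqr !ss !mul1r.
Qed.

Lemma sign_twistK c : sign_untwist (sign_twist c) = c.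
Proof.
apply/funext => x; apply/funext => j; rewrite /sign_twist /sign_untwist addrK.
set y := x - _; set t := (-1) ^+ j; set z := c _ _.
have -> : t * (s x * s y * (t * (s x * s y * z))) =
  t * t * ((s x * s x) * (s y * s y)) * z by ring.
by rewrite signr_sqr !ss !mul1r.
Qed.

Lemma sign_neq0 x : s x != 0.
Proof. by apply/eqP => s0; have /eqP := ss x; rewrite s0 mul0r eq_sym oner_eq0. Qed.

Lemma sign_monodromy_neq0 x : H x != 0.
Proof. by apply/eqP => s0; have /eqP := HH x; rewrite s0 mul0r eq_sym oner_eq0. Qed.

Definition signed_coef (alpha : int -> 'I_n -> K) i (j : 'I_n) : K :=
  (-1) ^+ j * alpha i j.

Lemma solves_twist c v : solves c 1 v ->
  solves (signed_coef (sign_twist c)) e (fun i => s (i - d) * v (i - d)).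
Proof.
move=> Hv i; rewrite {1}Hv mulrDr; congr (_ + _); last first.
  have -> : i - a%:Z - d = i - d - a%:Z by lia.
  rewrite sa mul1r; set x := i - d; set w := v _.
  have -> : e * (e * s x * w) = e * e * (s x * w) by ring.
  by rewrite signr_sqr mul1r.
rewrite mulr_sumr; apply: eq_bigr => j _; rewrite /signed_coef /sign_twist.
have -> : i - j.+1%:Z - d = i - d - j.+1%:Z by lia.
set x := i - d; set y := x - _; set t := (-1) ^+ j; set z := c _ _.
have -> : t * (t * (s x * s y * z)) * (s y * v y) =
  t * t * (s y * s y) * (s x * (z * v y)) by ring.
by rewrite signr_sqr !ss !mul1r.
Qed.

Lemma solves_untwist alpha v : solves (signed_coef alpha) e v ->
  solves (sign_untwist alpha) 1 (fun x => s x * v (x + d)).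
Proof.
move=> Hv x; rewrite {1}Hv mulrDr; congr (_ + _); last first.
  have -> : x + d - a%:Z = x - a%:Z + d by lia.
  by rewrite sa; set w := v _; ring.
rewrite mulr_sumr; apply: eq_bigr => j _; rewrite /signed_coef /sign_untwist.
have -> : x + d - j.+1%:Z = x - j.+1%:Z + d by lia.
set y := x - _; set t := (-1) ^+ j; set z := alpha _ _; set w := v _.
have -> : t * (s x * s y * z) * (s y * w) = (s y * s y) * (s x * (t * z * w)) by ring.
by rewrite ss mul1r.
Qed.

Lemma sign_twist_periodic c : twisted b H c ->
  forall i j, sign_twist c (i + b%:Z) j = sign_twist c i j.
Proof.
move=> tc i j; rewrite /sign_twist.
set y := i + b%:Z - d.
have -> : i - d = y - b%:Z by rewrite /y; lia.
have -> : y - b%:Z - j.+1%:Z = y - j.+1%:Z - b%:Z by lia.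
rewrite !sb; congr (_ * _); set z := y - j.+1%:Z.
have -> : e * H y * s y * (e * H z * s z) * c (y - b%:Z) j =
  e * e * (s y * s z) * (H y * (c (y - b%:Z) j * H z)) by ring.
by rewrite tc signr_sqr mul1r [H y * (_ * _)]mulrA HH mul1r.
Qed.

Lemma sign_untwist_twisted alpha :
  (forall i j, alpha (i + b%:Z) j = alpha i j) -> twisted b H (sign_untwist alpha).
Proof.
move=> ab x j; rewrite /sign_untwist.
have -> : x - b%:Z - j.+1%:Z = x - j.+1%:Z - b%:Z by lia.
rewrite -(ab (x - b%:Z + d)) (_ : x - b%:Z + d + b%:Z = x + d); last by lia.
rewrite !sb; set z := x - j.+1%:Z; set t := (-1) ^+ j; set w := alpha _ _.
have -> : t * (e * H x * s x * (e * H z * s z) * w) * H z =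
  (e * e) * (H z * H z) * (H x * (t * (s x * s z * w))) by ring.
by rewrite signr_sqr HH !mul1r.
Qed.

(** Each solution is a signed linear functional of [V]; over a turn the factor H of the signs
    cancels the factor H of [V] and leaves (-1)^(a - 1). *)
Lemma superperiodic_twist c V m : vsolves c 1 V -> window V m \in unitmx ->
  (forall x, V (x - b%:Z) = H x *: V x) ->
  forall v, solves (signed_coef (sign_twist c)) e v ->
  forall i, v (i + b%:Z) = e * v i.
Proof.
move=> HV um VH v /solves_untwist; rewrite sign_twistK => Hv i.
have [xi Hxi] := solves_expand (oner_neq0 _) HV um Hv.
pose y := i + b%:Z - d.
have h1 := Hxi y; have h2 := Hxi (y - b%:Z).
rewrite VH -scalemxAr mxE -h1 sb in h2.
rewrite (_ : y - b%:Z + d = i) in h2; last by rewrite /y; lia.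
rewrite (_ : y + d = i + b%:Z) in h2; last by rewrite /y; lia.
apply: (mulfI (sign_neq0 y)); apply: (mulfI (sign_monodromy_neq0 y)).
by rewrite -h2; ring.
Qed.

Lemma quasiperiodic_untwist alpha V : vsolves (sign_untwist alpha) 1 V ->
  (forall v, solves (signed_coef alpha) e v -> forall i, v (i + b%:Z) = e * v i) ->
  forall x, V (x - b%:Z) = H x *: V x.
Proof.
move=> HV Hsuper x; apply/matrixP => k l; rewrite ord1 mxE.
have /vsolvesP /(_ k) /solves_twist := HV; rewrite sign_untwistK => /Hsuper.
move=> /(_ (x - b%:Z + d)).
have -> : x - b%:Z + d + b%:Z - d = x by lia.
rewrite addrK sb; set u := V x k 0; set w := V _ k 0 => E.
apply: (mulfI (sign_neq0 x)); apply: (mulfI (sign_monodromy_neq0 x)).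
have -> : H x * (s x * (H x * u)) = (H x * H x) * (s x * u) by ring.
rewrite E; have -> : e * (e * H x * s x * w) = (e * e) * (H x * (s x * w)) by ring.
by rewrite signr_sqr HH !mul1r.
Qed.

End SignTwist.

Section SolutionBases.
Variables (K : fieldType) (n : nat).
Local Notation a := n.+1.
Variables (c : int -> 'I_n -> K) (e : K) (V : int -> 'cV[K]_a).
Hypotheses (e0 : e != 0) (HV : vsolves c e V) (uV : window V 0 \in unitmx).

Lemma solves_expand_unique v : solves c e v ->
  exists! xi : 'rV[K]_a, forall x, v x = (xi *m V x) 0 0.
Proof.
move=> /(solves_expand e0 HV uV) [xi Hxi]; exists xi; split=> // xi' Hxi'.
by apply: (row_expand_uniq uV) => x; rewrite -Hxi -Hxi'.
Qed.

(** Each family is a linear image of the other, and the composite matrix fixes an invertible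
    window. *)
Lemma basis_change U : vsolves c e U ->
  (forall v, solves c e v -> exists xi : 'rV[K]_a, forall x, v x = (xi *m U x) 0 0) ->
  exists2 g : 'M[K]_a, g \in unitmx & forall x, U x = g *m V x.
Proof.
move=> HU span.
have [g Hg] := vsolves_expand e0 HV uV HU.
have /choice [h Hh] : forall k, exists xi : 'rV[K]_a,
    forall x, V x k 0 = (xi *m U x) 0 0.
  by move=> k; apply: span; move: k; apply/vsolvesP.
exists g => //.
have e1 : (\matrix_k h k) *m g *m window V 0 = 1%:M *m window V 0.
  rewrite mul1mx -window_mul; congr window; apply/funext => x.
  rewrite -mulmxA -Hg; apply/matrixP => k l; rewrite ord1 Hh !mxE.
  by apply: eq_bigr => y _; rewrite mxE.
have /mulmx1_unit [] // := can_inj (mulmxK uV) e1.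
Qed.

Lemma prod_monodromy (H : int -> K) b m :
  (forall x, V (x - b%:Z) = H x *: V x) ->
  (\prod_(y < a) H (m - (y : nat)%:Z)) * ((-1) ^+ n * e) ^+ b = 1.
Proof.
move=> VH.
have D1 (k : nat) x : \det (window V x) = ((-1) ^+ n * e) ^+ k * \det (window V (x - k%:Z)).
  elim: k x => [|k IH] x; first by rewrite expr0 mul1r subr0.
  rewrite (det_window x HV) (IH (x - 1)) mulrA -exprS.
  by rewrite (_ : x - 1 - k%:Z = x - k.+1%:Z) //; lia.
have D2 : window V (m - b%:Z) = window V m *m diag_mx (\row_y H (m - (y : nat)%:Z)).
  apply/matrixP => k y; rewrite mul_mx_diag !mxE.
  have -> : m - b%:Z - (y : nat)%:Z = m - (y : nat)%:Z - b%:Z by lia.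
  by rewrite VH mxE mulrC.
have um : \det (window V m) != 0.
  by have := window_unit m e0 HV uV; rewrite unitmxE unitfE.
apply: (mulIf um); rewrite mul1r [RHS](D1 b) D2 det_mulmx det_diag.
have -> : \prod_(y < a) (\row_y H (m - (y : nat)%:Z) : 'rV[K]_a) 0 y = \prod_(y < a) H (m - (y : nat)%:Z).
  by apply: eq_bigr => y _; rewrite mxE.
by move: (\prod_(_ < _) _) (\det _) (_ ^+ b) => u v w; ring.
Qed.

End SolutionBases.

(** * Friezes *)

Section Friezes.
Variables (K : fieldType) (n b : nat).
Hypothesis hab : (n.+1 < b)%N.
Local Notation a := n.+1.
Local Notation e := ((-1) ^+ n : K).
Local Notation w := (frieze_width n b).

Let e0 : e != 0 := signr_neq0.

Lemma frieze_widthE : w%:Z = b%:Z - a%:Z - 1.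
Proof. by rewrite /frieze_width; lia. Qed.

(** Minors of a frieze list columns by increasing index and windows by decreasing index; this
    permutation passes from one to the other. *)
Definition reversal (q : nat) : 'M[K]_q := \matrix_(y, z) (y == rev_ord z)%:R.

Lemma reversal_unit q : \det (reversal q) != 0.
Proof.
have h : reversal q *m reversal q = 1%:M.
  apply/matrixP => y z; rewrite [LHS]mxE (bigD1 (rev_ord z)) //= big1 => [|x nx].
    by rewrite !mxE rev_ordK eqxx mulr1 addr0.
  by rewrite [X in _ * X]mxE (negbTE nx) mulr0.
by have [_] := mulmx1_unit h; rewrite unitmxE unitfE.
Qed.

Lemma mul_reversal q m (A : 'M[K]_(m, q)) x z :
  (A *m reversal q) x z = A x (rev_ord z).
Proof.
rewrite mxE (bigD1 (rev_ord z)) //= big1 => [|y ny].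
  by rewrite mxE eqxx mulr1 addr0.
by rewrite [reversal _ _ _]mxE (negbTE ny) mulr0.
Qed.

Definition ascending (V : int -> 'cV[K]_a) (q : nat) (j : int) : 'M[K]_(a, q) :=
  \matrix_(k, y) V (j + (y : nat)%:Z) k 0.

Lemma ascendingE (V : int -> 'cV[K]_a) j :
  ascending V a j = window V (j + n%:Z) *m reversal a.
Proof.
apply/matrixP => k z; rewrite mul_reversal !mxE; congr (V _ k 0).
by rewrite /=; have := ltn_ord z; lia.
Qed.

Section FundamentalSolution.
Variable alpha : int -> 'I_n -> K.
Local Notation comp m := (companion (signed_coef alpha m) e).

Lemma companion_unit m : comp m \is a GRing.unit.
Proof.
rewrite -[_ \is a _]/(comp m \in unitmx) unitmxE det_companion signr_sqr.
exact: unitr1.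
Qed.

(** [zprod] solves F (z - 1) = F z f z, so inverse companion matrices are supplied to obtain a
    product growing by [comp m] at step m. *)
Definition fundamental : int -> 'M[K]_a := zprod (fun m => (comp m)^-1).

Lemma fundamental_unit m : fundamental m \is a GRing.unit.
Proof. by apply: zprod_unit => z; rewrite unitrV companion_unit. Qed.

Lemma fundamentalP m : fundamental m = fundamental (m - 1) *m comp m.
Proof.
rewrite /fundamental zprodP => [|z]; last by rewrite unitrV companion_unit.
by rewrite mulmxE mulrVK ?companion_unit.
Qed.

Definition fundamental_seq (j : int) : 'cV[K]_a := col ord0 (fundamental j).

Lemma window_fundamental m : window fundamental_seq m = fundamental m.
Proof.
apply/matrixP => k y; rewrite !mxE; case: y => y hy /=.
elim: y hy m => [|y IH] hy m.
  by rewrite subr0; congr (fundamental _ _ _); apply: val_inj.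
have hyn : (y < n)%N by [].
have -> : Ordinal hy = lift ord0 (Ordinal hyn) by apply: val_inj.
rewrite [in RHS]fundamentalP mul_companion_lift.
have -> : widen_ord (leqnSn n) (Ordinal hyn) = Ordinal (ltnW hy) by apply: val_inj.
by rewrite -(IH (ltnW hy)); congr (fundamental _ _ _); lia.
Qed.

Lemma fundamental_vsolves : vsolves (signed_coef alpha) e fundamental_seq.
Proof.
move=> m; apply/matrixP => k l; rewrite ord1 mxE fundamentalP mul_companion0.
rewrite -window_fundamental [RHS]mxE summxE; congr (_ + _).
  apply: eq_bigr => j _; rewrite mxE [RHS]mxE /=.
  by rewrite (_ : m - 1 - (j : nat)%:Z = m - j.+1%:Z) //; lia.
by rewrite mxE [RHS]mxE /= (_ : m - 1 - n%:Z = m - a%:Z) //; lia.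
Qed.

Lemma fundamental_window m : window fundamental_seq m \in unitmx.
Proof. by rewrite window_fundamental; exact: fundamental_unit. Qed.

Definition frieze_row (i : int) : 'rV[K]_a := row ord0 (invmx (fundamental (i - 1))).

(* The entry (i, j) of the frieze of the equation alpha, for all i and j: the
   i-th row is the solution with values 0, ..., 0, 1 at i - a, ..., i - 1. *)
Definition frieze_entry (i j : int) : K := (frieze_row i *m fundamental_seq j) 0 0.

Lemma frieze_entry_solves i : solves (signed_coef alpha) e (frieze_entry i).
Proof. exact: vsolves_row fundamental_vsolves. Qed.

Lemma frieze_entry_init i (y : 'I_a) :
  frieze_entry i (i - 1 - (y : nat)%:Z) = (ord0 == y)%:R.
Proof.
rewrite /frieze_entry -row_window window_fundamental -row_mul mulVmx.
  by rewrite !mxE.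
exact: fundamental_unit.
Qed.

Lemma frieze_entry1 i : frieze_entry i (i - 1) = 1.
Proof. by have := frieze_entry_init i ord0; rewrite subr0. Qed.

Lemma frieze_entry0 i (y : nat) : (0 < y < a)%N -> frieze_entry i (i - 1 - y%:Z) = 0.
Proof.
case/andP => y0 ya; rewrite (frieze_entry_init i (Ordinal ya)).
by case: y y0 ya.
Qed.

Definition frieze_block (q : nat) (i j : int) : 'M[K]_q :=
  \matrix_(x, y) frieze_entry (i + (x : nat)%:Z) (j + (y : nat)%:Z).

Definition frieze_rows (q : nat) (i : int) : 'M[K]_(q, a) :=
  \matrix_(x < q) frieze_row (i + (x : nat)%:Z).

Lemma frieze_blockE q i j :
  frieze_block q i j = frieze_rows q i *m ascending fundamental_seq q j.
Proof.
apply/matrixP => x y; rewrite [LHS]mxE /frieze_entry mxE [RHS]mxE.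
by apply: eq_bigr => k _; congr (_ * _); rewrite [RHS]mxE.
Qed.

Lemma det_fundamental m : \det (fundamental m) = 1.
Proof.
have step x : \det (fundamental x) = \det (fundamental (x - 1)).
  by rewrite fundamentalP det_mulmx det_companion signr_sqr mulr1.
apply: (@int_ind_pm (fun m => \det (fundamental m) = 1) 0) => [|x <-|x <-].
- by rewrite /fundamental zprod0 det1.
- by rewrite step addrK.
- by rewrite -step.
Qed.

Lemma det_ascending_fundamental j j' :
  \det (ascending fundamental_seq a j) = \det (ascending fundamental_seq a j').
Proof. by rewrite !ascendingE !det_mulmx !window_fundamental !det_fundamental. Qed.

(** The block factors as rows times columns, and the determinant of the column factor is independent
    of j. At j = i - 1 the block is triangular with ones on the diagonal. *)
Lemma frieze_block1 i j : \det (frieze_block a i j) = 1.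
Proof.
rewrite frieze_blockE det_mulmx (det_ascending_fundamental j (i - 1)) -det_mulmx.
rewrite -frieze_blockE -det_tr det_trig => [|].
  apply: big1 => x _; rewrite !mxE.
  by rewrite (_ : i - 1 + x%:Z = i + x%:Z - 1) ?frieze_entry1 //; lia.
apply/is_trig_mxP => x y xy; rewrite !mxE.
have -> : i - 1 + (x : nat)%:Z = i + (y : nat)%:Z - 1 - (y - x)%N%:Z by lia.
by rewrite frieze_entry0 //; have := ltn_ord y; lia.
Qed.

(** The factorization through dimension a bounds the rank. *)
Lemma frieze_block0 i j : \det (frieze_block a.+1 i j) = 0.
Proof.
apply/eqP/negPn/negP; rewrite -unitfE -unitmxE => u.
have := mxrank_unit u; rewrite frieze_blockE => r.
by have := mulmx_max_rank (frieze_rows a.+1 i) (ascending fundamental_seq a.+1 j); lia.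
Qed.

Lemma frieze_rows_unit i : frieze_rows a i \in unitmx.
Proof.
rewrite unitmxE unitfE; apply/eqP => d0.
have := frieze_block1 i i; rewrite frieze_blockE det_mulmx d0 mul0r => /eqP.
by rewrite eq_sym oner_eq0.
Qed.

(** Test on the rows j + 1, ..., j + a: there the entries in column j are initial values, and those
    in column j + b become the same initial values of the rows moved by b. *)
Lemma antiperiodic_of_rows :
  (forall i j, frieze_entry i j = e * frieze_entry (i + b%:Z) j) ->
  forall j, fundamental_seq (j + b%:Z) = e *: fundamental_seq j.
Proof.
move=> Hi j; apply: (can_inj (mulKmx (frieze_rows_unit (j + 1)))).
apply/matrixP => x l; rewrite ord1.
have rE q (u : 'cV[K]_a) : (frieze_rows a q *m u) x 0 = (frieze_row (q + (x : nat)%:Z) *m u) 0 0.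
  by rewrite !mxE; apply: eq_bigr => k _; rewrite mxE.
rewrite -scalemxAr [RHS]mxE !rE -/(frieze_entry _ _) -/(frieze_entry _ _) Hi.
congr (_ * _); set i := j + 1 + _.
have -> : j + b%:Z = i + b%:Z - 1 - (x : nat)%:Z by rewrite /i; lia.
have -> : j = i - 1 - (x : nat)%:Z by rewrite /i; lia.
by rewrite !frieze_entry_init.
Qed.

End FundamentalSolution.

(** The array [frieze_array] over an arbitrary field, convertible to it over [R[i]]. *)
Definition frieze_extend (d : int -> 'I_w -> K) (i j : int) : K :=
  if (j - i == -1) || (j - i == w%:Z) then 1
  else if j - i is Posz k then
    if insub k is Some k' then d i k' else 0
  else 0.

Lemma frieze_extend1 d (i j : int) : j - i = -1 \/ j - i = w%:Z -> frieze_extend d i j = 1.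
Proof. by rewrite /frieze_extend => -[] ->; rewrite eqxx ?orbT. Qed.

Lemma frieze_extend_inside d i (k : 'I_w) : frieze_extend d i (i + (k : nat)%:Z) = d i k.
Proof.
rewrite /frieze_extend (_ : i + (k : nat)%:Z - i = (k : nat)%:Z); last by lia.
rewrite ifF; last by have := ltn_ord k; lia.
by rewrite valK.
Qed.

Lemma frieze_extend0 d (i j : int) : j - i <= -2 \/ w%:Z < j - i -> frieze_extend d i j = 0.
Proof.
rewrite /frieze_extend => h; rewrite ifF; last by lia.
case: (j - i) h => [k|//] h.
by rewrite insubF //; apply/negbTE; rewrite -leqNgt; lia.
Qed.

Definition array_minor (d : int -> 'I_w -> K) (q : nat) (i j : int) : K :=
  \det (\matrix_(x < q, y < q)
    frieze_extend d (i + (x : nat)%:Z) (j + (y : nat)%:Z)).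

Definition tame_array (d : int -> 'I_w -> K) :=
  (forall i j, -1 <= j - i <= w%:Z -> array_minor d a i j = 1) /\
  (forall i j, 0 <= j - i < w%:Z -> array_minor d a.+1 i j = 0).

Definition superperiodic_equation (alpha : int -> 'I_n -> K) :=
  (forall i j, alpha (i + b%:Z) j = alpha i j) /\
  (forall v, solves (signed_coef alpha) e v -> forall i, v (i + b%:Z) = e * v i).

Definition equation_frieze alpha (i : int) (k : 'I_w) : K :=
  frieze_entry alpha i (i + (k : nat)%:Z).

Section EquationToFrieze.
Variable alpha : int -> 'I_n -> K.
Hypothesis Halpha : superperiodic_equation alpha.

Lemma frieze_entry_turn i j : frieze_entry alpha i (j + b%:Z) = e * frieze_entry alpha i j.
Proof. by case: Halpha => _; apply; exact: frieze_entry_solves. Qed.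

(** By antiperiodicity the a - 1 values before i - 1 + b vanish, so the recurrence there keeps only
    its last term. *)
Lemma frieze_entry_top i : frieze_entry alpha i (i + w%:Z) = 1.
Proof.
have := frieze_entry_solves alpha i (i - 1 + b%:Z).
rewrite frieze_entry_turn frieze_entry1 big1 => [|j _]; last first.
  rewrite (_ : i - 1 + b%:Z - j.+1%:Z = i - 1 - j.+1%:Z + b%:Z); last by lia.
  by rewrite frieze_entry_turn frieze_entry0 ?mulr0 //= ltnS.
rewrite add0r (_ : i - 1 + b%:Z - a%:Z = i + w%:Z); last by have := frieze_widthE; lia.
by move/(mulfI e0) => <-.
Qed.

Lemma frieze_extend_equation (i j : int) : - a%:Z <= j - i <= b%:Z - 2 ->
  frieze_extend (equation_frieze alpha) i j = frieze_entry alpha i j.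
Proof.
move=> hij; have wE := frieze_widthE.
have [h|h] := ltP (j - i) (-1).
  rewrite frieze_extend0; last by lia.
  have -> : j = i - 1 - `|(i - 1 - j)%R|%N%:Z by lia.
  by rewrite frieze_entry0 //; lia.
have [h1|h1] := eqVneq (j - i) (-1).
  rewrite frieze_extend1; last by lia.
  by rewrite (_ : j = i - 1) ?frieze_entry1 //; lia.
have [h2|h2] := ltP (j - i) w%:Z.
  have hk : (`|(j - i)%R| < w)%N by lia.
  have -> : j = i + (Ordinal hk : nat)%:Z by rewrite /=; lia.
  by rewrite frieze_extend_inside.
have [h3|h3] := eqVneq (j - i) w%:Z.
  rewrite frieze_extend1; last by lia.
  by rewrite (_ : j = i + w%:Z) ?frieze_entry_top //; lia.
rewrite frieze_extend0; last by lia.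
have -> : j = i - 1 - `|(i - 1 + b%:Z - j)%R|%N%:Z + b%:Z by lia.
by rewrite frieze_entry_turn frieze_entry0 ?mulr0 //; lia.
Qed.

Lemma array_minor_equation q (i j : int) : - a%:Z + q%:Z - 1 <= j - i <= b%:Z - 1 - q%:Z ->
  array_minor (equation_frieze alpha) q i j = \det (frieze_block alpha q i j).
Proof.
move=> h; congr (\det _); apply/matrixP => x y; rewrite !mxE.
by apply: frieze_extend_equation; have := ltn_ord x; have := ltn_ord y; lia.
Qed.

Lemma equation_frieze_tame : tame_array (equation_frieze alpha).
Proof.
have wE := frieze_widthE; split=> i j hij.
  by rewrite array_minor_equation ?frieze_block1 //; lia.
by rewrite array_minor_equation ?frieze_block0 //; lia.
Qed.

End EquationToFrieze.

Definition frieze_column (d : int -> 'I_w -> K) (i j : int) : 'cV[K]_a :=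
  \col_x frieze_extend d (i + (x : nat)%:Z) j.

Definition frieze_coefs d (j : int) : 'cV[K]_a :=
  invmx (window (frieze_column d (j - n%:Z)) (j - 1)) *m frieze_column d (j - n%:Z) j.

Definition frieze_equation d (j : int) (k : 'I_n) : K :=
  (-1) ^+ k * frieze_coefs d j (widen_ord (leqnSn n) k) 0.

Lemma signed_frieze_equation d j k :
  signed_coef (frieze_equation d) j k = frieze_coefs d j (widen_ord (leqnSn n) k) 0.
Proof. by rewrite /signed_coef /frieze_equation mulrA signr_sqr mul1r. Qed.

Section FriezeToEquation.
Variable d : int -> 'I_w -> K.
Hypothesis Hd : tame_array d.
Local Notation f := (frieze_extend d).
Local Notation alpha := (frieze_equation d).

Lemma array_minor_window i j :
  array_minor d a i j = \det (window (frieze_column d i) (j + n%:Z)) * \det (reversal a).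
Proof.
rewrite -det_mulmx -ascendingE; congr (\det _).
by apply/matrixP => x y; rewrite !mxE.
Qed.

Lemma window_column_det (i m : int) : -1 <= m - n%:Z - i <= w%:Z ->
  \det (window (frieze_column d i) m) * \det (reversal a) = 1.
Proof.
by case: Hd => H _ /H; rewrite array_minor_window (_ : m - n%:Z + n%:Z = m) //; lia.
Qed.

Lemma window_column_unit (i m : int) : -1 <= m - n%:Z - i <= w%:Z ->
  window (frieze_column d i) m \in unitmx.
Proof.
move/window_column_det => E; rewrite unitmxE unitfE; apply/eqP => d0.
by move/eqP: E; rewrite d0 mul0r eq_sym oner_eq0.
Qed.

Lemma frieze_coefs_relation j : frieze_column d (j - n%:Z) j =
  \sum_(k < n) frieze_coefs d j (widen_ord (leqnSn n) k) 0 *: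
    frieze_column d (j - n%:Z) (j - k.+1%:Z)
  + frieze_coefs d j ord_max 0 *: frieze_column d (j - n%:Z) (j - a%:Z).
Proof.
have u : window (frieze_column d (j - n%:Z)) (j - 1) \in unitmx.
  by apply: window_column_unit; lia.
have -> : frieze_column d (j - n%:Z) j =
    window (frieze_column d (j - n%:Z)) (j - 1) *m frieze_coefs d j.
  by rewrite mulKVmx.
rewrite window_mulE; congr (_ + _).
  by apply: eq_bigr => k _; rewrite (_ : j - 1 - _ = j - k.+1%:Z) //; lia.
by rewrite (_ : j - 1 - _ = j - a%:Z) //; lia.
Qed.

(** Two consecutive windows of columns are minors of order a with the same value, so the companion
    matrix between them has determinant 1. *)
Lemma frieze_coefs_last j : frieze_coefs d j ord_max 0 = e.
Proof.
have wE := frieze_widthE.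
have D := det_window_step (frieze_coefs_relation j).
have D1 := @window_column_det (j - n%:Z) j ltac:(lia).
have D2 := @window_column_det (j - n%:Z) (j - 1) ltac:(lia).
have E : e * frieze_coefs d j ord_max 0 = 1.
  by rewrite -[LHS]mulr1 -[X in _ * X = _]D2 mulrA -D.
by apply: (mulfI e0); rewrite E signr_sqr.
Qed.

(** The failure of row i to satisfy the relation of column j; that relation is solved for on the a
    rows j - a + 1, ..., j only. *)
Definition frieze_defect i j : K := f i j -
  (\sum_(k < n) signed_coef alpha j k * f i (j - k.+1%:Z) + e * f i (j - a%:Z)).

Lemma frieze_defect_base j (x : 'I_a) : frieze_defect (j - n%:Z + (x : nat)%:Z) j = 0.
Proof.
have fE u : f (j - n%:Z + (x : nat)%:Z) u = frieze_column d (j - n%:Z) u x 0 by rewrite mxE.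
apply/eqP; rewrite /frieze_defect subr_eq0 !fE {1}frieze_coefs_relation mxE summxE.
rewrite frieze_coefs_last; apply/eqP; congr (_ + _); last by rewrite mxE.
by apply: eq_bigr => k _; rewrite mxE signed_frieze_equation fE.
Qed.

Definition defect_vector (j : int) : 'cV[K]_a.+1 :=
  \col_y if unlift ord0 y is Some y' then
    - (if unlift ord_max y' is Some k then signed_coef alpha j k else e) else 1.

Lemma frieze_defect_mul q (i j : int) (x : 'I_q) :
  ((\matrix_(x < q, y < a.+1) f (i + (x : nat)%:Z) (j - (y : nat)%:Z)) *m
    defect_vector j) x 0 = frieze_defect (i + (x : nat)%:Z) j.
Proof.
rewrite mxE big_ord_recl big_ord_recr /frieze_defect opprD /= -sumrN.
rewrite !mxE unlift_none mulr1 subr0; congr (_ + (_ + _)).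
  apply: eq_bigr => k _; rewrite !mxE liftK.
  have {2}-> : widen_ord (leqnSn n) k = lift ord_max k.
    by apply: val_inj; rewrite /= /bump leqNgt ltn_ord.
  by rewrite liftK mulrN mulrC /= /bump.
by rewrite liftK unlift_none mulrN mulrC /bump.
Qed.

(* The relation between a + 1 consecutive columns extends one row up at a time:
   the next minor of order a + 1 vanishes, and its cofactor is a minor of order
   a, hence equal to 1. *)
Lemma frieze_defect0 (i j : int) : j - b%:Z + 2 <= i <= j -> frieze_defect i j = 0.
Proof.
have wE := frieze_widthE.
have [k hk] : exists k : nat, i = j - k%:Z \/ j < i.
  by case: (leP i j) => h; [exists `|(j - i)%R|%N; left; lia|exists 0%N; right].
case: hk => [->|h] hi; last by lia.
elim: k {-2}k (leqnn k) hi {i} => [|m IH] k km hi.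
  have := frieze_defect_base j ord_max; rewrite (_ : j - n%:Z + _ = j - k%:Z) //=; lia.
have [kn|nk] := leqP k n.
  have hx : (n - k < a)%N by lia.
  have := frieze_defect_base j (Ordinal hx).
  by rewrite (_ : j - n%:Z + _ = j - k%:Z) //=; lia.
set i := j - k%:Z in hi *.
pose T := \matrix_(x < a.+1, y < a.+1) f (i + (x : nat)%:Z) (j - (y : nat)%:Z).
have T0 : \det T = 0.
  have [_ /(_ i (j - a%:Z))] := Hd; rewrite /array_minor.
  have -> : \matrix_(x < a.+1, y < a.+1) f (i + (x : nat)%:Z) (j - a%:Z + (y : nat)%:Z)
      = T *m reversal a.+1.
    apply/matrixP => x y; rewrite mul_reversal !mxE; congr (f _ _).
    by rewrite /=; have := ltn_ord y; lia.
  rewrite det_mulmx => H; apply: (mulIf (reversal_unit a.+1)).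
  by rewrite mul0r; apply: H; rewrite /i; lia.
have Tz : T *m defect_vector j = frieze_defect i j *: delta_mx ord0 0.
  apply/matrixP => x l; rewrite ord1 frieze_defect_mul !mxE eqxx andbT.
  case: x => [[|u] hu] /=; first by rewrite addr0 mulr1.
  rewrite mulr0 (_ : i + u.+1%:Z = j - (k - u.+1)%N%:Z); last by rewrite /i; lia.
  by apply: IH; rewrite /i in hi; lia.
have : (\adj T *m (T *m defect_vector j)) ord0 0 = 0.
  by rewrite mulmxA mul_adj_mx T0 mul_scalar_mx scale0r mxE.
rewrite Tz -scalemxAr mxE -colE !mxE /cofactor addn0 expr0 mul1r.
set B := row' _ _; have -> : B = window (frieze_column d (i + 1)) (j - 1).
  by apply/matrixP => x y; rewrite !mxE /= /bump; congr (f _ _); lia.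
move/eqP; rewrite mulf_eq0 => /orP [/eqP //|/eqP D0].
have := @window_column_det (i + 1) (j - 1); rewrite D0 mul0r => /(_ _) E.
have /eqP : 0 = 1 :> K by apply: E; rewrite /i in hi *; lia.
by rewrite eq_sym oner_eq0.
Qed.

(** The lower zeros and ones of the array are the initial values of the solution; beyond them both
    sides obey the same recurrence by [frieze_defect0]. *)
Lemma frieze_entry_extend (i j : int) : i - a%:Z <= j <= i + b%:Z - 2 ->
  frieze_entry alpha i j = f i j.
Proof.
move=> hj; have -> : j = i - a%:Z + `|(j - (i - a%:Z))%R|%N%:Z by lia.
have : (`|(j - (i - a%:Z))%R| <= a + b - 2)%N by lia.
elim: `|(j - (i - a%:Z))%R|%N {-2}`|_|%N (leqnn `|(j - (i - a%:Z))%R|%N) => [|m IH] t tm ht.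
  have -> : t = 0%N by lia.
  rewrite (_ : i - a%:Z + 0 = i - 1 - (ord_max : 'I_a)%:Z); last by rewrite /=; lia.
  rewrite frieze_entry_init; case: (posnP n) => n0.
    rewrite frieze_extend1; last by rewrite /=; lia.
    by rewrite (_ : ord0 == ord_max) //; apply/eqP/val_inj.
  rewrite frieze_extend0; last by rewrite /=; lia.
  by rewrite (_ : (ord0 == ord_max) = false) //; apply/eqP => /(congr1 val) /=; lia.
have [ta|ta] := ltnP t a.
  have hy : (n - t < a)%N by lia.
  rewrite (_ : i - a%:Z + t%:Z = i - 1 - (Ordinal hy)%:Z); last by rewrite /=; lia.
  rewrite frieze_entry_init; have [tn|tn] := eqVneq t n.
    rewrite frieze_extend1; last by rewrite /=; lia.
    by rewrite (_ : ord0 == _) //; apply/eqP/val_inj; rewrite /=; lia.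
  rewrite frieze_extend0; last by rewrite /=; lia.
  by rewrite (_ : (ord0 == _) = false) //; apply/eqP => /(congr1 val) /=; lia.
have := @frieze_defect0 i (i - a%:Z + t%:Z); rewrite /frieze_defect => /(_ ltac:(lia)) /eqP.
rewrite subr_eq0 => /eqP ->; rewrite frieze_entry_solves; congr (_ + e * _).
  apply: eq_bigr => k _; have hk := ltn_ord k.
  rewrite (_ : i - a%:Z + t%:Z - k.+1%:Z = i - a%:Z + (t - k.+1)%N%:Z); last by lia.
  by rewrite IH //; lia.
rewrite (_ : i - a%:Z + t%:Z - a%:Z = i - a%:Z + (t - a)%N%:Z); last by lia.
by rewrite IH //; lia.
Qed.

(** Both sides are solutions in j, compared on the initial window of row i + b. There row i meets
    the upper rows of zeros, and one more step from the upper row of ones gives the sign. *)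
Lemma frieze_entry_row_turn i j :
  frieze_entry alpha i j = e * frieze_entry alpha (i + b%:Z) j.
Proof.
have wE := frieze_widthE; apply/eqP; rewrite -subr_eq0; apply/eqP.
apply: (@solves_eq0 _ _ (signed_coef alpha) e
  (fun j => frieze_entry alpha i j - e * frieze_entry alpha (i + b%:Z) j)
  (i + b%:Z - 1)) => [||y {j}]; first exact: e0.
  move=> {}j; rewrite [in LHS]frieze_entry_solves [X in _ - _ * X]frieze_entry_solves.
  rewrite mulrDr opprD addrACA mulr_sumr -sumrB; congr (_ + _).
    by apply: eq_bigr => k _; rewrite mulrBr mulrCA.
  by rewrite mulrBr.
rewrite frieze_entry_init; have hy := ltn_ord y.
have top (z : nat) : (0 < z < a)%N -> frieze_entry alpha i (i + b%:Z - 1 - z%:Z) = 0.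
  by move=> hz; rewrite frieze_entry_extend ?frieze_extend0 //; lia.
have [y0|y0] := posnP y; last first.
  rewrite top; last by lia.
  rewrite (_ : (ord0 == y) = false) ?mulr0 ?subr0 //.
  by apply/eqP => /(congr1 val) /=; lia.
rewrite (_ : ord0 == y); last by apply/eqP/val_inj.
rewrite y0 subr0 frieze_entry_solves big1 => [|k _]; last first.
  by rewrite top ?mulr0 //; have := ltn_ord k; lia.
rewrite frieze_entry_extend; last by lia.
by rewrite frieze_extend1 ?add0r ?subrr //; lia.
Qed.

(** Antiperiodicity of the fundamental solution comes first; periodicity of the coefficients follows
    because an invertible window determines them. *)
Lemma frieze_equation_superperiodic : superperiodic_equation alpha.
Proof.
have VH := antiperiodic_of_rows frieze_entry_row_turn.
split=> [j k|v Hv i].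
  have E : signed_coef alpha (j + b%:Z) =1 signed_coef alpha j.
    have [|E _] := @coef_uniq _ _ (fundamental_seq alpha) j (signed_coef alpha (j + b%:Z))
      (signed_coef alpha j) e e (fundamental_window alpha _); last exact: E.
    rewrite -fundamental_vsolves; apply: (scalerI e0).
    rewrite -[RHS]VH [RHS]fundamental_vsolves scalerDr scaler_sumr; congr (_ + _).
      apply: eq_bigr => y _; rewrite scalerA mulrC -scalerA -VH.
      by rewrite (_ : j - y.+1%:Z + b%:Z = j + b%:Z - y.+1%:Z) //; lia.
    by rewrite -VH (_ : j - a%:Z + b%:Z = j + b%:Z - a%:Z) //; lia.
  by have := E k; rewrite /signed_coef => /mulfI; apply; rewrite signr_eq0.
have [xi Hxi] := solves_expand e0 (fundamental_vsolves alpha)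
  (fundamental_window alpha 0) Hv.
by rewrite !Hxi VH -scalemxAr mxE.
Qed.

Lemma frieze_equationK : equation_frieze alpha = d.
Proof.
apply/funext => i; apply/funext => k; rewrite /equation_frieze.
have wE := frieze_widthE; have hk := ltn_ord k.
by rewrite frieze_entry_extend ?frieze_extend_inside //; lia.
Qed.

End FriezeToEquation.

(** The columns of the frieze satisfy the original recurrence, and its coefficients are determined
    by an invertible window of columns. *)
Lemma equation_friezeK alpha : superperiodic_equation alpha ->
  frieze_equation (equation_frieze alpha) = alpha.
Proof.
move=> Ha; have Hd := equation_frieze_tame Ha; set d := equation_frieze alpha in Hd *.
apply/funext => j; apply/funext => k.
have wE := frieze_widthE.
have colE (x : 'I_a) (y : nat) : (y <= a)%N ->
    frieze_column d (j - n%:Z) (j - y%:Z) x 0 =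
    frieze_entry alpha (j - n%:Z + (x : nat)%:Z) (j - y%:Z).
  move=> hy; rewrite mxE frieze_extend_equation //; have := ltn_ord x; lia.
have [||E _] := @coef_uniq _ _ (frieze_column d (j - n%:Z)) j
    (fun k => frieze_coefs d j (widen_ord (leqnSn n) k) 0) (signed_coef alpha j)
    (frieze_coefs d j ord_max 0) e.
- by apply: (window_column_unit Hd); lia.
- rewrite -frieze_coefs_relation //; apply/matrixP => x l; rewrite ord1.
  rewrite [RHS]mxE summxE [X in _ = _ + X]mxE colE //.
  have := colE x 0%N isT; rewrite subr0 => ->; rewrite frieze_entry_solves.
  congr (_ + _); apply: eq_bigr => y _; rewrite [RHS]mxE colE //.
  by rewrite ltnW // ltnS.
by rewrite /frieze_equation E /signed_coef mulrA signr_sqr mul1r.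
Qed.

Section FriezeRegularity.

Lemma regular_zprod_mx (T : Type) (X : set T) (G : set (T -> K)) m
    (A : T -> int -> 'M[K]_m.+1) z :
  (forall k, regular_mx X G (fun x => A x k)) ->
  (forall x k, X x -> A x k \is a GRing.unit) ->
  regular_mx X G (fun x => zprod (A x) z).
Proof.
move=> rA uA; case: z => k; apply: regular_prod_mx => i _ //.
by apply: regular_invmx => // x; apply: uA.
Qed.

Lemma regular_equation_frieze i k :
  generated superperiodic_equation [set g | exists i j, g = fun alpha : int -> 'I_n -> K => alpha i j]
    (fun alpha => equation_frieze alpha i k).
Proof.
set X := superperiodic_equation; set G := [set g | _].
have rC m : regular_mx X G (fun alpha => companion (signed_coef alpha m) e).
  move=> y z; apply: (@gen_ext _ _ _ _ (fun alpha =>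
      if unlift ord0 z is Some z' then (y == z' :> nat)%:R
      else if unlift ord_max y is Some j then signed_coef alpha m j else e)).
    case: (unlift ord0 z) => [z'|]; first exact: gen_const.
    case: (unlift ord_max y) => [y'|]; last exact: gen_const.
    by apply: generated_scale; apply: gen_base; exists m, y'.
  by move=> alpha _; rewrite mxE.
have rF m : regular_mx X G (fun alpha => fundamental alpha m).
  apply: regular_zprod_mx => [y|alpha y _]; last by rewrite unitrV companion_unit.
  by apply: regular_invmx => [|alpha _]; [exact: rC|exact: companion_unit].
have rR : regular_mx X G (fun alpha => frieze_row alpha i).
  move=> y z; apply: (@gen_ext _ _ _ _
      (fun alpha => invmx (fundamental alpha (i - 1)) ord0 z)).
    by apply: regular_invmx => // alpha _; exact: fundamental_unit.
  by move=> alpha _; rewrite mxE.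
have rS j : regular_mx X G (fun alpha => fundamental_seq alpha j).
  by move=> y z; apply: (gen_ext (rF j y ord0)) => alpha _; rewrite mxE.
exact: (regular_mulmx rR (rS _) 0 0).
Qed.

Lemma regular_frieze_equation j k :
  generated tame_array [set g | exists i k, g = fun d : int -> 'I_w -> K => d i k]
    (fun d => frieze_equation d j k).
Proof.
set X := tame_array; set G := [set g | _].
have rf i l : generated X G (fun d => frieze_extend d i l).
  rewrite /frieze_extend; case: (_ || _); first exact: gen_const.
  case: (l - i) => [q|q]; last exact: gen_const.
  case: (insub q) => [q'|]; last exact: gen_const.
  by apply: gen_base; exists i, q'.
have rc i l : regular_mx X G (fun d => frieze_column d i l).
  by move=> y z; apply: (gen_ext (rf (i + (y : nat)%:Z) l)) => d _; rewrite mxE.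
apply: generated_scale; apply: (regular_mulmx _ (rc _ _)).
apply: regular_invmx => [y z|d Hd]; last by apply: (window_column_unit Hd); lia.
by apply: (gen_ext (rc (j - n%:Z) (j - 1 - (z : nat)%:Z) y 0)) => d _; rewrite [RHS]mxE.
Qed.

Lemma frieze_isomorphism : isomorphism
  (X := affine_variety tame_array [set g | exists i k, g = fun d : int -> 'I_w -> K => d i k])
  (Y := affine_variety superperiodic_equation
    [set g | exists i j, g = fun alpha : int -> 'I_n -> K => alpha i j])
  frieze_equation.
Proof.
set X := affine_variety tame_array _; set Y := affine_variety superperiodic_equation _.
apply: (@isomorphism_of_inverse _ X Y frieze_equation equation_frieze).
- exact: affine_ext_closed.
- exact: frieze_equation_superperiodic.
- exact: equation_frieze_tame.
- exact: frieze_equationK.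
- exact: equation_friezeK.
- apply: generated_pullback; first exact: frieze_equation_superperiodic.
  by move=> _ [i [j ->]]; exact: regular_frieze_equation.
- apply: generated_pullback; first exact: equation_frieze_tame.
  by move=> _ [i [j ->]]; exact: regular_equation_frieze.
Qed.

End FriezeRegularity.

End Friezes.

(** * Stokes representations *)

Section Representations.
Variables (R : realType) (n b : nat) (i0 l0 : int).
Hypothesis (b0 : (0 < b)%N).
Hypothesis (hl0 : odd `|l0|%N).
Local Notation C := (R[i]).
Local Notation a := n.+1.
Local Notation res x := (residue n (i0 + x)).
Local Notation angle := (angle R n b i0 l0).
Local Notation hmx := (hmx n b i0).
Local Notation stokes_mx := (stokes_mx i0).
Variables (N : nat) (th : N.-tuple R) (tm : 'I_N -> int).
Hypothesis tmE : forall m, tnth th m = angle (tm m).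
Hypothesis tm_range : forall m, 1 <= tm m <= 4 * b%:Z.
Hypothesis tm_surj : forall t (k' k : 'I_a), 1 <= t <= 4 * b%:Z ->
  is_arrow i0 t k' k -> exists m, tm m = t.
Hypothesis tm_sorted : forall m m' : 'I_N, (m < m')%N -> tm m < tm m'.
Implicit Types rho : stokes_data R n N.

Lemma tm_inj : injective tm.
Proof.
move=> m m' e; case: (ltngtP m m') => [/tm_sorted|/tm_sorted|/val_inj //];
by rewrite e ltxx.
Qed.

Lemma arrow_tm m (k' k : 'I_a) :
  stokes_arrow b (tnth th m) k' k <-> is_arrow i0 (tm m) k' k.
Proof.
rewrite (stokes_arrowP _ b0 hl0); split.
  by move=> [t []]; rewrite tmE => /(angle_inj b0) ->.
by move=> ar; exists (tm m).
Qed.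

(* The Stokes matrix at time t, equal to 1 unless t is a singular time. *)
Definition stokes_at rho (t : int) : 'M[C]_a :=
  \prod_(m < N | tm (rev_ord m) == t) rho.2 (rev_ord m).

Lemma stokes_at_tm rho m : stokes_at rho (tm m) = rho.2 m.
Proof.
rewrite /stokes_at (big_pred1 (rev_ord m)) ?rev_ordK // => m' /=.
by rewrite (inj_eq tm_inj) (inv_eq rev_ordK).
Qed.

Lemma stokes_at1 rho t : (forall m, tm m != t) -> stokes_at rho t = 1.
Proof. by move=> ht; rewrite /stokes_at big_pred0 // => m; apply/negbTE. Qed.

Lemma stokes_at_case rho t :
  (exists2 m, tm m = t & stokes_at rho t = rho.2 m) \/
  (forall m, tm m != t) /\ stokes_at rho t = 1.
Proof.
have [[m <-]|H] := pselect (exists m, tm m = t).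
  by left; exists m => //; apply: stokes_at_tm.
have ht m : tm m != t by apply/eqP => e; apply: H; exists m.
by right; split => //; apply: stokes_at1.
Qed.

Definition partial_product rho (t : int) : 'M[C]_a :=
  \prod_(m < N | tm (rev_ord m) <= t) rho.2 (rev_ord m).

(** The products run over [rev_ord], hence by decreasing time, so the factor at time t comes
    first. *)
Lemma filter_step (I : Type) (r : seq I) (g : I -> int) (t : int) :
  pairwise (fun i j => g j < g i) r ->
  [seq i <- r | g i <= t] = [seq i <- r | g i == t] ++ [seq i <- r | g i <= t - 1].
Proof.
elim: r => //= i r IH /andP [hi pr].
have none : g i <= t -> [seq j <- r | g j == t] = [::].
  move=> it; elim: r hi {IH pr} => //= j r IH /andP [ij /IH ->].
  by case: eqP => // e; lia.
case: (ltgtP (g i) t) => it.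
- have -> : g i <= t - 1 by lia.
  by rewrite IH // none //; lia.
- have -> : g i <= t - 1 = false by lia.
  exact: IH.
- have -> : g i <= t - 1 = false by lia.
  by rewrite IH //= none //; lia.
Qed.

Lemma rev_times_decreasing :
  pairwise (fun m m' : 'I_N => tm (rev_ord m') < tm (rev_ord m)) (index_enum 'I_N).
Proof.
have -> : index_enum 'I_N = enum 'I_N by rewrite enumT.
have h : pairwise ltn (map val (enum 'I_N)).
  by rewrite val_enum_ord -sorted_pairwise ?iota_ltn_sorted //; exact: ltn_trans.
rewrite pairwise_map in h; apply: sub_pairwise h => m m' /= mm'.
by apply: tm_sorted; rewrite /=; have := ltn_ord m'; lia.
Qed.

Lemma partial_product_step rho t :
  partial_product rho t = stokes_at rho t * partial_product rho (t - 1).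
Proof.
rewrite /partial_product -[LHS]big_filter (filter_step t rev_times_decreasing).
by rewrite big_cat !big_filter.
Qed.

Lemma partial_product0 rho : partial_product rho 0 = 1.
Proof.
by rewrite /partial_product big_pred0 // => m; have := tm_range (rev_ord m); lia.
Qed.

Lemma stokes_productE rho : stokes_product rho = partial_product rho (4 * b%:Z).
Proof.
by apply: eq_bigl => m; have := tm_range (rev_ord m); case/andP => _ ->.
Qed.

Lemma stokes_product_uptoE rho t :
  stokes_product_upto th rho (angle t) = partial_product rho (t - 1).
Proof.
by apply: eq_bigl => m; rewrite tmE ltr_angle //; lia.
Qed.

(** The frame is the inverse of S_m ... S_1, so within the base turn its columns are the vectors
    u_k. *)
Lemma frame_partial_product rho c (F : int -> 'M[C]_a) :
  (forall t, 1 <= t <= 4 * b%:Z -> stokes_mx c t = stokes_at rho t) ->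
  (forall t : int, F (t - 1) = F t * stokes_mx c t) -> F 0 = 1 ->
  forall t, 0 <= t <= 4 * b%:Z -> F t * partial_product rho t = 1.
Proof.
move=> Hc HF F0 t ht; have -> : t = `|t|%N%:Z by lia.
have {ht} : (`|t| <= 4 * b)%N by lia.
elim: `|t|%N => [|k IH] hk; first by rewrite F0 partial_product0 mulr1.
rewrite partial_product_step -Hc; last by lia.
rewrite mulrA -HF (_ : k.+1%:Z - 1 = k%:Z); last by lia.
by apply: IH; lia.
Qed.

Definition monodromy_coef rho (x : int) : C := rho.1 (res x) (res (x - b%:Z)).

Lemma monodromy_coef_periodic rho x :
  monodromy_coef rho (x - a%:Z) = monodromy_coef rho x.
Proof.
have e y : res (y - a%:Z) = res y.
  apply/eqP; rewrite res_eq; apply/dvdzP; exists (-1); lia.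
by rewrite /monodromy_coef e (_ : x - a%:Z - b%:Z = x - b%:Z - a%:Z) ?e //; lia.
Qed.

Lemma residue_shift x (y : int) : residue n ((res x : nat)%:Z + y) = res (x + y).
Proof.
apply/eqP; rewrite residue_eq val_residue /modz.
apply/dvdzP; exists (- ((i0 + x) %/ a%:Z)%Z); lia.
Qed.

Definition in_low := low a b.

Lemma reducedP rho :
  reduced b i0 rho <-> forall x, ~~ in_low x -> monodromy_coef rho x = 1.
Proof.
have p0 : (0 < gcdn a b)%N by rewrite gcdn_gt0.
split=> [H x lx|H k Hk].
  rewrite /monodromy_coef.
  have -> : res x = residue n (i0 + x - b%:Z + b%:Z) by congr residue; lia.
  rewrite addrA; apply: H => t; rewrite /gab => tp; rewrite subrK res_eq.
  apply: contra lx => /dvdzP [q e]; rewrite /in_low /low.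
  have -> : x = q * a%:Z + t%:Z by lia.
  have pa := @lattice_p_le a b isT; rewrite modzMDl modz_small //; lia.
have ek : k + b%:Z = i0 + (k + b%:Z - i0) by lia.
have ek' : k = i0 + (k + b%:Z - i0 - b%:Z) by lia.
rewrite ek [X in rho.1 _ (residue n X)]ek' -/(monodromy_coef rho _); apply: H.
apply/negP => lo; set x := k + b%:Z - i0 in ek lo.
have hx : 0 <= (x %% a%:Z)%Z by rewrite modz_ge0.
have := Hk `|(x %% a%:Z)%Z|%N; rewrite /in_low /low in lo.
move=> /(_ _) /negP; apply.
  by rewrite /gab; lia.
by rewrite ek res_eq gez0_abs // -eqz_mod_dvd modz_mod.
Qed.

Lemma frieze_compatibleP rho : frieze_compatible b i0 rho <->
  forall x, in_low x -> monodromy_coef rho x = frieze_sign a b C n.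
Proof.
split=> [H x lx|H m /andP [m1 mp]].
  have hx : 0 <= (x %% a%:Z)%Z by rewrite modz_ge0.
  rewrite -[RHS](H (`|(x %% a%:Z)%Z|.+1)%N); last first.
    by move: lx; rewrite /in_low /low /gab; lia.
  rewrite /reduced_monodromy.
  rewrite (_ : i0 + _ - 1 = i0 + (x %% a%:Z)%Z); last by lia.
  rewrite -addrA; apply: (periodic_eq (monodromy_coef_periodic rho)).
  by rewrite -eqz_mod_dvd modz_mod.
rewrite /reduced_monodromy.
have -> : i0 + m%:Z - 1 = i0 + (m%:Z - 1) by lia.
rewrite -addrA; apply: H; rewrite /in_low /low.
have pa := @lattice_p_le a b isT; rewrite /gab in mp; rewrite modz_small; lia.
Qed.

Section StokesRepresentation.
Variable rho : stokes_data R n N.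
Hypothesis Hrho : stokes_rep b th rho.

Lemma monodromy_coef_neq0 x : monodromy_coef rho x != 0.
Proof.
have [_ _ _ _ H] := Hrho; apply/H.
by rewrite residue_shift; congr residue; lia.
Qed.

Lemma monodromy_hmx : rho.1 = hmx (monodromy_coef rho).
Proof.
have [_ _ _ _ H] := Hrho; apply/matrixP => k k'; rewrite mxE.
case: eqP => [e|ne]; last first.
  by apply/eqP/negbNE/negP => /H.
rewrite /monodromy_coef res_lift; congr (rho.1 _ _).
have [y ey] := lift_res i0 k'; have [x ex] := lift_res i0 k.
move: e; rewrite ex ey residue_shift => /eqP; rewrite res_eq => h.
have -> : i0 + ((res x : nat)%:Z - i0 - b%:Z) = (res x : nat)%:Z + - b%:Z by lia.
by rewrite residue_shift; apply/eqP; rewrite res_eq (_ : _ - _ = - (x - (y + b%:Z))) ?rpredN //; lia.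
Qed.

Lemma stokes_at_diag t k : stokes_at rho t k k = 1.
Proof.
have [_ _ H _ _] := Hrho.
by case: (stokes_at_case rho t) => [[m _ ->]|[_ ->]]; rewrite ?H // mxE eqxx.
Qed.

Lemma stokes_at_off t k k' : k != k' -> ~ is_arrow i0 t k' k ->
  stokes_at rho t k k' = 0.
Proof.
have [_ _ _ H _] := Hrho => ne na.
case: (stokes_at_case rho t) => [[m mt ->]|[_ ->]]; last first.
  by rewrite mxE (negbTE ne).
by apply: H => //; rewrite arrow_tm mt.
Qed.

End StokesRepresentation.

(** A solution of P (x - b) = H x P x, built separately on each class modulo b. Dividing a twisted
    family by the ratios P x / P (x - j) makes it b-periodic. *)
Definition turn_potential (H : int -> C) (x : int) : C :=
  zprod (fun k => H ((x %% b%:Z)%Z + k * b%:Z)) (x %/ b%:Z)%Z.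

Lemma turn_potential_sub (H : int -> C) x : (forall y, H y != 0) ->
  turn_potential H (x - b%:Z) = H x * turn_potential H x.
Proof.
move=> H0; rewrite /turn_potential.
have -> : x - b%:Z = -1 * b%:Z + x by lia.
rewrite modzMDl divzMDl; last by lia.
rewrite (addrC (-1)) zprodP => [|k]; last by rewrite unitfE.
by rewrite mulrC addrC -divz_eq.
Qed.

Lemma turn_potential_neq0 (H : int -> C) x : (forall y, H y != 0) ->
  turn_potential H x != 0.
Proof.
by move=> H0; rewrite -unitfE zprod_unit // => k; rewrite unitfE.
Qed.

(* The number of turns separating the arrow from x with superscript j.+1 from
   its translate at a time between 1 and 4 b. *)
Definition arrow_turn (x : int) (j : 'I_n) : int :=
  ((a%:Z + j.+1.*2%:Z - 4 * x - 1) %/ (4 * b%:Z))%Z.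

Lemma arrow_turnP x (j : 'I_n) : 1 <= a%:Z + j.+1.*2%:Z - 4 * (x + arrow_turn x j * b%:Z) <= 4 * b%:Z.
Proof.
rewrite /arrow_turn; set t := a%:Z + j.+1.*2%:Z - 4 * x - 1.
have h1 := divz_eq t (4 * b%:Z); have h2 : 0 <= (t %% (4 * b%:Z))%Z by rewrite modz_ge0; lia.
have h3 : (t %% (4 * b%:Z))%Z < 4 * b%:Z by rewrite ltz_pmod; lia.
lia.
Qed.

Lemma arrow_turn_eq x (j : 'I_n) z :
  1 <= a%:Z + j.+1.*2%:Z - 4 * (x + z * b%:Z) <= 4 * b%:Z -> arrow_turn x j = z.
Proof.
have := arrow_turnP x j; set y := arrow_turn x j => h1 h2.
have b1 : 0 < b%:Z by lia.
have h : (y - z) * b%:Z < b%:Z by rewrite mulrBl; lia.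
have h' : (z - y) * b%:Z < b%:Z by rewrite mulrBl; lia.
by nia.
Qed.

(* The entries of the Stokes matrices in the base period, transported to the
   other arrows so that the family is twisted-periodic. *)
Definition rep_coef rho (x : int) (j : 'I_n) : C :=
  let P := turn_potential (monodromy_coef rho) in
  let y := x + arrow_turn x j * b%:Z in
  P x / P (x - j.+1%:Z) * (P (y - j.+1%:Z) / P y) *
  stokes_at rho (a%:Z + j.+1.*2%:Z - 4 * y) (res (y - j.+1%:Z)) (res y).

Lemma twisted_ext (H : int -> C) (c c' : int -> 'I_n -> C) :
  (forall x, H x != 0) -> twisted b H c -> twisted b H c' ->
  (forall x (j : 'I_n), 1 <= a%:Z + j.+1.*2%:Z - 4 * x <= 4 * b%:Z -> c x j = c' x j) ->
  c = c'.
Proof.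
move=> H0 tc tc' cc; apply/funext => x; apply/funext => j.
pose f y := c y j == c' y j.
have fb y : f (y - b%:Z) = f y.
  by rewrite /f -(inj_eq (mulIf (H0 (y - j.+1%:Z)))) tc tc' (inj_eq (mulfI (H0 y))).
suff : f x by move/eqP.
rewrite (periodic_eq fb (y := x + arrow_turn x j * b%:Z)).
  by apply/eqP/cc/arrow_turnP.
by apply/dvdzP; exists (- arrow_turn x j); lia.
Qed.

(** * The recessive sequence of a Stokes representation *)

Section RepresentationToSequence.
Variable rho : stokes_data R n N.
Hypothesis Hrho : stokes_rep b th rho.
Local Notation H := (monodromy_coef rho).
Local Notation c := (rep_coef rho).

Lemma rep_coef_twisted : twisted b H c.
Proof.
move=> x j; rewrite /rep_coef.
have H0 := monodromy_coef_neq0 Hrho.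
have -> : arrow_turn (x - b%:Z) j = arrow_turn x j + 1.
  by apply: arrow_turn_eq; have := arrow_turnP x j; lia.
have -> : x - b%:Z + (arrow_turn x j + 1) * b%:Z = x + arrow_turn x j * b%:Z by lia.
have -> : x - b%:Z - j.+1%:Z = x - j.+1%:Z - b%:Z by lia.
rewrite !turn_potential_sub //; move: (stokes_at _ _ _ _) => S.
by field; rewrite H0 !turn_potential_neq0.
Qed.

Lemma rep_coef_stokes t : 1 <= t <= 4 * b%:Z -> stokes_mx c t = stokes_at rho t.
Proof.
move=> ht; apply: stokes_mx_uniq.
- exact: stokes_at_diag.
- exact: stokes_at_off.
move=> x j e; have et : a%:Z + j.+1.*2%:Z - 4 * x = t by lia.
have z0 : arrow_turn x j = 0 by apply: arrow_turn_eq; lia.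
have H0 := monodromy_coef_neq0 Hrho.
rewrite /rep_coef z0 mul0r addr0 et -[LHS]mul1r; congr (_ * _).
by field; rewrite !turn_potential_neq0.
Qed.

Definition rep_frame : int -> 'M[C]_a := zprod (stokes_mx c).
Definition rep_seq : int -> 'cV[C]_a := frame_seq i0 rep_frame.

Lemma rep_frameP t : rep_frame (t - 1) = rep_frame t * stokes_mx c t.
Proof. by apply: zprodP => z; apply: stokes_mx_unit. Qed.

Lemma rep_frame0 : rep_frame 0 = 1. Proof. exact: zprod0. Qed.

Lemma rep_frame_monodromy : rep_frame (4 * b%:Z) = hmx H.
Proof.
have [_ Hprod _ _ _] := Hrho; rewrite -(monodromy_hmx Hrho).
have E : rep_frame (4 * b%:Z) * stokes_product rho = 1.
  rewrite stokes_productE.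
  by apply: (frame_partial_product rep_coef_stokes rep_frameP rep_frame0); lia.
have h : stokes_product rho * rho.1 = 1 by exact: mulmx1C Hprod.
by rewrite -[LHS]mulr1 -h mulrA E mul1r.
Qed.

Lemma rep_seq_vsolves : vsolves c 1 rep_seq.
Proof. exact/frame_seq_vsolves/rep_frameP. Qed.

Lemma rep_seq_window m : window rep_seq m \in unitmx.
Proof.
by apply: (frame_window_unit (F := rep_frame) rep_frameP); rewrite rep_frame0 unitmx1.
Qed.

Lemma rep_seq_turn x : rep_seq (x - b%:Z) = H x *: rep_seq x.
Proof.
apply: (frame_quasiperiodic _ _ rep_coef_twisted rep_frameP rep_frame0 rep_frame_monodromy).
- exact: monodromy_coef_periodic.
- exact: monodromy_coef_neq0.
Qed.

Lemma recessive_polygonE k (m : 'I_b) :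
  recessive_polygon b i0 l0 th rho k m = rep_seq ((m : nat)%:Z - b%:Z) k 0.
Proof.
rewrite mxE decay_angleE // -[2 * pi]mulr1 -[1 : R]/(1%:~R) angle_turn // mulr1.
rewrite stokes_product_uptoE.
(* The product stops strictly before the decay direction, that is at time 4b - 4m - 1, where the
   column m - b is still constant. *)
set t := _ - 1.
have ht : 0 <= t <= 4 * b%:Z by rewrite /t; have := ltn_ord m; lia.
have E := frame_partial_product rep_coef_stokes rep_frameP rep_frame0 ht.
have -> : invmx (partial_product rho t) = rep_frame t.
  have u : partial_product rho t \in unitmx.
    by have /mulmx1_unit [] := E.
  have E' : rep_frame t *m partial_product rho t = 1%:M by exact: E.
  by rewrite -[LHS]mul1mx -E' mulmxK.
rewrite -addrA /rep_seq -(frame_const rep_frameP (t := t)); last by rewrite /t; lia.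
by rewrite -colE mxE.
Qed.

End RepresentationToSequence.

(** * The representation of a twisted family of coefficients *)

Section SequenceToRepresentation.
Variables (H : int -> C) (c : int -> 'I_n -> C).

Definition mk_rep : stokes_data R n N :=
  (hmx H, [ffun m => stokes_mx c (tm m)]).

Hypothesis Ha : forall x, H (x - a%:Z) = H x.
Hypothesis H0 : forall x, H x != 0.

Lemma mk_rep_monodromy x : monodromy_coef mk_rep x = H x.
Proof. by rewrite /monodromy_coef hmxE // subrr dvdz0. Qed.

Lemma mk_rep_stokes t : 1 <= t <= 4 * b%:Z -> stokes_at mk_rep t = stokes_mx c t.
Proof.
move=> ht; case: (stokes_at_case mk_rep t) => [[m <- ->]|[hm ->]].
  by rewrite ffunE.
apply/esym/stokes_mx_uniq => [k|k k' ne _|x j e].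
- by rewrite mxE eqxx.
- by rewrite mxE (negbTE ne).
have [|m mt] := @tm_surj t (res x) (res (x - j.+1%:Z)) ht.
  by exists x, j.
by have := hm m; rewrite mt eqxx.
Qed.

Hypothesis tc : twisted b H c.
Hypothesis Hmon : zprod (stokes_mx c) (4 * b%:Z) = hmx H.

Lemma mk_rep_stokes_rep : stokes_rep b th mk_rep.
Proof.
have uS z : stokes_mx c z \is a GRing.unit by exact: stokes_mx_unit.
split.
- by split=> [|m] /=; rewrite ?ffunE; [exact: hmx_unit|exact: uS].
- rewrite /= -Hmon stokes_productE.
  apply: (frame_partial_product (c := c)) => [t ht|t||].
  + by rewrite mk_rep_stokes.
  + exact: zprodP.
  + exact: zprod0.
  + by lia.
- by move=> m k; rewrite ffunE stokes_mx_diag.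
- by move=> m k k' ne; rewrite arrow_tm ffunE => na; apply: stokes_mx0.
move=> k k' /=; rewrite mxE; case: ifPn => [/eqP e|/eqP ne]; last by split=> [|e]; [rewrite eqxx|case: (ne e)].
by split.
Qed.

Lemma mk_rep_coef : rep_coef mk_rep = c.
Proof.
apply: (twisted_ext H0 _ tc) => [x j|x j hx].
  rewrite -!mk_rep_monodromy; exact: (rep_coef_twisted mk_rep_stokes_rep).
have e : 4 * x + (a%:Z + j.+1.*2%:Z - 4 * x) = a%:Z + j.+1.*2%:Z by lia.
rewrite -(stokes_mx_entry i0 (rep_coef mk_rep) e).
by rewrite (rep_coef_stokes mk_rep_stokes_rep) // mk_rep_stokes // stokes_mx_entry.
Qed.

End SequenceToRepresentation.

Lemma mk_repK rho : stokes_rep b th rho ->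
  mk_rep (monodromy_coef rho) (rep_coef rho) = rho.
Proof.
move=> Hrho; rewrite /mk_rep -(monodromy_hmx Hrho) [RHS]surjective_pairing.
congr (_, _); apply/ffunP => m; rewrite ffunE rep_coef_stokes //.
exact: stokes_at_tm.
Qed.

(** * Framings and projective equivalence *)

Lemma scale_div (K : fieldType) (W : lmodType K) (h e : K) (w w' : W) :
  h != 0 -> h *: w = e *: w' -> w = (e / h) *: w'.
Proof. by move=> h0 E; rewrite mulrC -scalerA -E scalerA mulVf ?scale1r. Qed.

Lemma scale_turn (K : fieldType) (W : lmodType K) (h h' e : K) (w w' : W) :
  h != 0 -> w = e *: w' -> h' *: w = (e * h' / h) *: (h *: w').
Proof. by move=> h0 ->; rewrite !scalerA mulfVK // mulrC. Qed.

Lemma diag_mx_unit (d : 'rV[C]_a) : (forall k, d 0 k != 0) ->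
  diag_mx d \is a GRing.unit.
Proof.
move=> d0; rewrite -[_ \is a _]/(diag_mx d \in unitmx) unitmxE det_diag unitfE.
exact/prodf_neq0.
Qed.

Lemma diag_mxV (d : 'rV[C]_a) : (forall k, d 0 k != 0) ->
  invmx (diag_mx d) = diag_mx (\row_i (d 0 i)^-1).
Proof.
move=> d0; apply: (can_inj (mulKmx (diag_mx_unit d0))).
rewrite mulmxV ?diag_mx_unit // mulmx_diag.
apply/matrixP => k k'; rewrite !mxE; case: eqP => [->|_]; last by rewrite !mulr0n.
by rewrite mulfV.
Qed.

Lemma diag_conjE (d : 'rV[C]_a) (A : 'M[C]_a) k k' : (forall k, d 0 k != 0) ->
  (diag_mx d *m A *m invmx (diag_mx d)) k k' = d 0 k * A k k' / d 0 k'.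
Proof. by move=> d0; rewrite diag_mxV // mul_mx_diag mul_diag_mx !mxE. Qed.

Lemma stokes_upto_unit rho t : stokes_rep b th rho ->
  stokes_product_upto th rho t \is a GRing.unit.
Proof. by move=> [[_ uS] _ _ _ _]; apply: rpred_prod => m _; apply: uS. Qed.

Section FramingChange.
Variables (rho rho' : stokes_data R n N).
Hypothesis Hrho : stokes_rep b th rho.

(** Conjugation by a diagonal matrix acts on columns of inverse products as one linear map followed
    by a rescaling of each column. *)
Lemma framing_projective : framing_equiv b rho rho' ->
  projective_equiv (recessive_polygon b i0 l0 th rho)
                   (recessive_polygon b i0 l0 th rho').
Proof.
move=> [d [d0 _ _ eS]]; have uD := diag_mx_unit d0.
have invE (A : 'M[C]_a) : A \in unitmx ->
    invmx (diag_mx d *m A *m invmx (diag_mx d)) =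
    diag_mx d *m invmx A *m invmx (diag_mx d).
  move=> uA; rewrite -[LHS]/((diag_mx d * A * (diag_mx d)^-1)^-1).
  by rewrite !invrM ?unitrV ?unitrMr // invrK mulrA.
have uptoE t : stokes_product_upto th rho' t =
    diag_mx d *m stokes_product_upto th rho t *m invmx (diag_mx d).
  rewrite /stokes_product_upto.
  pose f (A : 'M[C]_a) := diag_mx d * A * (diag_mx d)^-1.
  have fM A B : f (A * B) = f A * f B.
    by rewrite /f -!mulrA; congr (_ * (_ * _)); rewrite mulKr.
  rewrite -[RHS]/(f _) (big_morph f fM (id1 := 1)).
    by apply: eq_bigr => m _; exact: eS.
  by rewrite /f mulr1 mulrV.
exists (diag_mx d), (\row_m (d 0 (residue n (i0 + (m : 'I_b)%:Z - b%:Z)))^-1).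
split=> //; first by move=> m; rewrite mxE invr_neq0.
apply/matrixP => k m; rewrite mul_mx_diag mul_diag_mx !mxE uptoE.
by rewrite invE ?stokes_upto_unit // diag_conjE.
Qed.

End FramingChange.

Section ProjectiveChange.
Variables (rho rho' : stokes_data R n N).
Hypotheses (Hrho : stokes_rep b th rho) (Hrho' : stokes_rep b th rho').
Hypotheses (Rrho : reduced b i0 rho) (Rrho' : reduced b i0 rho').
Local Notation H := (monodromy_coef rho).
Local Notation H' := (monodromy_coef rho').
Local Notation V := (rep_seq rho).
Local Notation V' := (rep_seq rho').

(** The proportionality is given at b consecutive positions; quasi-periodicity of both sequences
    carries it to all integers, with corrected scalars. *)
Lemma projective_seq (g : 'M[C]_a) (d : 'rV[C]_b) :
  (forall m, d 0 m != 0) ->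
  recessive_polygon b i0 l0 th rho' =
    g *m recessive_polygon b i0 l0 th rho *m diag_mx d ->
  exists e : int -> C, (forall x, e x != 0) /\ forall x, V' x = e x *: (g *m V x).
Proof.
move=> d0 eM.
have base (m : 'I_b) : V' ((m : nat)%:Z - b%:Z) =
    d 0 m *: (g *m V ((m : nat)%:Z - b%:Z)).
  apply/matrixP => k i; rewrite ord1 -(recessive_polygonE Hrho') eM.
  rewrite mul_mx_diag !mxE mulrC; congr (_ * _); apply: eq_bigr => l _.
  by rewrite recessive_polygonE.
have H0 := monodromy_coef_neq0 Hrho; have H0' := monodromy_coef_neq0 Hrho'.
suff /choice [e He] : forall x, exists e : C, e != 0 /\ V' x = e *: (g *m V x).
  by exists e; split => x; have [] := He x.
move=> x; pose y := (x %% b%:Z)%Z.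
have hy : (`|y| < b)%N.
  have h1 : 0 <= y by rewrite modz_ge0; lia.
  have h2 : y < b%:Z by rewrite ltz_pmod; lia.
  lia.
have -> : x = y - b%:Z + ((x %/ b%:Z)%Z + 1) * b%:Z by rewrite /y /modz; lia.
pose Q (q : int) := exists e : C, e != 0 /\
  V' (y - b%:Z + q * b%:Z) = e *: (g *m V (y - b%:Z + q * b%:Z)).
apply: (@int_ind_pm Q 0) => [|q [e [e0 He]]|q [e [e0 He]]].
- exists (d 0 (Ordinal hy)); split => //.
  have := base (Ordinal hy); rewrite /= mul0r addr0 gez0_abs //.
  by rewrite modz_ge0; lia.
- rewrite /Q; move: He; have -> : y - b%:Z + q * b%:Z = y - b%:Z + (q + 1) * b%:Z - b%:Z by lia.
  move: (y - b%:Z + (q + 1) * b%:Z) => u; rewrite !rep_seq_turn // => He.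
  exists (e * H u / H' u); split; first by rewrite !mulf_neq0 ?invr_neq0.
  by apply: scale_div (H0' u) _; rewrite He -scalemxAr scalerA.
- rewrite /Q; have -> : y - b%:Z + (q - 1) * b%:Z = y - b%:Z + q * b%:Z - b%:Z by lia.
  move: (y - b%:Z + q * b%:Z) He => u He; rewrite !rep_seq_turn //.
  exists (e * H' u / H u); split; first by rewrite !mulf_neq0 ?invr_neq0.
  by rewrite -scalemxAr; apply: scale_turn.
Qed.

(** Uniqueness of the coefficients makes the scalars [e] a-periodic and relates the Stokes entries.
    Comparing turns, with both monodromies reduced, gives invariance under b off the low residues,
    so [e] depends only on x modulo gcd(a, b) and its inverse is a minimal framing. *)
Lemma projective_framing :
  projective_equiv (recessive_polygon b i0 l0 th rho)
                   (recessive_polygon b i0 l0 th rho') ->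
  framing_equiv b rho rho'.
Proof.
move=> [g [d [ug d0 eM]]].
have [e [e0 Ve]] := projective_seq d0 eM.
pose W x := g *m V x.
have sW : vsolves (rep_coef rho) 1 W by exact/vsolves_mul/rep_seq_vsolves.
have uW m : window W m \in unitmx by rewrite window_mul unitmx_mul ug rep_seq_window.
have W0 x : W x != 0.
  apply/eqP => Wx; have := uW x; rewrite unitmxE unitfE => /eqP; apply.
  have := det_mx11; rewrite (expand_det_col _ ord0) big1 // => k _.
  by rewrite mxE subr0 Wx mxE mul0r.
have coefE x : (forall j, rep_coef rho x j =
    rep_coef rho' x j * e (x - j.+1%:Z) / e x) /\ e (x - a%:Z) = e x.
  have E : \sum_(j < n) rep_coef rho x j *: W (x - j.+1%:Z) + 1 *: W (x - a%:Z) =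
    \sum_(j < n) (rep_coef rho' x j * e (x - j.+1%:Z) / e x) *: W (x - j.+1%:Z)
      + (e (x - a%:Z) / e x) *: W (x - a%:Z).
    rewrite -sW; apply: (scalerI (e0 x)); rewrite -Ve (rep_seq_vsolves rho').
    rewrite scalerDr scaler_sumr; congr (_ + _); last first.
      by rewrite scale1r Ve scalerA mulrC mulfVK.
    apply: eq_bigr => j _; rewrite Ve !scalerA; congr (_ *: _).
    by rewrite [RHS]mulrC mulfVK.
  have [Ec E1] := coef_uniq (uW _) E; split => //.
  by apply: (mulIf (invr_neq0 (e0 x))); rewrite -E1 mulfV.
have eH x : e (x - b%:Z) * H x = H' x * e x.
  have : H' x *: V' x = V' (x - b%:Z) by rewrite rep_seq_turn.
  rewrite !Ve (rep_seq_turn Hrho) -scalemxAr !scalerA -/(W x) => /eqP.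
  rewrite -subr_eq0 -scalerBl scaler_eq0 (negbTE (W0 x)) orbF subr_eq0.
  by move=> /eqP.
have ea x : e (x - a%:Z) = e x by have [] := coefE x.
(* The shift by b puts the low residue of the turn relation where [lattice_constant] expects it. *)
pose D z := e (z - b%:Z).
have Dconst z z' : ((gcdn a b)%:Z %| z - z')%Z -> D z = D z'.
  apply: (lattice_constant (a := a) (b := b)) => // {z z'} z.
    by rewrite /D -[RHS]ea; congr e; lia.
  move=> lo; have := eH (z - b%:Z); rewrite /D.
  have lo' : ~~ in_low (z - b%:Z) by [].
  move/reducedP: Rrho => ->; rewrite ?lo' //; move/reducedP: Rrho' => -> //.
  by rewrite mulr1 mul1r.
have econst z z' : ((gcdn a b)%:Z %| z - z')%Z -> e z = e z'.
  move=> h; have := Dconst (z + b%:Z) (z' + b%:Z).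
  by rewrite /D !addrK; apply; rewrite opprD addrACA subrr addr0.
(* As b is a multiple of gcd(a, b), the scalars are also b-periodic, so the remaining monodromy
   entries agree too. *)
have HH x : H' x = H x.
  apply: (mulIf (e0 x)); rewrite -eH mulrC; congr (_ * _).
  apply: econst; rewrite (_ : _ - _ = - b%:Z); last by lia.
  by rewrite rpredN dvdzE /= dvdn_gcdr.
pose f : 'rV[C]_a := \row_k (e ((k : nat)%:Z - i0))^-1.
have f0 k : f 0 k != 0 by rewrite mxE invr_neq0.
have fres x : f 0 (res x) = (e x)^-1.
  rewrite mxE; congr (_^-1); apply: econst.
  apply: (@dvdz_trans a%:Z); first by rewrite dvdzE /= dvdn_gcdl.
  by rewrite -(@res_eq n i0) res_lift.
exists f; split => //.
- move=> k k' kk'; rewrite !mxE; congr (_^-1); apply: econst.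
  rewrite (_ : _ - _ = (k : nat)%:Z - (k' : nat)%:Z); last by lia.
  by move/eqP: kk'; rewrite /gab -!eqz_nat -!modz_nat eqz_mod_dvd.
- rewrite (monodromy_hmx Hrho) (monodromy_hmx Hrho').
  have -> : H' = H by apply/funext.
  apply/matrixP => k k'; rewrite diag_conjE //.
  have [x ->] := lift_res i0 k; have [y ->] := lift_res i0 k'.
  rewrite hmxE; last exact: monodromy_coef_periodic.
  case: ifP => h; last by rewrite mulr0 mul0r.
  rewrite !fres invrK; have -> : e y = e x.
    apply: econst; apply: (@dvdz_trans (gcdn a b)%:Z) => //.
    have -> : y - x = - (x - b%:Z - y) - b%:Z by lia.
    rewrite rpredB ?rpredN //; last by rewrite dvdzE /= dvdn_gcdr.
    by apply: dvdz_trans h; rewrite dvdzE /= dvdn_gcdl.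
  by rewrite mulrAC mulVf ?mul1r.
move=> m; rewrite -[LHS](stokes_at_tm) -rep_coef_stokes //.
apply: stokes_mx_uniq => [k|k k' ne na|x j ej].
- have [_ _ S1 _ _] := Hrho; rewrite diag_conjE // S1 mulr1 mulfV //.
- rewrite diag_conjE // -stokes_at_tm (stokes_at_off Hrho) //.
  by rewrite mulr0 mul0r.
rewrite diag_conjE // -(stokes_at_tm rho) -rep_coef_stokes //.
rewrite stokes_mx_entry // !fres invrK; have [-> _] := coefE x.
by field; rewrite !e0.
Qed.

End ProjectiveChange.

(** Vertices that wrap around the polygon are nonzero multiples of vectors at consecutive positions,
    so a functional vanishing on them kills a whole window. *)
Lemma recessive_nondegenerate rho : stokes_rep b th rho ->
  Defs.nondegenerate (recessive_polygon b i0 l0 th rho).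
Proof.
move=> Hrho m; apply: unitmx_kernel => xi Hxi.
apply: (can_inj (mulmxK (rep_seq_window rho ((m : nat)%:Z - b%:Z + n%:Z)))).
rewrite mul0mx; apply/matrixP => i y; rewrite ord1 row_window [RHS]mxE.
pose f x := xi *m rep_seq rho x == 0.
have fb x : f (x - b%:Z) = f x.
  have E : rep_seq rho (x - b%:Z) = monodromy_coef rho x *: rep_seq rho x.
    exact: (rep_seq_turn Hrho).
  rewrite /f E; apply: row_scale_eq0; exact: (monodromy_coef_neq0 Hrho).
suff /eqP -> : f ((m : nat)%:Z - b%:Z + n%:Z - (y : nat)%:Z) by rewrite mxE.
pose t := rev_ord y; pose c := iter t (@ordS b) m.
have hc : (c : nat)%:Z = (m : nat)%:Z + (n%:Z - (y : nat)%:Z) - ((m + t) %/ b)%N%:Z * b%:Z.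
  have := divn_eq (m + t) b; rewrite /c iter_ordS /t /=; have := ltn_ord y; lia.
rewrite (periodic_eq fb (y := (c : nat)%:Z - b%:Z)).
  apply/eqP/matrixP => k l; rewrite !ord1.
  have E := congr1 (fun A : 'rV[C]_a => A 0 t) Hxi; rewrite /= [RHS]mxE in E.
  rewrite [RHS]mxE -E [LHS]mxE [RHS]mxE; apply: eq_bigr => z _.
  by congr (_ * _); rewrite [RHS]mxE (recessive_polygonE Hrho).
apply/dvdzP; exists ((m + t) %/ b)%N%:Z; lia.
Qed.

Section PolygonRepresentation.
Variable M : 'M[C]_(n.+1, b).
Local Notation polygon_monodromy := (polygon_monodromy b0 M).
Local Notation polygon_stokes := (polygon_stokes b0 M).
Local Notation polygon_scale := (polygon_scale b0 M).

Definition polygon_rep : stokes_data R n N :=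
  mk_rep polygon_monodromy polygon_stokes.

Hypothesis HM : Defs.nondegenerate M.

Let Ha := polygon_monodromy_periodic b0 M.
Let H0 := polygon_monodromy_neq0 b0 HM.

Lemma polygon_frame_monodromy :
  zprod (stokes_mx polygon_stokes) (4 * b%:Z) = hmx polygon_monodromy.
Proof.
apply: (frame_monodromy (m := 0) Ha H0 (polygon_stokes_twisted b0 HM) _ _
  (scaled_vsolves b0 HM) (scaled_window b0 HM _) (scaled_turn b0 HM)).
- by apply: zprodP => z; apply: stokes_mx_unit.
- exact: zprod0.
Qed.

Lemma polygon_rep_stokes_rep : stokes_rep b th polygon_rep.
Proof.
exact: (mk_rep_stokes_rep Ha H0 polygon_frame_monodromy).
Qed.

Lemma polygon_rep_reduced : reduced b i0 polygon_rep.
Proof.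
apply/reducedP => x lo; rewrite mk_rep_monodromy; last exact: Ha.
by rewrite /polygon_monodromy /potential_monodromy (negbTE (lo : ~~ low a b x)).
Qed.

(** The recessive sequence of the constructed representation and the rescaled polygon solve the same
    recurrence, hence differ by an invertible matrix. *)
Lemma recessive_polygon_rep :
  projective_equiv (recessive_polygon b i0 l0 th polygon_rep) M.
Proof.
have cE : rep_coef polygon_rep = polygon_stokes.
  exact: (mk_rep_coef Ha H0 (polygon_stokes_twisted b0 HM) polygon_frame_monodromy).
have sV := rep_seq_vsolves polygon_rep; rewrite cE in sV.
have [g Hg] := vsolves_expand (oner_neq0 _) sV (rep_seq_window _ 0)
  (scaled_vsolves b0 HM).
have ug : g \in unitmx.
  have := scaled_window b0 HM 0.
  have -> : scaled_seq b0 M = (fun x => g *m rep_seq polygon_rep x) by apply/funext.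
  by rewrite window_mul unitmx_mul => /andP [].
exists g, (\row_m (polygon_scale ((m : nat)%:Z - b%:Z))^-1); split => //.
  by move=> m; rewrite mxE invr_neq0 // (polygon_scale_neq0 b0 HM).
apply/matrixP => k m; rewrite mul_mx_diag !mxE.
have /matrixP /(_ k 0) := Hg ((m : nat)%:Z - b%:Z).
rewrite mxE /polygon_seq polygon_index_ord [col _ _ _ _]mxE [RHS]mxE => E.
rewrite (eq_bigr (fun l => g k l * rep_seq polygon_rep ((m : nat)%:Z - b%:Z) l 0)) -?E.
  by rewrite mulrAC mulfV ?mul1r // (polygon_scale_neq0 b0 HM).
by move=> l _; rewrite recessive_polygonE //; exact: polygon_rep_stokes_rep.
Qed.

End PolygonRepresentation.

Local Notation Rred := (Rred n b i0 th).
Local Notation vertices := (recessive_polygon b i0 l0 th).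

Lemma regular_stokes_matrix (X : set (stokes_data R n N)) m :
  regular_mx X (@stokes_coord R n N) (fun rho => rho.2 m).
Proof. by move=> k k'; apply: gen_base; right; exists m, k, k'. Qed.

Lemma vertices_regular (X : set (stokes_data R n N)) :
  (forall rho, X rho -> stokes_rep b th rho) ->
  regular_mx X (@stokes_coord R n N) vertices.
Proof.
move=> HX k m; set t := decay_angle R n b (i0 + (m : nat)%:Z) l0 + 2 * pi.
have H : regular_mx X (@stokes_coord R n N)
    (fun rho => invmx (stokes_product_upto th rho t)).
  apply: regular_invmx => [|rho /HX Hrho]; last exact: stokes_upto_unit.
  by apply: regular_prod_mx => i _; apply: regular_stokes_matrix.
apply: (gen_ext (H k (residue n (i0 + (m : nat)%:Z - b%:Z)))) => rho _.
by rewrite mxE.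
Qed.

Lemma vertices_pullback f : @regfun _ (polygons R n b) f ->
  @regfun _ Rred (fun rho => f (vertices rho)).
Proof.
apply: generated_pullback => [rho [Hrho _]|_ [k [m ->]]].
  exact: recessive_nondegenerate.
by apply: vertices_regular => rho [].
Qed.

Lemma polygon_rep_pullback f : @regfun _ Rred f ->
  @regfun _ (polygons R n b) (fun M => f (polygon_rep M)).
Proof.
apply: generated_pullback => [M HM|].
  by split; [exact: polygon_rep_stokes_rep|exact: polygon_rep_reduced].
move=> _ [[k [k' ->]]|[m [k [k' ->]]]].
  have H := regular_hmx b i0
    (fun y => regular_polygon_monodromy b0 (X := [set M : 'M[C]_(n.+1, b) | Defs.nondegenerate M])
      (fun M HM => HM) y) k k'.
  exact: H.
have H := regular_stokes_mx i0 (tm m)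
  (fun y j => regular_polygon_stokes b0 (X := [set M : 'M[C]_(n.+1, b) | Defs.nondegenerate M])
    (fun M HM => HM) y j) k k'.
by apply: (gen_ext H) => M _; rewrite ffunE.
Qed.

Lemma projective_equiv_sym (M M' : 'M[C]_(n.+1, b)) :
  projective_equiv M M' -> projective_equiv M' M.
Proof.
move=> [g [d [ug d0 ->]]]; exists (invmx g), (\row_m (d 0 m)^-1); split.
- by rewrite unitmx_inv.
- by move=> m; rewrite mxE invr_neq0.
apply/matrixP => k m; rewrite mul_mx_diag !mulmxA mulVmx // mul1mx.
by rewrite mul_mx_diag !mxE mulfK.
Qed.

Lemma projective_equiv_trans (M M' M'' : 'M[C]_(n.+1, b)) :
  projective_equiv M M' -> projective_equiv M' M'' -> projective_equiv M M''.
Proof.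
move=> [g [d [ug d0 ->]]] [g' [d' [ug' d0' ->]]].
exists (g' *m g), (\row_m (d 0 m * d' 0 m)); split.
- by rewrite unitmx_mul ug' ug.
- by move=> m; rewrite mxE mulf_neq0.
by rewrite !mulmxA -mulmxA mulmx_diag; congr (_ *m diag_mx _).
Qed.

Lemma vertices_equiv rho rho' : @points _ Rred rho -> @points _ Rred rho' ->
  framing_equiv b rho rho' <-> projective_equiv (vertices rho) (vertices rho').
Proof.
move=> [Hrho Rrho] [Hrho' Rrho']; split; first exact: framing_projective.
exact: projective_framing.
Qed.

Lemma vertices_orbit_bijection :
  orbit_bijection (X := Rred) (Y := polygons R n b)
    (@framing_equiv R n b N) (@projective_equiv R n b) vertices.
Proof.
split.
- by move=> rho [Hrho _]; apply: recessive_nondegenerate.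
- exact: vertices_equiv.
move=> M HM; exists (polygon_rep M); last exact: recessive_polygon_rep.
by split; [exact: polygon_rep_stokes_rep|exact: polygon_rep_reduced].
Qed.

Lemma vertices_git_isomorphism :
  exists beta : ambient (wild_character_variety n b i0 th) -> ambient (Pab R n b),
    isomorphism beta /\
    forall rho, @points _ Rred rho ->
      beta (wild_class b i0 th rho) = polygon_class (vertices rho).
Proof.
apply: (@git_isomorphism _ Rred (polygons R n b) _ _ vertices polygon_rep).
- exact: affine_ext_closed.
- exact: affine_ext_closed.
- by move=> rho [Hrho _]; apply: recessive_nondegenerate.
- by move=> M HM; split; [exact: polygon_rep_stokes_rep|exact: polygon_rep_reduced].
- exact: vertices_equiv.
- by move=> M HM; apply: recessive_polygon_rep.
- by move=> M M' _ _; apply: projective_equiv_sym.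
- by move=> M M' M'' _ _ _; apply: projective_equiv_trans.
- exact: vertices_pullback.
- exact: polygon_rep_pullback.
Qed.

(** * Frieze-compatible representations *)

Section FriezeCompatible.
Hypothesis hab : (a < b)%N.
(** Position x carries the index m = x + 1 + b, so this is epsilon_m, the lattice sign at m - 1,
    extended to all integers. *)
Local Notation sg := (fun x : int =>
  lattice_sign (isT : (0 < a)%N) b0 C n (x + b%:Z)).
Local Notation HF := (frieze_monodromy a b C n).
Local Notation RF := (RF n b i0 th).

Lemma lattice_quotient_le : (a %/ gcdn a b <= b %/ gcdn a b)%N.
Proof. by apply: leq_div2r; apply: ltnW. Qed.

Lemma sg_sqr x : sg x * sg x = 1.
Proof. exact: lattice_sign_sqr. Qed.

Lemma HF_sqr x : HF x * HF x = 1.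
Proof. exact: (frieze_monodromy_sqr _ _ lattice_quotient_le). Qed.

Lemma sg_subA x : sg (x - a%:Z) = (-1) ^+ n * sg x.
Proof.
rewrite /= (_ : x - a%:Z + b%:Z = x + b%:Z - a%:Z); last by lia.
exact: (lattice_sign_subA _ b0 C n lattice_quotient_le).
Qed.

Lemma sg_subB x : sg (x - b%:Z) = (-1) ^+ n * HF x * sg x.
Proof.
have := lattice_sign_subB (isT : (0 < a)%N) b0 C n lattice_quotient_le (x + b%:Z).
by rewrite addrK subrK.
Qed.

Lemma HF_periodic x : HF (x - a%:Z) = HF x.
Proof. exact: frieze_monodromy_periodic. Qed.

Lemma eps_signE (m : nat) : (1 <= m <= a + b)%N ->
  eps_sign R n b m = lattice_sign (isT : (0 < a)%N) b0 C n (m%:Z - 1).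
Proof.
move=> hm; have p0 : (0 < gcdn a b)%N by rewrite gcdn_gt0.
rewrite /eps_sign /lattice_sign /gab /sab /gab; case: leqP => mp.
  have c : lattice_coords a b (m%:Z - 1) (m%:Z - 1, 0, 0).
    split => /=; [by lia| |by rewrite !mul0r addr0 subr0].
    by have := lattice_r0 b (isT : (0 < a)%N); lia.
  by have [_ -> ->] := latE (isT : (0 < a)%N) b0 c; rewrite addr0 expr0z.
have [/= hi hl e] := latP (isT : (0 < a)%N) b0 (m%:Z - 1).
have /(lat_k_range (isT : (0 < a)%N) b0) hk : (gcdn a b < m <= a + b)%N by lia.
apply: xget_unique => [|_ [i [k [l [hi' hk' e' ->]]]]].
  set i := lat_i _ _ _ in hi e; set k := lat_k _ _ _ in hk e *.
  set l := lat_l _ _ _ in hl e *.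
  exists (`|i|.+1)%N, `|k|%N, `|l|%N; split; [by lia|by lia| |].
    by apply/eqP; rewrite -eqz_nat PoszD PoszM -addn1 !PoszD PoszM !gez0_abs; lia.
  have -> : k + l = (`|k| + `|l|)%N%:Z by lia.
  by rewrite exprM.
have [|-> ->] := lat_nat (isT : (0 < a)%N) b0 mp hi' _ e'; first by lia.
by rewrite exprM.
Qed.

(** Exactly one translate of the arrow by whole turns falls between times 1 and 4b, so the choice
    made by [xget] is forced. *)
Lemma stokes_entryE rho y (j : 'I_n) :
  let w := y + arrow_turn y j * b%:Z in
  stokes_entry b th rho (i0 + y) l0 j.+1 =
  stokes_at rho (a%:Z + j.+1.*2%:Z - 4 * w) (res (w - j.+1%:Z)) (res w).
Proof.
move=> w; set T := _ - 4 * w.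
have hT : 1 <= T <= 4 * b%:Z := arrow_turnP y j.
have turnE z : arrow_angle R n b (i0 + y) l0 j.+1 + 2 * pi * z%:~R =
    angle (a%:Z + j.+1.*2%:Z - 4 * y + 4 * b%:Z * z).
  by rewrite arrow_angleE // angle_turn.
have [|m mT] := @tm_surj T (res w) (res (w - j.+1%:Z)) hT.
  by exists w, j; split => //; rewrite /T; lia.
apply: xget_unique => [|_ [m' [z [em ->]]]].
  exists m, (- arrow_turn y j); split.
    by rewrite turnE tmE mT /T /w; congr angle; lia.
  rewrite -mT stokes_at_tm; congr (rho.2 m (residue n _) (residue n _)); rewrite /w; lia.
move: em; rewrite turnE tmE => /(angle_inj b0) em.
have ez : arrow_turn y j = - z.
  by apply: arrow_turn_eq; have := tm_range m'; rewrite em; lia.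
have -> : m' = m by apply: tm_inj; rewrite em mT /T /w ez; lia.
rewrite -mT stokes_at_tm; congr (rho.2 m (residue n _) (residue n _)); rewrite /w ez; lia.
Qed.

Lemma h_signE x : 0 <= x < a%:Z -> h_sign R n b (`|x|.+1)%N = HF x.
Proof.
move=> hx; rewrite /h_sign /frieze_monodromy /low modz_small // /gab.
have -> : (x < (gcdn a b)%:Z) = (`|x|.+1 <= gcdn a b)%N by lia.
by case: leqP.
Qed.

(** The sign compensates for the turn separating the arrow of the recurrence from the arrow at which
    the Stokes entry is read. *)
Lemma eta_entry rho (m : nat) (j : 'I_n) : stokes_rep b th rho ->
  (forall x, monodromy_coef rho x = HF x) -> (a < m <= a + b)%N ->
  eta R n b i0 l0 m j.+1 * stokes_entry b th rho (i0 + (m%:Z - 1)) l0 j.+1 =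
  rep_coef rho (m%:Z - 1 - b%:Z) j.
Proof.
move=> Hrho HE hm; set y := m%:Z - 1; set x := y - b%:Z.
have yE : y = m%:Z - 1 by []; have xE : x = y - b%:Z by [].
clearbody x; clearbody y.
have hj := ltn_ord j.
rewrite stokes_entryE /rep_coef.
have tx := arrow_turnP x j; set z := arrow_turn x j in tx *.
have zy : arrow_turn y j = z - 1.
  by apply: arrow_turn_eq; lia.
have -> : y + arrow_turn y j * b%:Z = x + z * b%:Z by rewrite zy; lia.
move: (stokes_at _ _ _ _) => S; congr (_ * S).
have H0 u : monodromy_coef rho u != 0 by exact: monodromy_coef_neq0.
have P0 u := turn_potential_neq0 u H0.
have condE : (arrow_angle R n b (i0 + m%:Z - 1) l0 j.+1 + 2 * pi <=
    decay_angle R n b i0 l0) = (a%:Z + j.+1.*2%:Z - 4 * x <= 0).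
  have -> : i0 + m%:Z - 1 = i0 + y by lia.
  rewrite arrow_angleE // -[2 * pi]mulr1 -[1 : R]/(1%:~R) angle_turn // mulr1.
  by rewrite -[in decay_angle _ _ _ _ _](addr0 i0) decay_angleE // ler_angle //; lia.
rewrite /eta condE.
(* As a - b <= x < a, the arrow time from x either lies in the base turn or, when it is not
   positive, precedes it by one turn. *)
have [t0|t1] := leP (a%:Z + j.+1.*2%:Z - 4 * x) 0; last first.
  have -> : z = 0 by apply: arrow_turn_eq; lia.
  rewrite mul0r addr0 andbF; move: (P0 x) (P0 (x - j.+1%:Z)).
  by move: (turn_potential _ _) (turn_potential _ _) => u v u0 v0; field; rewrite u0 v0.
have -> : z = -1 by apply: arrow_turn_eq; lia.
have -> : x + -1 * b%:Z = x - b%:Z by lia.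
have -> : x - b%:Z - j.+1%:Z = x - j.+1%:Z - b%:Z by lia.
rewrite !turn_potential_sub // !HE.
have F0 u : HF u != 0 by rewrite -HE.
have -> : turn_potential (monodromy_coef rho) x / turn_potential (monodromy_coef rho) (x - j.+1%:Z) *
  (HF (x - j.+1%:Z) * turn_potential (monodromy_coef rho) (x - j.+1%:Z) /
   (HF x * turn_potential (monodromy_coef rho) x)) = (HF x)^-1 * HF (x - j.+1%:Z).
  move: (P0 x) (P0 (x - j.+1%:Z)) (F0 x).
  move: (turn_potential _ _) (turn_potential _ _) (HF x) (HF _) => u v f g u0 v0 f0.
  by field; rewrite u0 v0 f0.
have x0 : 0 <= x < a%:Z by lia.
have e1 : (m - b)%N = (`|x|.+1)%N by lia.
rewrite andbT; case: ltnP => hb.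
  rewrite e1 h_signE // (_ : (`|x|.+1 - j.+1)%N = (`|(x - j.+1%:Z)%R|.+1)%N); last first.
    by lia.
  by rewrite h_signE //; lia.
have xj : x - j.+1%:Z < 0 by lia.
have modxj : ((x - j.+1%:Z) %% a%:Z)%Z = x - j.+1%:Z + a%:Z.
  rewrite -[RHS](@modz_small _ a%:Z); last by lia.
  rewrite (_ : x - j.+1%:Z + a%:Z = 1 * a%:Z + (x - j.+1%:Z)); last by lia.
  by rewrite modzMDl.
have gdiv : (gcdn a b %| a)%N by rewrite dvdn_gcdl.
(* Here [eta] is 1, so the two monodromy factors must agree. If gcd(a, b) = a all residues are low.
   Otherwise gcd(a, b) <= a/2, and 4x >= a + 2(j + 1) with x < j + 1 puts both x and x - (j + 1) + a
   off the low residues. *)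
have [ga|ga] := eqVneq (gcdn a b) a.
  by rewrite /frieze_monodromy /low ga !ltz_pmod // mulVf // signr_eq0.
have g2 : (2 * gcdn a b <= a)%N.
  move: ga gdiv; set g := gcdn a b; clearbody g => /eqP ga /dvdnP [q hq].
  case: q hq => [|[|q]] hq; [by lia|by lia|].
  by rewrite hq leq_mul2r orbT.
rewrite /frieze_monodromy /low modxj modz_small //.
by rewrite !ifF ?invr1 ?mulr1 //; lia.
Qed.

Local Notation Phi := (@PhiRE R n b i0 l0 N th).

Lemma period_rep_range i : (a < period_rep n b i <= a + b)%N /\
  exists q : int, i = (period_rep n b i)%:Z + q * b%:Z.
Proof.
rewrite /period_rep; set u := i - (a + 1)%N%:Z.
have h1 : 0 <= (u %% b%:Z)%Z by rewrite modz_ge0; lia.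
have h2 : (u %% b%:Z)%Z < b%:Z by rewrite ltz_pmod; lia.
split; first by lia.
by exists (u %/ b%:Z)%Z; have := divz_eq u b%:Z; rewrite {1}/u; lia.
Qed.

Lemma PhiE rho : stokes_rep b th rho ->
  (forall x, monodromy_coef rho x = HF x) ->
  Phi rho = sign_twist b sg (rep_coef rho).
Proof.
move=> Hrho HE; apply/funext => i; apply/funext => j; rewrite /PhiRE.
have [hm [q hq]] := period_rep_range i; set m := period_rep n b i in hm hq *.
have tc : twisted b HF (rep_coef rho).
  by have := rep_coef_twisted Hrho; have -> : monodromy_coef rho = HF by apply/funext.
have per := sign_twist_periodic HF_sqr sg_subB tc.
have -> : sign_twist b sg (rep_coef rho) i j = sign_twist b sg (rep_coef rho) m%:Z j.
  apply: (periodic_eq (f := fun i => sign_twist b sg (rep_coef rho) i j) (d := b%:Z)).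
    by move=> x; rewrite -per subrK.
  by rewrite hq addrAC subrr add0r dvdz_mull.
have hj := ltn_ord j.
rewrite -addrA /coef_sign /sign_twist eps_signE; last by lia.
rewrite eps_signE; last by lia.
have -> : m%:Z - (1 + b%:Z) = m%:Z - 1 - b%:Z by lia.
rewrite subn1 /= -(eta_entry j Hrho HE hm).
have -> : m%:Z - 1 - b%:Z + b%:Z = m%:Z - 1 by lia.
have -> : m%:Z - 1 - b%:Z - j.+1%:Z + b%:Z = (m - j.+1)%N%:Z - 1 by lia.
move: (lattice_sign _ _ _ _ _) (lattice_sign _ _ _ _ _) (eta _ _ _ _ _ _ _) (stokes_entry _ _ _ _ _ _).
by move=> u v f g; ring.
Qed.

Lemma RF_monodromy rho : @points _ RF rho -> forall x, monodromy_coef rho x = HF x.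
Proof.
move=> [_ /reducedP Hred /frieze_compatibleP Hfr] x; rewrite /frieze_monodromy.
by case: ifPn => lo; [exact: Hfr|exact: Hred].
Qed.

Lemma RF_of_monodromy rho : stokes_rep b th rho ->
  (forall x, monodromy_coef rho x = HF x) -> @points _ RF rho.
Proof.
move=> Hrho HE; split => //.
  by apply/reducedP => x lo; rewrite HE /frieze_monodromy (negbTE (lo : ~~ low a b x)).
by apply/frieze_compatibleP => x lo; rewrite HE /frieze_monodromy (lo : low a b x).
Qed.

Lemma RF_twisted rho : @points _ RF rho -> twisted b HF (rep_coef rho).
Proof.
move=> Hrho; have -> : HF = monodromy_coef rho by apply/funext => x; rewrite RF_monodromy.
by apply: rep_coef_twisted; case: Hrho.
Qed.

Lemma RF_turn rho : @points _ RF rho ->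
  forall x, rep_seq rho (x - b%:Z) = HF x *: rep_seq rho x.
Proof.
by move=> Hrho x; rewrite -(RF_monodromy Hrho); apply: rep_seq_turn; case: Hrho.
Qed.

Lemma Phi_RF rho : @points _ RF rho -> Phi rho = sign_twist b sg (rep_coef rho).
Proof. by move=> Hrho; apply: PhiE; [case: Hrho|apply: RF_monodromy]. Qed.

Lemma Phi_superperiodic rho : @points _ RF rho -> @superperiodic R n b (Phi rho).
Proof.
move=> Hrho; rewrite Phi_RF //; split.
  exact: (sign_twist_periodic HF_sqr sg_subB (RF_twisted Hrho)).
move=> v Hv; exact: (superperiodic_twist sg_sqr HF_sqr sg_subA sg_subB
  (rep_seq_vsolves rho) (rep_seq_window rho 0) (RF_turn Hrho) Hv).
Qed.

Definition equation_rep (alpha : int -> 'I_n -> C) : stokes_data R n N :=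
  mk_rep HF (sign_untwist b sg alpha).

Let HF0 := sign_monodromy_neq0 HF_sqr.

Section EquationRep.
Variable alpha : int -> 'I_n -> C.
Hypothesis Halpha : superperiodic b alpha.
Local Notation c := (sign_untwist b sg alpha).

Let tc : twisted b HF c.
Proof. by apply: (sign_untwist_twisted HF_sqr sg_subB); case: Halpha. Qed.

(** The frame and its recessive sequence exist before the monodromy is known. Superperiodicity makes
    the sequence quasi-periodic, and [frame_monodromy] turns this into h S_N ... S_1 = 1. *)
Lemma equation_monodromy : zprod (stokes_mx c) (4 * b%:Z) = hmx HF.
Proof.
pose F := zprod (stokes_mx c).
have HF' (t : int) : F (t - 1) = F t * stokes_mx c t.
  by apply: zprodP => z; apply: stokes_mx_unit.
have sV := frame_seq_vsolves HF'.
have uV : window (frame_seq i0 F) 0 \in unitmx.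
  by apply: (frame_window_unit HF'); rewrite /F zprod0 unitmx1.
apply: (frame_monodromy (m := 0) HF_periodic HF0 tc HF' _ sV uV).
  exact: zprod0.
apply: (quasiperiodic_untwist sg_sqr HF_sqr sg_subA sg_subB sV).
by move=> v Hv; case: Halpha => _ /(_ v Hv).
Qed.

Lemma equation_rep_stokes_rep : stokes_rep b th (equation_rep alpha).
Proof. exact: (mk_rep_stokes_rep HF_periodic HF0 equation_monodromy). Qed.

Lemma equation_rep_RF : @points _ RF (equation_rep alpha).
Proof.
apply: (RF_of_monodromy equation_rep_stokes_rep) => x.
by apply: mk_rep_monodromy; exact: HF_periodic.
Qed.

Lemma equation_repK : Phi (equation_rep alpha) = alpha.
Proof.
rewrite (Phi_RF equation_rep_RF).
have -> : rep_coef (equation_rep alpha) = c.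
  exact: (mk_rep_coef HF_periodic HF0 tc equation_monodromy).
exact: (sign_untwistK b sg_sqr).
Qed.

End EquationRep.

Lemma PhiK rho : @points _ RF rho -> equation_rep (Phi rho) = rho.
Proof.
move=> Hrho; rewrite Phi_RF // /equation_rep (sign_twistK b sg_sqr).
have -> : HF = monodromy_coef rho by apply/funext => x; rewrite RF_monodromy.
by apply: mk_repK; case: Hrho.
Qed.

Lemma Phi_pullback f : @regfun _ (Eab R n b) f ->
  @regfun _ RF (fun rho => f (Phi rho)).
Proof.
apply: generated_pullback => [rho|_ [i [j ->]]]; first exact: Phi_superperiodic.
apply: generated_scale; rewrite -addrA.
have [y -> {i}] : exists y, i0 + ((period_rep n b i)%:Z - 1) = i0 + y by eexists.
set w := y + arrow_turn y j * b%:Z.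
have H : regular_mx (@points _ RF) (@stokes_coord R n N)
    (fun rho => stokes_at rho (a%:Z + j.+1.*2%:Z - 4 * w)).
  by apply: regular_prod_mx => m _; apply: regular_stokes_matrix.
apply: (gen_ext (H (res (w - j.+1%:Z)) (res w))) => rho _.
by rewrite stokes_entryE.
Qed.

Lemma equation_rep_pullback f : @regfun _ RF f ->
  @regfun _ (Eab R n b) (fun alpha => f (equation_rep alpha)).
Proof.
apply: generated_pullback => [alpha|]; first exact: equation_rep_RF.
move=> _ [[k [k' ->]]|[m [k [k' ->]]]]; first exact: gen_const.
have H : regular_mx (@superperiodic R n b)
    [set f | exists i j, f = fun alpha : int -> 'I_n -> C => alpha i j]
    (fun alpha => stokes_mx (sign_untwist b sg alpha) (tm m)).
  apply: regular_stokes_mx => y j.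
  apply: generated_scale; apply: generated_scale; apply: gen_base.
  by exists (y + (1 + b%:Z)), j.
by apply: (gen_ext (H k k')) => alpha _; rewrite ffunE.
Qed.

Lemma Phi_isomorphism : @isomorphism _ RF (Eab R n b) Phi.
Proof.
apply: (@isomorphism_of_inverse _ RF (Eab R n b) Phi equation_rep).
- exact: affine_ext_closed.
- exact: Phi_superperiodic.
- exact: equation_rep_RF.
- exact: PhiK.
- exact: equation_repK.
- exact: Phi_pullback.
- exact: equation_rep_pullback.
Qed.

Lemma equation_rep_isomorphism : @isomorphism _ (Eab R n b) RF equation_rep.
Proof.
apply: (@isomorphism_of_inverse _ (Eab R n b) RF equation_rep Phi).
- exact: affine_ext_closed.
- exact: equation_rep_RF.
- exact: Phi_superperiodic.
- exact: equation_repK.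
- exact: PhiK.
- exact: equation_rep_pullback.
- exact: Phi_pullback.
Qed.

Lemma nondegenerate_projective (M M' : 'M[C]_(n.+1, b)) :
  Defs.nondegenerate M -> projective_equiv M M' -> Defs.nondegenerate M'.
Proof.
move=> HM [g [d [ug d0 ->]]] m.
set f := fun t : 'I_n.+1 => iter t (@ordS b) m.
have -> : colsub f (g *m M *m diag_mx d) =
    g *m colsub f M *m diag_mx (\row_t d 0 (f t)).
  apply/matrixP => k t; rewrite [LHS]mxE !mul_mx_diag [LHS]mxE [RHS]mxE.
  congr (_ * _); last by rewrite mxE.
  by rewrite !mxE; apply: eq_bigr => l _; rewrite mxE.
rewrite !unitmx_mul ug (HM m) /=; apply: diag_mx_unit => t.
by rewrite mxE.
Qed.

Lemma polygon_class_projective (M M' : 'M[C]_(n.+1, b)) :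
  Defs.nondegenerate M -> projective_equiv M M' ->
  polygon_class M' = polygon_class M.
Proof.
move=> HM MM'; have HM' := nondegenerate_projective HM MM'.
apply/(@git_class_eq _ (polygons R n b) (@projective_equiv R n b) M' M HM).
apply: (@git_equiv_of_orbit _ (polygons R n b)) HM' HM _.
exact: projective_equiv_sym.
Qed.

Lemma equation_class_Phi rho : @points _ RF rho ->
  @equation_class R n b (Phi rho) = polygon_class (vertices rho).
Proof.
move=> Hrho; have [Hrep _ _] := Hrho.
(* The signed recessive sequence solves the difference equation; its vertex i = m + 1 is, up to
   sign, the recessive vector at position m - b. *)
pose U (i : int) := sg (i - (1 + b%:Z)) *: rep_seq rho (i - (1 + b%:Z)).
have UE k x : U x k 0 = sg (x - (1 + b%:Z)) * rep_seq rho (x - (1 + b%:Z)) k 0.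
  by rewrite /U [LHS]mxE.
have sU : vsolves (signed_coef (Phi rho)) ((-1) ^+ n) U.
  apply/vsolvesP => k; rewrite Phi_RF //.
  have /vsolvesP /(_ k) /(solves_twist b sg_sqr sg_subA) H := rep_seq_vsolves rho.
  by have -> : (fun x => U x k 0) = (fun x => sg (x - (1 + b%:Z)) *
    rep_seq rho (x - (1 + b%:Z)) k 0) by apply/funext => x; apply: UE.
have s0 x : sg x != 0 by exact: (sign_neq0 sg_sqr).
have uU : window U 0 \in unitmx.
  apply: unitmx_kernel => xi Hxi.
  apply: (can_inj (mulmxK (rep_seq_window rho (- (1 + b%:Z))))); rewrite mul0mx.
  apply/matrixP => i y; have E := congr1 (fun A : 'rV[C]_a => A 0 y) Hxi.
  rewrite /= row_window [RHS]mxE in E.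
  rewrite ord1 row_window [RHS]mxE.
  suff /eqP -> : xi *m rep_seq rho (- (1 + b%:Z) - (y : nat)%:Z) == 0 by rewrite mxE.
  rewrite -(row_scale_eq0 _ _ (s0 (- (1 + b%:Z) - (y : nat)%:Z))).
  apply/eqP/matrixP => k l; rewrite !ord1 [RHS]mxE -[RHS]E /U.
  by rewrite (_ : 0 - (y : nat)%:Z - (1 + b%:Z) = - (1 + b%:Z) - (y : nat)%:Z) //; lia.
have e0 : (-1) ^+ n != 0 :> C by rewrite signr_eq0.
have vU : projective_equiv (vertices rho) (basis_polygon b U).
  exists 1%:M, (\row_m sg ((m : nat)%:Z - b%:Z)); split.
  - exact: unitmx1.
  - by move=> m; rewrite mxE.
  apply/matrixP => k m; rewrite mul1mx mul_mx_diag mxE [RHS]mxE recessive_polygonE //.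
  rewrite UE [(\row_m _) _ _]mxE mulrC.
  by rewrite (_ : m.+1%:Z - (1 + b%:Z) = (m : nat)%:Z - b%:Z) //; lia.
have nd := recessive_nondegenerate Hrep.
have ndU := nondegenerate_projective nd vU.
have cU := polygon_class_projective nd vU.
apply/seteqP; split => M.
  (* Any other basis of solutions is a linear image of [U], which gives a projectively equivalent
     polygon. *)
  move=> [V [[HV spanV] HM]]; rewrite -cU.
  have [|v /spanV [xi [Hxi _]]|g ug gE] := basis_change e0 sU uU (U := V).
  - by apply/vsolvesP.
  - by exists xi.
  rewrite -(polygon_class_projective ndU (M' := basis_polygon b V)) //.
  exists g, (const_mx 1); split => //; first by move=> m; rewrite mxE oner_eq0.
  rewrite diag_const_mx mulmx1; apply/matrixP => k m; rewrite mxE gE [LHS]mxE [RHS]mxE.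
  by apply: eq_bigr => l _; congr (_ * _); rewrite [RHS]mxE.
move=> HM; exists U; rewrite cU; split => //; split.
  by have /vsolvesP H := sU; exact: H.
by move=> v Hv; apply: (solves_expand_unique e0 sU uU).
Qed.

Section CoprimeCase.
Hypothesis cab : coprime a b.

Lemma Rred_RF rho : @points _ Rred rho -> @points _ RF rho.
Proof.
move=> [Hrep Hred]; apply: RF_of_monodromy => // x.
have g1 : gcdn a b = 1%N by apply/eqP.
have lowE y : low a b y = (a%:Z %| y)%Z.
  rewrite /low g1; have h : 0 <= (y %% a%:Z)%Z by rewrite modz_ge0.
  by apply/idP/dvdz_mod0P; lia.
rewrite /frieze_monodromy; case: ifPn => lo; last by move/reducedP: Hred => ->.
have := prod_monodromy (oner_neq0 C) (rep_seq_vsolves rho) (rep_seq_window rho 0)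
  n%:Z (rep_seq_turn Hrep).
rewrite (bigD1 ord_max) //= big1 => [|y ny]; last first.
  move/reducedP: Hred => -> //; rewrite /in_low lowE; apply/negP.
  have yn : (y < n)%N.
    by rewrite ltn_neqAle -ltnS ltn_ord andbT; apply: contra ny => /eqP e; apply/eqP/val_inj.
  by move/dvdz_small; lia.
rewrite !mulr1 subrr => E.
have -> : monodromy_coef rho x = monodromy_coef rho 0.
  by apply: (periodic_eq (monodromy_coef_periodic rho)); rewrite subr0 -lowE.
have e2 : ((-1) ^+ n) ^+ b * ((-1) ^+ n) ^+ b = 1 :> C.
  by rewrite -exprMn signr_sqr expr1n.
rewrite -[LHS]mulr1 -e2 mulrA E mul1r /frieze_sign g1 !divn1.
(* The determinants give (-1)^((a - 1) b), which is the frieze-compatible sign (-1)^((b - a)(a - 1))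
   because a (a - 1) is even. *)
rewrite -exprM -signr_odd -[RHS]signr_odd; congr (_ ^+ nat_of_bool _).
by rewrite !oddM oddB ?(ltnW hab) //= ; case: (odd n); case: (odd b).
Qed.

Lemma RF_Rred_points : @points _ RF = @points _ Rred.
Proof.
apply/seteqP; split => rho; last exact: Rred_RF.
by move=> [].
Qed.

(** For coprime a and b a minimal framing is a scalar matrix, and conjugation by it is trivial. *)
Lemma framing_trivial rho rho' : framing_equiv b rho rho' -> rho = rho'.
Proof.
move=> [d [d0 dp e1 e2]]; have g1 : gcdn a b = 1%N by apply/eqP.
have dE k : d 0 k = d 0 ord0 by apply: dp; rewrite /gab g1 !modn1.
have conj1 (A : 'M[C]_a) : diag_mx d *m A *m invmx (diag_mx d) = A.
  by apply/matrixP => k k'; rewrite diag_conjE // !dE mulrAC mulfV ?mul1r.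
rewrite [LHS]surjective_pairing [RHS]surjective_pairing e1 conj1; congr (_, _).
by apply/ffunP => m; rewrite e2 conj1.
Qed.

Local Notation Bab := (wild_character_variety n b i0 th).
Local Notation forget := (@wild_class R n b i0 N th).

Lemma forget_isomorphism : @isomorphism _ RF Bab forget.
Proof.
have [|rho rho' E|[hX hI hS] hreg] := @git_trivial _ _ (@points _ Rred) (@stokes_coord R n N)
    (@framing_equiv R n b N).
- by move=> rho rho' _ _; apply: framing_trivial.
- rewrite [LHS]surjective_pairing [RHS]surjective_pairing; congr (_, _).
    by apply/matrixP => k k'; apply: (E (fun rho => rho.1 k k')); left; exists k, k'.
  apply/ffunP => m; apply/matrixP => k k'.
  by apply: (E (fun rho => rho.2 m k k')); right; exists m, k, k'.
split; first by rewrite RF_Rred_points; split.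
move=> f; rewrite /= -/(@points _ RF) RF_Rred_points; exact: hreg.
Qed.

End CoprimeCase.

End FriezeCompatible.

End Representations.

Lemma coef_sign_pm1 (R : realType) (n b : nat) (i0 l0 : int) (i j : nat) :
  coef_sign R n b i0 l0 i j = 1 \/ coef_sign R n b i0 l0 i j = -1.
Proof.
have pm (m : nat) : ((-1) ^+ m = 1 :> R[i]) \/ ((-1) ^+ m = -1 :> R[i]).
  by rewrite -signr_odd; case: (odd m); [right|left]; rewrite ?expr1 ?expr0.
have mulpm (x y : R[i]) : (x = 1 \/ x = -1) -> (y = 1 \/ y = -1) ->
    (x * y = 1 \/ x * y = -1).
  by move=> [->|->] [->|->]; rewrite ?mulr1 ?mul1r ?mulrNN ?mulr1; tauto.
have eps_pm m : eps_sign R n b m = 1 \/ eps_sign R n b m = -1.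
  rewrite /eps_sign; case: ifP => _; first by left.
  by case: xgetP => [_ _ [? [? [? [_ _ _ ->]]]]|_]; [exact: pm|left].
have h_pm m : h_sign R n b m = 1 \/ h_sign R n b m = -1.
  by rewrite /h_sign; case: ifP => _; [exact: pm|left].
have inv_pm (x : R[i]) : (x = 1 \/ x = -1) -> (x^-1 = 1 \/ x^-1 = -1).
  by move=> [->|->]; rewrite ?invrN invr1; tauto.
apply: (mulpm); last first.
  rewrite /eta; case: ifP => _; last by left.
  by apply: mulpm; [apply: inv_pm|]; apply: h_pm.
by apply: (mulpm); [apply: (mulpm); apply: eps_pm|exact: pm].
Qed.

Theorem theorem1p2 (R : realType) (n b : nat) (hab : (n.+1 < b)%N)
    (i0 l0 : int) (hl0 : odd `|l0|%N) :
  \forall vt \near (decay_angle R n b i0 l0)^'+,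
  forall (N : nat) (th : N.-tuple R), singular_angles n b vt th ->
  let RFab := RF n b i0 th in
  let Bab := wild_character_variety n b i0 th in
  let Phi := @PhiRE R n b i0 l0 N th in
  let vertices := @recessive_polygon R n b i0 l0 N th in
  let forget := @wild_class R n b i0 N th in
  [/\ (forall i j : nat, (n.+1 < i <= n.+1 + b)%N -> (1 <= j <= n)%N ->
         coef_sign R n b i0 l0 i j = 1 \/ coef_sign R n b i0 l0 i j = -1),
      @isomorphism _ RFab (Eab R n b) Phi,
      orbit_bijection (X := Rred n b i0 th) (Y := polygons R n b)
        (@framing_equiv R n b N) (@projective_equiv R n b) vertices,
      (exists beta : ambient Bab -> ambient (Pab R n b),
        [/\ isomorphism beta,
            forall rho, @points _ (Rred n b i0 th) rho ->
              beta (forget rho) = polygon_class (vertices rho) &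
            forall rho, @points _ RFab rho ->
              beta (forget rho) = equation_class (Phi rho)]) &
      coprime n.+1 b ->
        [/\ @isomorphism _ RFab Bab forget,
            @isomorphism _ (Eab R n b) (Pab R n b) (@equation_class R n b),
            isomorphic (Fab R n b) (Eab R n b) &
            isomorphic (Eab R n b) Bab]].
Proof.
have b0 : (0 < b)%N by apply: leq_ltn_trans hab.
(* Singular directions lie at integer times, so it is close enough for [vt] to precede time 1. *)
have lt01 : decay_angle R n b i0 l0 < angle R n b i0 l0 1.
  by rewrite -[X in X < _](_ : angle R n b i0 l0 0 = _) ?ltr_angle // /angle mulr0 addr0.
near=> vt.
have hvt : angle R n b i0 l0 0 < vt < angle R n b i0 l0 1.
  apply/andP; split; last by near: vt; apply: nbhs_right_lt.
  rewrite /angle mulr0 addr0; near: vt; exact: nbhs_right_gt.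
move=> N th Hth.
set RFab := RF n b i0 th; set Bab := wild_character_variety n b i0 th.
set Phi := @PhiRE R n b i0 l0 N th; set forget := @wild_class R n b i0 N th.
have [tm [tmE tm_range tm_surj tm_sorted]] := singular_times b0 hl0 hvt Hth.
have isoPhi : @isomorphism _ RFab (Eab R n b) Phi.
  exact: (Phi_isomorphism b0 hl0 tmE tm_range tm_surj tm_sorted hab).
have [beta [iso_beta betaE]] :=
  vertices_git_isomorphism b0 hl0 tmE tm_range tm_surj tm_sorted.
have RFred rho : @points _ RFab rho -> @points _ (Rred n b i0 th) rho by case.
have classE rho : @points _ RFab rho -> beta (forget rho) = equation_class (Phi rho).
  move=> Hrho; rewrite betaE; last exact: RFred.
  apply/esym.
  exact: (equation_class_Phi b0 hl0 tmE tm_range tm_surj tm_sorted hab Hrho).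
split => //.
- by move=> i j _ _; exact: coef_sign_pm1.
- exact: (vertices_orbit_bijection b0 hl0 tmE tm_range tm_surj tm_sorted).
- by exists beta; split.
move=> cab.
have iso_forget : @isomorphism _ RFab Bab forget.
  exact: (forget_isomorphism b0 hl0 tmE tm_range tm_sorted hab cab).
have iso_inv : @isomorphism _ (Eab R n b) RFab _ :=
  equation_rep_isomorphism b0 hl0 tmE tm_range tm_surj tm_sorted hab.
have isoEB := isomorphism_comp iso_inv iso_forget.
split => //.
- apply: (isomorphism_ext (X := Eab R n b) (Y := Pab R n b) _ _
    (isomorphism_comp isoEB iso_beta)).
    exact: affine_ext_closed.
  move=> alpha Ha; rewrite classE.
    congr (equation_class _).
    exact: (equation_repK b0 hl0 tmE tm_range tm_surj tm_sorted hab Ha).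
  exact: (equation_rep_RF b0 hl0 tmE tm_range tm_surj tm_sorted hab Ha).
- by exists (@frieze_equation _ n b); exact: (@frieze_isomorphism R[i] n b hab).
- by eexists; exact: isoEB.
Unshelve. all: by end_near.
Qed.
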